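(* Let $0<\gamma<1$ and $1<p\leq\infty$, let $q$ be the exponent conjugate to $p$, and let $\alpha\in\mathbb{R}$. (1) If $\alpha<\frac{1-\gamma}{\max(2,q)}$, there exist a $\mathcal{U}_{\beta^\gamma}$-frequently hypercyclic function $f\in H(\mathbb{D})$ for $T_\alpha$ and a constant $C>0$ such that $M_p(f,r)\leq C(1-r)^{\alpha-\frac{1-\gamma}{\max(2,q)}}$ for all $0<r<1$. (2) If $\alpha>\frac{1-\gamma}{\max(2,q)}$, there exist a $\mathcal{U}_{\beta^\gamma}$-frequently hypercyclic function $f\in H(\mathbb{D})$ for $T_\alpha$ and a constant $C>0$ such that $M_p(f,r)\leq C$ for all $0<r<1$.
   Context: $\mathbb{D}$ is the open unit disc in $\mathbb{C}$ and $H(\mathbb{D})$ is the Fréchet space of analytic functions on $\mathbb{D}$ with the topology of uniform convergence on compact subsets. For $\alpha\in\mathbb{R}$ and $n\ge1$ put $w_n(\alpha)=(1+\frac1n)^{\alpha}$; the weighted Taylor shift $T_\alpha:H(\mathbb{D})\to H(\mathbb{D})$ is $T_\alpha\big(\sum_{k\ge0}a_kz^k\big)=\sum_{k\ge0}a_{k+1}w_{k+1}(\alpha)z^k$. For $0\le\gamma\le1$ and $E\subset\mathbb{N}$, the upper $\beta^\gamma$-density is $\overline d_{\beta^\gamma}(E)=\limsup_{n\to\infty}\frac{\sum_{1\le k\le n,\,k\in E}e^{k^\gamma}}{\sum_{k=1}^ne^{k^\gamma}}$. A function $f\in H(\mathbb{D})$ is $\mathcal{U}_{\beta^\gamma}$-frequently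 hypercyclic for $T_\alpha$ if for every non-empty open set $U\subset H(\mathbb{D})$, $\overline d_{\beta^\gamma}(\{n\in\mathbb{N}:T_\alpha^nf\in U\})>0$. For $0<r<1$, $M_p(f,r)=\big(\frac1{2\pi}\int_0^{2\pi}|f(re^{i\theta})|^p\,d\theta\big)^{1/p}$ if $1\le p<\infty$, and $M_\infty(f,r)=\sup_{0\le t\le2\pi}|f(re^{it})|$. The conjugate exponent $q$ satisfies $\frac1p+\frac1q=1$ ($q=1$ if $p=\infty$). *)

(* Defs.v *)
From Stdlib Require Import Reals List ClassicalEpsilon.
From Coquelicot Require Import Coquelicot.

Open Scope R_scope.

Definition disc (z : C) : Prop := Cmod z < 1.

Definition is_Cpseries (a : nat -> C) (z l : C) : Prop :=
  @is_pseries C_AbsRing C_NormedModule a z l.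

Definition analytic_at (f : C -> C) (z0 : C) : Prop :=
  exists a : nat -> C,
    @locally C_UniformSpace z0 (fun z => is_Cpseries a (Cminus z z0) (f z)).

(* The space H(D).  The values outside the disc are irrelevant: open sets
   (see HD_open) do not distinguish functions that agree on the disc. *)
Record HD : Type := mkHD {
  HD_fun :> C -> C;
  HD_analytic : forall z, disc z -> analytic_at HD_fun z
}.

Definition compactC (K : C -> Prop) : Prop :=
  forall (I : Type) (V : I -> C -> Prop),
    (forall i, @open C_UniformSpace (V i)) ->
    (forall z, K z -> exists i, V i z) ->
    exists l : list I, forall z, K z -> exists i, In i l /\ V i z.

(* Topology of uniform convergence on the compact subsets of the disc. *)
Definition HD_open (U : HD -> Prop) : Prop :=
  forall f : HD, U f ->
    exists (K : C -> Prop) (eps : R),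
      compactC K /\ (forall z, K z -> disc z) /\ 0 < eps /\
      forall g : HD, (forall z, K z -> Cmod (Cminus (g z) (f z)) < eps) -> U g.

(* Only used for n >= 1. *)
Definition weight (alpha : R) (n : nat) : R := Rpower (1 + / INR n) alpha.

Definition is_taylor_shift (alpha : R) (f g : HD) : Prop :=
  exists a : nat -> C,
    (forall z, disc z -> is_Cpseries a z (f z)) /\
    (forall z, disc z ->
       is_Cpseries (fun k => Cmult (a (S k)) (RtoC (weight alpha (S k)))) z (g z)).

(* Every f in H(D) is the sum on the disc of its Taylor series at 0, and the
   shifted weighted series also converges on the disc; so a g as below exists,
   and its values on the disc are determined by f. *)
Definition taylor_shift (alpha : R) (f : HD) : HD :=
  epsilon (inhabits f) (is_taylor_shift alpha f).

Definition beta (gamma : R) (k : nat) : R := exp (Rpower (INR k) gamma).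

Definition restrict (E : nat -> Prop) (u : nat -> R) (k : nat) : R :=
  if excluded_middle_informative (E k) then u k else 0.

Definition upper_density (gamma : R) (E : nat -> Prop) : Rbar :=
  LimSup_seq (fun n =>
    sum_n_m (restrict E (beta gamma)) 1 n / sum_n_m (beta gamma) 1 n).

Definition U_freq_hypercyclic (gamma : R) (T : HD -> HD) (f : HD) : Prop :=
  forall U : HD -> Prop, HD_open U -> (exists g, U g) ->
    Rbar_lt 0 (upper_density gamma (fun n => U (Nat.iter n T f))).

(* x^a for x >= 0 and a > 0; Rpower 0 a would be 1. *)
Definition pow_nonneg (x a : R) : R :=
  if Rlt_dec 0 x then Rpower x a else 0.

Definition circle_point (r t : R) : C := (r * cos t, r * sin t).

(* Valued in Rbar so that the supremum is a genuine one; the value at m_infty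
   is irrelevant. *)
Definition M_p (p : Rbar) (f : C -> C) (r : R) : Rbar :=
  match p with
  | Finite p =>
      Finite (pow_nonneg
        (/ (2 * PI) *
         RInt (fun t => pow_nonneg (Cmod (f (circle_point r t))) p) 0 (2 * PI))
        (/ p))
  | _ => Lub_Rbar (fun x => exists t, 0 <= t <= 2 * PI /\
                              x = Cmod (f (circle_point r t)))
  end.

Definition conjugate (p : Rbar) (q : R) : Prop :=
  match p with
  | Finite p => / p + / q = 1
  | p_infty => q = 1
  | m_infty => False
  end.

(* Main.v *)
From Stdlib Require Import Arith Reals Lra Lia List ClassicalEpsilon Classical Cantor.
From Coquelicot Require Import Coquelicot.
Require Import Defs.

(** The coordinates [nu alpha k * a k], with [nu alpha k = (k + 1) ^ alpha],
    turn the weighted shift into the plain backward shift. The orbit of [f]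
    therefore comes close to a polynomial whenever the rescaled coefficients
    of [f] repeat those of the polynomial and are then followed by a long
    enough gap. As [e ^ (k ^ gamma)] grows by a constant factor over a length
    [k ^ (1 - gamma)], the total weight up to [N] is, up to a constant,
    carried by a window of that length ending at [N]. It is thus enough to
    place copies of each polynomial at a positive proportion of the positions
    of one window, for infinitely many windows; these may be as sparse as
    desired.

    The function [f] is a sum of blocks. A block is, up to constants, a
    polynomial [N ^ (- alpha) * z ^ N * U z * K (z ^ s)]: here [U] is a
    pattern from a countable dense family and [K] a kernel of order comparable
    to [N ^ (1 - gamma)], with a positive proportion of coefficients equal to
    1; the gap [s] depends on the pattern only. The kernel is chosen with the
    smallest possible means: Rudin-Shapiro polynomials for [q <= 2]
    ([rudin_shapiro_kernel]), whose supremum is of the order of the square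
    root of the degree, and a product of two Dirichlet kernels for [q > 2]
    ([trapezoid_kernel]), whose mean of order [p] is of the order of the power
    [1 / q] of the degree. A kernel shorter than its window by a factor that
    depends on the pattern compensates for the size of the pattern without
    destroying the positive density. The mean of a block on the circle of
    radius [r] is then at most a constant times [N ^ tau * r ^ N], with [tau =
    (1 - gamma) / max (2, q) - alpha] ([universal_function]). Over lacunary
    [N] these terms sum to [O ((1 - r) ^ (- tau))] if [tau > 0]
    ([lacunary_sum_le]) and to [O (1)] if [tau < 0] ([lacunary_sum_bounded]).

    Density of the patterns requires that a function which is analytic at each
    point of the disc is the sum of its Taylor series at 0
    ([taylor_series_on_disc]). This is proved without complex integration
    along paths: re-expansion at points near the boundary of the disc of
    convergence, with a radius and a bound that are uniform by compactness,
    forces the Taylor coefficients to be smaller than that disc allows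
    ([taylor_coefficients_bound]). *)

Open Scope R_scope.
Set Bullet Behavior "Strict Subproofs".

(** * Finite sums and convergence in the complex plane *)

Fixpoint Csum (f : nat -> C) (n : nat) : C :=
  match n with O => RtoC 0 | S n => (Csum f n + f n)%C end.

Fixpoint Rsum (f : nat -> R) (n : nat) : R :=
  match n with O => 0 | S n => Rsum f n + f n end.

Lemma Csum_ext : forall f g n,
  (forall k, (k < n)%nat -> f k = g k) -> Csum f n = Csum g n.
Proof.
  intros f g n; induction n as [|n IH]; intros H; simpl; auto.
  rewrite IH, H; auto.
Qed.

Lemma Rsum_ext : forall f g n,
  (forall k, (k < n)%nat -> f k = g k) -> Rsum f n = Rsum g n.
Proof.
  intros f g n; induction n as [|n IH]; intros H; simpl; auto.
  rewrite IH, H; auto.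
Qed.

Lemma Csum_plus : forall f g n,
  Csum (fun k => f k + g k)%C n = (Csum f n + Csum g n)%C.
Proof. intros f g n; induction n as [|n IH]; simpl; [ring|rewrite IH; ring]. Qed.

Lemma Csum_scal : forall c f n,
  Csum (fun k => c * f k)%C n = (c * Csum f n)%C.
Proof. intros c f n; induction n as [|n IH]; simpl; [ring|rewrite IH; ring]. Qed.

Lemma Csum_minus : forall f g n,
  Csum (fun k => f k - g k)%C n = (Csum f n - Csum g n)%C.
Proof. intros f g n; induction n as [|n IH]; simpl; [ring|rewrite IH; ring]. Qed.

Lemma Csum_zero : forall f n,
  (forall k, (k < n)%nat -> f k = RtoC 0) -> Csum f n = RtoC 0.
Proof.
  intros f n; induction n as [|n IH]; intros H; simpl; auto.
  rewrite IH, H; auto; ring.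
Qed.

Lemma Csum_split : forall f n m,
  Csum f (n + m) = (Csum f n + Csum (fun k => f (n + k)%nat) m)%C.
Proof.
  intros f n m; induction m as [|m IH]; simpl.
  - rewrite Nat.add_0_r; ring.
  - rewrite Nat.add_succ_r; simpl; rewrite IH; ring.
Qed.

Lemma Csum_swap : forall (f : nat -> nat -> C) n m,
  Csum (fun i => Csum (fun j => f i j) m) n =
  Csum (fun j => Csum (fun i => f i j) n) m.
Proof.
  intros f n m; induction n as [|n IH]; simpl.
  - symmetry; apply Csum_zero; auto.
  - rewrite IH, <- Csum_plus; reflexivity.
Qed.

Lemma Csum_extend : forall f n m, (n <= m)%nat ->
  (forall k, (n <= k < m)%nat -> f k = RtoC 0) -> Csum f m = Csum f n.
Proof.
  intros f n m Hnm H. replace m with (n + (m - n))%nat by lia.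
  rewrite Csum_split, (Csum_zero _ (m - n)).
  - ring.
  - intros k Hk; apply H; lia.
Qed.

Lemma Csum_single : forall f n k0, (k0 < n)%nat ->
  (forall k, (k < n)%nat -> k <> k0 -> f k = RtoC 0) -> Csum f n = f k0.
Proof.
  intros f n k0 Hk H.
  rewrite (Csum_extend f (S k0) n); [|lia|intros; apply H; lia].
  simpl; rewrite Csum_zero; [ring|intros; apply H; lia].
Qed.

Lemma Rsum_plus : forall f g n,
  Rsum (fun k => f k + g k) n = Rsum f n + Rsum g n.
Proof. intros f g n; induction n as [|n IH]; simpl; [ring|rewrite IH; ring]. Qed.

Lemma Rsum_scal : forall c f n, Rsum (fun k => c * f k) n = c * Rsum f n.
Proof. intros c f n; induction n as [|n IH]; simpl; [ring|rewrite IH; ring]. Qed.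

Lemma Rsum_le : forall f g n,
  (forall k, (k < n)%nat -> f k <= g k) -> Rsum f n <= Rsum g n.
Proof.
  intros f g n; induction n as [|n IH]; intros H; simpl; [lra|].
  apply Rplus_le_compat; auto.
Qed.

Lemma Rsum_nonneg : forall f n,
  (forall k, (k < n)%nat -> 0 <= f k) -> 0 <= Rsum f n.
Proof.
  intros f n; induction n as [|n IH]; intros H; simpl; [lra|].
  apply Rplus_le_le_0_compat; auto.
Qed.

Lemma Rsum_split : forall f n m,
  Rsum f (n + m) = Rsum f n + Rsum (fun k => f (n + k)%nat) m.
Proof.
  intros f n m; induction m as [|m IH]; simpl.
  - rewrite Nat.add_0_r; ring.
  - rewrite Nat.add_succ_r; simpl; rewrite IH; ring.
Qed.

Lemma Rsum_mono : forall f n m, (n <= m)%nat -> (forall k, 0 <= f k) ->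
  Rsum f n <= Rsum f m.
Proof.
  intros f n m Hnm H. replace m with (n + (m - n))%nat by lia.
  rewrite Rsum_split.
  pose proof (Rsum_nonneg (fun k => f (n + k)%nat) (m - n) (fun k _ => H _)). lra.
Qed.

Lemma Rsum_const : forall c n, Rsum (fun _ => c) n = INR n * c.
Proof.
  intros c n; induction n as [|n IH]; [simpl; ring|].
  simpl Rsum; rewrite IH, S_INR; ring.
Qed.

Lemma Cmod_Csum : forall f n, Cmod (Csum f n) <= Rsum (fun k => Cmod (f k)) n.
Proof.
  intros f n; induction n as [|n IH]; simpl.
  - rewrite Cmod_0; lra.
  - eapply Rle_trans; [apply Cmod_triangle|lra].
Qed.

Lemma Rsum_geom_le : forall q n, 0 <= q < 1 -> Rsum (fun k => q ^ k) n <= / (1 - q).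
Proof.
  intros q n Hq.
  assert (H : (1 - q) * Rsum (fun k => q ^ k) n = 1 - q ^ n).
  { induction n as [|n IH]; simpl; [ring|]. rewrite Rmult_plus_distr_l, IH; ring. }
  apply Rmult_le_reg_l with (1 - q); [lra|].
  rewrite H, Rinv_r by lra. pose proof (pow_le q n (proj1 Hq)). lra.
Qed.

Lemma Cmod_minus_sym : forall x y, Cmod (x - y)%C = Cmod (y - x)%C.
Proof. intros x y. replace (y - x)%C with (- (x - y))%C by ring. now rewrite Cmod_opp. Qed.

Lemma Cmod_minus_triangle : forall x y z,
  Cmod (x - z)%C <= Cmod (x - y)%C + Cmod (y - z)%C.
Proof.
  intros x y z. replace (x - z)%C with ((x - y) + (y - z))%C by ring.
  apply Cmod_triangle.
Qed.

Lemma Cmod_lt_box : forall (z : C) d, Rabs (fst z) < d -> Rabs (snd z) < d -> Cmod z < 2 * d.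
Proof.
  intros z d H1 H2. eapply Rle_lt_trans; [apply Cmod_2Rmax|].
  assert (Hm : Rmax (Rabs (fst z)) (Rabs (snd z)) < d) by (apply Rmax_lub_lt; auto).
  assert (Hm0 : 0 <= Rmax (Rabs (fst z)) (Rabs (snd z)))
    by (eapply Rle_trans; [apply Rabs_pos|apply Rmax_l]).
  assert (Hs : sqrt 2 < 2).
  { rewrite <- (sqrt_Rsqr 2) at 2 by lra. apply sqrt_lt_1; unfold Rsqr; lra. }
  nra.
Qed.

Definition Cconv (u : nat -> C) (l : C) : Prop :=
  forall eps, 0 < eps -> exists N, forall n, (N <= n)%nat -> Cmod (u n - l)%C < eps.

Lemma Cconv_ext : forall u v l N0,
  (forall n, (N0 <= n)%nat -> u n = v n) -> Cconv u l -> Cconv v l.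
Proof.
  intros u v l N0 H Hu eps He. destruct (Hu eps He) as [N HN].
  exists (max N0 N). intros n Hn. rewrite <- H by lia. apply HN; lia.
Qed.

Lemma Cconv_const : forall c, Cconv (fun _ => c) c.
Proof.
  intros c eps He. exists O. intros n _.
  replace (c - c)%C with (RtoC 0) by ring. rewrite Cmod_0; auto.
Qed.

Lemma Cconv_plus : forall u v l m, Cconv u l -> Cconv v m ->
  Cconv (fun n => u n + v n)%C (l + m)%C.
Proof.
  intros u v l m Hu Hv eps He.
  destruct (Hu (eps / 2)) as [N HN]; [lra|]. destruct (Hv (eps / 2)) as [M HM]; [lra|].
  exists (max N M). intros n Hn.
  replace (u n + v n - (l + m))%C with ((u n - l) + (v n - m))%C by ring.
  eapply Rle_lt_trans; [apply Cmod_triangle|].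
  specialize (HN n ltac:(lia)); specialize (HM n ltac:(lia)); lra.
Qed.

Lemma Cconv_scal : forall c u l, Cconv u l -> Cconv (fun n => c * u n)%C (c * l)%C.
Proof.
  intros c u l Hu eps He. pose proof (Cmod_ge_0 c) as Hc.
  destruct (Hu (eps / (Cmod c + 1))) as [N HN].
  { apply Rdiv_lt_0_compat; lra. }
  exists N. intros n Hn. specialize (HN n Hn).
  replace (c * u n - c * l)%C with (c * (u n - l))%C by ring.
  rewrite Cmod_mult.
  apply Rle_lt_trans with ((Cmod c) * (eps / (Cmod c + 1))).
  - apply Rmult_le_compat_l; lra.
  - replace eps with ((Cmod c + 1) * (eps / (Cmod c + 1))) at 2 by (field; lra).
    apply Rmult_lt_compat_r; [apply Rdiv_lt_0_compat|]; lra.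
Qed.

Lemma Cconv_minus : forall u v l m, Cconv u l -> Cconv v m ->
  Cconv (fun n => u n - v n)%C (l - m)%C.
Proof.
  intros u v l m Hu Hv.
  apply Cconv_ext with (fun n => u n + (- (1)) * v n)%C O.
  - intros; ring.
  - replace (l - m)%C with (l + (- (1)) * m)%C by ring.
    apply Cconv_plus; auto. apply Cconv_scal; auto.
Qed.

Lemma Cconv_Csum : forall (u : nat -> nat -> C) l n,
  (forall j, (j < n)%nat -> Cconv (u j) (l j)) ->
  Cconv (fun k => Csum (fun j => u j k) n) (Csum l n).
Proof.
  intros u l n; induction n as [|n IH]; intros H; simpl.
  - apply Cconv_const.
  - apply Cconv_plus; auto.
Qed.

Lemma Cconv_bound : forall u l w B N,
  Cconv u l -> (forall n, (N <= n)%nat -> Cmod (u n - w)%C <= B) ->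
  Cmod (l - w)%C <= B.
Proof.
  intros u l w B N Hu HB. apply Rnot_lt_le; intros Hlt.
  destruct (Hu (Cmod (l - w)%C - B)) as [M HM]; [lra|].
  specialize (HM (max M N) ltac:(lia)); specialize (HB (max M N) ltac:(lia)).
  rewrite Cmod_minus_sym in HM.
  pose proof (Cmod_minus_triangle l (u (max M N)) w). lra.
Qed.

Lemma Cconv_shift : forall u l k, Cconv u l -> Cconv (fun n => u (n + k)%nat) l.
Proof.
  intros u l k Hu eps He. destruct (Hu eps He) as [N HN].
  exists N. intros n Hn. apply HN; lia.
Qed.

Lemma Cmod_small_eq : forall x y, (forall eps, 0 < eps -> Cmod (x - y)%C <= eps) -> x = y.
Proof.
  intros x y H.
  assert (H0 : Cmod (x - y)%C = 0).
  { apply Rle_antisym; [|apply Cmod_ge_0]. apply Rnot_lt_le; intros Hlt.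
    specialize (H (Cmod (x - y)%C / 2) ltac:(lra)). lra. }
  apply Cmod_eq_0 in H0. replace x with ((x - y) + y)%C by ring. rewrite H0; ring.
Qed.

Lemma Cconv_unique : forall u l m, Cconv u l -> Cconv u m -> l = m.
Proof.
  intros u l m Hl Hm. apply Cmod_small_eq; intros eps He.
  destruct (Hm eps He) as [N HN].
  apply (Cconv_bound u l m eps N Hl). intros n Hn. left; auto.
Qed.

Definition Ccauchy (u : nat -> C) : Prop :=
  forall eps, 0 < eps -> exists N, forall n m, (N <= n)%nat -> (N <= m)%nat ->
    Cmod (u n - u m)%C < eps.

Lemma Ccauchy_conv : forall u, Ccauchy u -> exists l, Cconv u l.
Proof.
  intros u Hu.
  assert (Hre : Cauchy_crit (fun n => Re (u n))).
  { intros eps He. destruct (Hu eps He) as [N HN]. exists N. intros n m Hn Hm.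
    unfold Rdist. eapply Rle_lt_trans; [|apply (HN n m Hn Hm)].
    apply (Rle_trans _ _ _ (re_le_Cmod (u n - u m)%C)); lra. }
  assert (Him : Cauchy_crit (fun n => Im (u n))).
  { intros eps He. destruct (Hu eps He) as [N HN]. exists N. intros n m Hn Hm.
    unfold Rdist. eapply Rle_lt_trans; [|apply (HN n m Hn Hm)].
    eapply Rle_trans; [apply Rmax_r|apply (Rmax_Cmod (u n - u m)%C)]. }
  destruct (Rcomplete.R_complete _ Hre) as [a Ha]. destruct (Rcomplete.R_complete _ Him) as [b Hb].
  exists (a, b). intros eps He.
  destruct (Ha (eps / 2)) as [N HN]; [lra|]. destruct (Hb (eps / 2)) as [M HM]; [lra|].
  exists (max N M). intros n Hn.
  specialize (HN n ltac:(lia)); specialize (HM n ltac:(lia)). unfold Rdist in *.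
  replace eps with (2 * (eps / 2)) by field.
  apply Cmod_lt_box; simpl; [exact HN|exact HM].
Qed.

(** * Power series *)

Definition series_to (a : nat -> C) (z l : C) : Prop :=
  Cconv (Csum (fun k => a k * z ^ k)%C) l.

Lemma pow_n_Cpow : forall (z : C) k, @pow_n C_Ring z k = (z ^ k)%C.
Proof. intros z k; induction k as [|k IH]; simpl; [|rewrite IH]; reflexivity. Qed.

Lemma sum_n_Csum : forall (f : nat -> C) n,
  @sum_n C_AbelianMonoid f n = Csum f (S n).
Proof.
  intros f n; induction n as [|n IH].
  - rewrite sum_O; simpl. ring.
  - rewrite sum_Sn, IH; reflexivity.
Qed.

Lemma is_Cpseries_iff : forall a z l, is_Cpseries a z l <-> series_to a z l.
Proof.
  intros a z l. unfold is_Cpseries, is_pseries, is_series.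
  match goal with |- filterlim ?f ?F _ <-> _ =>
    pose proof (@filterlim_locally_ball_norm C_AbsRing nat C_NormedModule F _ f l) as Hball
  end.
  assert (E : forall n, @sum_n C_AbelianMonoid
     (fun k => scal (@pow_n C_Ring z k) (a k)) n
     = Csum (fun k => a k * z ^ k)%C (S n)).
  { intros n; rewrite sum_n_Csum; apply Csum_ext; intros k _.
    rewrite pow_n_Cpow. change (z ^ k * a k = a k * z ^ k)%C. ring. }
  split.
  - intros H eps He. destruct (proj1 Hball H (mkposreal eps He)) as [N HN].
    exists (S N). intros n Hn. destruct n as [|n]; [lia|].
    specialize (HN n ltac:(lia)). red in HN. 
    rewrite <- E. exact HN.
  - intros H. apply Hball. intros eps. destruct (H eps (cond_pos eps)) as [N HN].
    exists N. intros n Hn. red. specialize (HN (S n) ltac:(lia)).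
    rewrite <- E in HN. exact HN.
Qed.

Lemma series_unique : forall a z l m, series_to a z l -> series_to a z m -> l = m.
Proof. intros a z l m; apply Cconv_unique. Qed.

Lemma series_terms_bounded : forall a h l, series_to a h l ->
  exists M, 0 < M /\ forall k, Cmod (a k) * Cmod h ^ k <= M.
Proof.
  intros a h l H. destruct (H 1) as [N HN]; [lra|].
  exists (2 + Rsum (fun k => Cmod (a k) * Cmod h ^ k) N).
  assert (Hn : forall k, 0 <= Cmod (a k) * Cmod h ^ k).
  { intros k; apply Rmult_le_pos; [|apply pow_le]; apply Cmod_ge_0. }
  split.
  - pose proof (Rsum_nonneg (fun k => Cmod (a k) * Cmod h ^ k) N (fun k _ => Hn k)). lra.
  - intros k. destruct (le_lt_dec N k) as [Hk|Hk].
    + pose proof (HN k Hk) as H1. pose proof (HN (S k) ltac:(lia)) as H2.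
      pose proof (Cmod_minus_triangle (Csum (fun k => a k * h ^ k)%C (S k)) l
         (Csum (fun k => a k * h ^ k)%C k)) as H3.
      rewrite (Cmod_minus_sym l) in H3.
      replace (Csum (fun k => a k * h ^ k)%C (S k) - Csum (fun k => a k * h ^ k)%C k)%C
        with (a k * h ^ k)%C in H3 by (simpl; ring).
      rewrite Cmod_mult, Cmod_pow in H3.
      pose proof (Rsum_nonneg (fun k => Cmod (a k) * Cmod h ^ k) N (fun k _ => Hn k)). lra.
    + pose proof (Rsum_mono (fun k => Cmod (a k) * Cmod h ^ k) (S k) N Hk Hn) as H1.
      simpl in H1.
      pose proof (Rsum_nonneg (fun k => Cmod (a k) * Cmod h ^ k) k (fun k _ => Hn k)). lra.
Qed.

Lemma geometric_tail_bound : forall (a : nat -> C) R M z n m,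
  0 < R -> Cmod z < R ->
  (forall k, (n <= k)%nat -> Cmod (a k) * R ^ k <= M) ->
  Rsum (fun k => Cmod (a (n + k)%nat) * Cmod z ^ (n + k)) m
    <= M * (Cmod z / R) ^ n / (1 - Cmod z / R).
Proof.
  intros a R M z n m HR Hz HM.
  set (q := Cmod z / R).
  assert (Hq : 0 <= q < 1).
  { unfold q; split.
    - apply Rdiv_le_0_compat; [apply Cmod_ge_0|lra].
    - apply Rlt_div_l; lra. }
  apply Rle_trans with (M * q ^ n * Rsum (fun k => q ^ k) m).
  - rewrite <- Rsum_scal. apply Rsum_le; intros k _.
    replace (Cmod z ^ (n + k)) with (R ^ (n + k) * (q ^ n * q ^ k)).
    + rewrite <- Rmult_assoc, (Rmult_assoc M).
      apply Rmult_le_compat_r.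
      * apply Rmult_le_pos; apply pow_le; lra.
      * apply HM; lia.
    + rewrite <- pow_add. rewrite <- Rpow_mult_distr. f_equal. unfold q; field; lra.
  - unfold Rdiv. apply Rmult_le_compat_l; [|apply Rsum_geom_le; auto].
    apply Rmult_le_pos; [|apply pow_le; lra].
    eapply Rle_trans; [|apply (HM n); lia].
    apply Rmult_le_pos; [apply Cmod_ge_0|apply pow_le; lra].
Qed.

Lemma Csum_tail_le : forall (a : nat -> C) R M z n m,
  0 < R -> Cmod z < R ->
  (forall k, (n <= k)%nat -> Cmod (a k) * R ^ k <= M) ->
  Cmod (Csum (fun k => a k * z ^ k)%C (n + m) - Csum (fun k => a k * z ^ k)%C n)%C
    <= M * (Cmod z / R) ^ n / (1 - Cmod z / R).
Proof.
  intros a R M z n m HR Hz HM.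
  rewrite Csum_split.
  match goal with |- Cmod ?x <= _ => replace x with
    (Csum (fun k => a (n + k)%nat * z ^ (n + k))%C m) by ring end.
  eapply Rle_trans; [apply Cmod_Csum|].
  eapply Rle_trans; [|apply (geometric_tail_bound a R M z n m); auto].
  apply Rsum_le; intros k _. rewrite Cmod_mult, Cmod_pow; lra.
Qed.

Lemma geom_to_0 : forall q c eps, 0 <= q < 1 -> 0 < eps ->
  exists N, forall n, (N <= n)%nat -> c * q ^ n < eps.
Proof.
  intros q c eps Hq He.
  destruct (pow_lt_1_zero q) with (y := eps / (Rabs c + 1)) as [N HN].
  - rewrite Rabs_pos_eq; lra.
  - apply Rdiv_lt_0_compat; [auto|pose proof (Rabs_pos c); lra].
  - exists N. intros n Hn. specialize (HN n Hn).
    rewrite Rabs_pos_eq in HN by (apply pow_le; lra).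
    pose proof (Rabs_pos c) as Hc. pose proof (Rle_abs c) as Hc'.
    pose proof (pow_le q n (proj1 Hq)) as Hp.
    apply Rle_lt_trans with ((Rabs c + 1) * q ^ n); [nra|].
    apply Rmult_lt_compat_l with (r := Rabs c + 1) in HN; [|lra].
    replace ((Rabs c + 1) * (eps / (Rabs c + 1))) with eps in HN by (field; lra). lra.
Qed.

(** Abel's lemma: inside the radius [R] the terms are dominated by a geometric
    series. *)
Lemma series_exists : forall (a : nat -> C) R M z,
  0 < R -> Cmod z < R -> (forall k, Cmod (a k) * R ^ k <= M) ->
  exists l, series_to a z l.
Proof.
  intros a R M z HR Hz HM. apply Ccauchy_conv. intros eps He.
  assert (Hq : 0 <= Cmod z / R < 1).
  { split.
    - apply Rdiv_le_0_compat; [apply Cmod_ge_0|lra].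
    - apply Rlt_div_l; lra. }
  destruct (geom_to_0 (Cmod z / R) (M / (1 - Cmod z / R)) (eps / 2) Hq) as [N HN]; [lra|].
  exists N.
  assert (HT : forall n, (N <= n)%nat ->
    Cmod (Csum (fun k => a k * z ^ k)%C n - Csum (fun k => a k * z ^ k)%C N)%C < eps / 2).
  { intros n Hn. replace n with (N + (n - N))%nat by lia.
    eapply Rle_lt_trans; [apply (Csum_tail_le a R M z N (n - N) HR Hz)|].
    - intros; apply HM.
    - specialize (HN N ltac:(lia)). unfold Rdiv in *. lra. }
  intros n m Hn Hm.
  pose proof (HT n Hn) as H1. pose proof (HT m Hm) as H2.
  rewrite Cmod_minus_sym in H2.
  pose proof (Cmod_minus_triangle (Csum (fun k => a k * z ^ k)%C n)
     (Csum (fun k => a k * z ^ k)%C N) (Csum (fun k => a k * z ^ k)%C m)). lra.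
Qed.

Lemma series_tail : forall (a : nat -> C) R M z n l,
  0 < R -> Cmod z < R ->
  (forall k, (n <= k)%nat -> Cmod (a k) * R ^ k <= M) ->
  series_to a z l ->
  Cmod (l - Csum (fun k => a k * z ^ k)%C n)%C
    <= M * (Cmod z / R) ^ n / (1 - Cmod z / R).
Proof.
  intros a R M z n l HR Hz HM Hl.
  apply (Cconv_bound _ _ _ _ n Hl). intros m Hm.
  replace m with (n + (m - n))%nat by lia. apply Csum_tail_le; auto.
Qed.

(** In the difference of the two series, the first nonzero term would dominate
    the tail as [h] tends to 0. *)
Lemma series_coef_unique : forall (a b : nat -> C) (F : C -> C) d, 0 < d ->
  (forall h, Cmod h < d -> series_to a h (F h)) ->
  (forall h, Cmod h < d -> series_to b h (F h)) ->
  forall k, a k = b k.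
Proof.
  intros a b F d Hd Ha Hb.
  set (c := fun k => (a k - b k)%C).
  assert (Hc : forall h, Cmod h < d -> series_to c h (RtoC 0)).
  { intros h Hh. replace (RtoC 0) with (F h - F h)%C by ring.
    unfold series_to. eapply (Cconv_ext _ _ _ O); [|apply Cconv_minus; [apply Ha|apply Hb]; exact Hh].
    intros n _. cbv beta. rewrite <- Csum_minus. apply Csum_ext.
    intros k _. unfold c; ring. }
  assert (Hz : forall k, c k = RtoC 0).
  { set (R := d / 2).
    assert (HR : 0 < R) by (unfold R; lra).
    destruct (series_terms_bounded c (RtoC R) (RtoC 0)) as [M [HM0 HM]].
    { apply Hc. rewrite Cmod_R, Rabs_pos_eq; unfold R; lra. }
    rewrite Cmod_R, Rabs_pos_eq in HM by lra.
    intros n. induction n as [n IH] using lt_wf_ind.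
    apply Cmod_small_eq. intros eps He.
    replace (c n - 0)%C with (c n) by ring.
    set (h := Rmin (R / 2) (eps * R ^ S n / (2 * M))).
    assert (Hh : 0 < h).
    { apply Rmin_pos; [lra|]. apply Rdiv_lt_0_compat; [|lra].
      apply Rmult_lt_0_compat; [auto|apply pow_lt; auto]. }
    assert (Hh1 : h <= R / 2) by apply Rmin_l.
    assert (Hh2 : h <= eps * R ^ S n / (2 * M)) by apply Rmin_r.
    assert (Hmh : Cmod (RtoC h) = h) by (rewrite Cmod_R, Rabs_pos_eq; lra).
    assert (HT := series_tail c R M (RtoC h) (S n) (RtoC 0) HR).
    rewrite Hmh in HT. specialize (HT ltac:(lra) (fun k _ => HM k)).
    specialize (HT (Hc (RtoC h) ltac:(rewrite Hmh; unfold R in *; lra))).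
    simpl Csum in HT. rewrite Csum_zero in HT.
    2:{ intros k Hk. rewrite IH by auto. ring. }
    replace (0 - (0 + c n * RtoC h ^ n))%C with (- (c n * RtoC h ^ n))%C in HT by ring.
    rewrite Cmod_opp, Cmod_mult, Cmod_pow, Hmh in HT.
    assert (Hp : 0 < h ^ n) by (apply pow_lt; auto).
    apply Rmult_le_reg_r with (h ^ n); auto.
    eapply Rle_trans; [exact HT|].
    assert (Hq : / (1 - h / R) <= 2).
    { assert (h / R <= / 2) by (apply Rle_div_l; lra).
      apply Rle_trans with (/ (/ 2)); [apply Rinv_le_contravar; lra|lra]. }
    apply Rle_trans with (M * (h / R) ^ S n * 2).
    { unfold Rdiv at 1. apply Rmult_le_compat_l; auto.
      apply Rmult_le_pos; [lra|]. apply pow_le. apply Rdiv_le_0_compat; lra. }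
    assert (HRp : 0 < R ^ S n) by (apply pow_lt; auto).
    unfold Rdiv. rewrite Rpow_mult_distr, pow_inv. simpl (h ^ S n).
    apply Rle_trans with (M * ((eps * R ^ S n / (2 * M) * h ^ n) * / R ^ S n) * 2).
    + apply Rmult_le_compat_r; [lra|]. apply Rmult_le_compat_l; [lra|].
      apply Rmult_le_compat_r; [left; apply Rinv_0_lt_compat; auto|].
      apply Rmult_le_compat_r; lra.
    + right. field. split; lra. }
  intros k. specialize (Hz k). unfold c in Hz.
  replace (a k) with ((a k - b k) + b k)%C by ring. rewrite Hz; ring.
Qed.

Lemma Csum_S_l : forall f n, Csum f (S n) = (f O + Csum (fun k => f (S k)) n)%C.
Proof.
  intros f n. replace (S n) with (1 + n)%nat by lia. rewrite Csum_split. simpl. ring.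
Qed.

Lemma RtoC_Rsum : forall f n, RtoC (Rsum f n) = Csum (fun k => RtoC (f k)) n.
Proof.
  intros f n; induction n as [|n IH]; simpl; auto. rewrite RtoC_plus, IH; auto.
Qed.

(** * Re-expansion of power series *)

Fixpoint binom (n k : nat) : nat :=
  match n, k with
  | _, O => 1
  | O, S _ => 0
  | S n', S k' => binom n' k' + binom n' (S k')
  end.

Lemma binom_n_0 : forall n, binom n 0 = 1%nat.
Proof. destruct n; auto. Qed.

Lemma binom_gt : forall n k, (n < k)%nat -> binom n k = O.
Proof.
  induction n as [|n IH]; intros [|k] H; simpl; try lia.
  rewrite !IH by lia. auto.
Qed.

Lemma binomial_formula : forall z h k n, (k < n)%nat ->
  Csum (fun j => RtoC (INR (binom k j)) * z ^ (k - j) * h ^ j)%C n = ((z + h) ^ k)%C.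
Proof.
  intros z h k; induction k as [|k IH]; intros n Hn.
  - destruct n as [|n]; [lia|]. rewrite Csum_S_l, Csum_zero.
    + simpl; ring.
    + intros j Hj; simpl. ring.
  - destruct n as [|n]; [lia|]. rewrite Csum_S_l.
    rewrite (Csum_ext _ (fun j =>
      z * (RtoC (INR (binom k (S j))) * z ^ (k - S j) * h ^ S j)
      + h * (RtoC (INR (binom k j)) * z ^ (k - j) * h ^ j))%C).
    + assert (E := IH (S n) ltac:(lia)).
      rewrite Csum_S_l, binom_n_0, Nat.sub_0_r in E.
      rewrite Csum_plus, !Csum_scal, (IH n) by lia.
      rewrite binom_n_0, Nat.sub_0_r. rewrite !Cpow_S, <- E. simpl Cpow. ring.
    + intros j Hj. simpl binom. simpl Nat.sub. rewrite plus_INR, RtoC_plus.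
      destruct (le_lt_dec k j) as [H|H].
      * rewrite (binom_gt k (S j)) by lia. simpl. ring.
      * replace (k - j)%nat with (S (k - S j)) by lia. simpl. ring.
Qed.

Lemma binomial_formula_R : forall x y k n, (k < n)%nat ->
  Rsum (fun j => INR (binom k j) * x ^ (k - j) * y ^ j) n = (x + y) ^ k.
Proof.
  intros x y k n Hn. apply RtoC_inj. rewrite RtoC_Rsum, RtoC_pow, RtoC_plus.
  rewrite <- (binomial_formula (RtoC x) (RtoC y) k n Hn). apply Csum_ext; intros j _.
  rewrite !RtoC_mult, !RtoC_pow. auto.
Qed.

Lemma binomial_term_le : forall x y k j, 0 <= x -> 0 <= y ->
  INR (binom k j) * x ^ (k - j) * y ^ j <= (x + y) ^ k.
Proof.
  intros x y k j Hx Hy.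
  assert (Hp : forall i, 0 <= INR (binom k i) * x ^ (k - i) * y ^ i).
  { intros i. repeat apply Rmult_le_pos; try apply pow_le; auto. apply pos_INR. }
  rewrite <- (binomial_formula_R x y k (S k + S j)) by lia.
  eapply Rle_trans; [|apply (Rsum_mono _ (S j)); [lia|exact Hp]].
  simpl. pose proof (Rsum_nonneg _ j (fun i _ => Hp i)). lra.
Qed.

(** The bound [M] on the coefficients travels with the expansion because it is
    what makes radius and bound uniform under a change of centre. *)
Definition expands (g : C -> C) (z : C) (b : nat -> C) (d M : R) : Prop :=
  0 < d /\ (forall k, Cmod (b k) * d ^ k <= M) /\
  forall h, Cmod h < d -> series_to b h (g (z + h)%C).

(** Power series converge absolutely, so the double series obtained from the
    binomial formula may be summed along the powers of [h]; comparing the two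
    triangular partial sums leaves only a geometric tail. *)
Lemma reexpand : forall (a : nat -> C) R M z, 0 < R -> Cmod z < R ->
  (forall k, Cmod (a k) * R ^ k <= M) ->
  exists b : nat -> C,
   (forall j, Cconv (Csum (fun k => a k * (RtoC (INR (binom k j)) * z ^ (k - j)))%C) (b j)) /\
   (forall d, 0 < d -> Cmod z + d < R -> forall j,
      Cmod (b j) * d ^ j <= M / (1 - (Cmod z + d) / R)) /\
   (forall h l, Cmod z + Cmod h < R -> series_to a (z + h)%C l -> series_to b h l).
Proof.
  intros a R M z HR Hz HM.
  pose proof (Cmod_ge_0 z) as Hz0.
  assert (Hcm : forall k j, Cmod (RtoC (INR (binom k j)) * z ^ (k - j))%C
                 = INR (binom k j) * Cmod z ^ (k - j)).
  { intros k j. rewrite Cmod_mult, Cmod_pow, Cmod_R, Rabs_pos_eq; auto. apply pos_INR. }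
  assert (Hex : forall j, exists l,
    Cconv (Csum (fun k => a k * (RtoC (INR (binom k j)) * z ^ (k - j)))%C) l).
  { intros j. set (d := (R - Cmod z) / 2).
    assert (Hd : 0 < d) by (unfold d; lra).
    destruct (series_exists (fun k => a k * (RtoC (INR (binom k j)) * z ^ (k - j)))%C
       (R / (Cmod z + d)) (M / d ^ j) (RtoC 1)) as [l Hl].
    - apply Rdiv_lt_0_compat; lra.
    - rewrite Cmod_1. apply Rlt_div_r; unfold d in *; lra.
    - intros k. rewrite Cmod_mult, Hcm.
      pose proof (binomial_term_le (Cmod z) d k j Hz0 (Rlt_le _ _ Hd)) as Hb.
      assert (Hdj : 0 < d ^ j) by (apply pow_lt; auto).
      assert (Hzd : 0 < (Cmod z + d) ^ k) by (apply pow_lt; lra).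
      apply (proj1 (Rle_div_r _ _ _ Hdj)). unfold Rdiv. rewrite Rpow_mult_distr, pow_inv.
      apply Rle_trans with (Cmod (a k) * R ^ k * ((Cmod z + d) ^ k * / (Cmod z + d) ^ k)).
      + replace (Cmod (a k) * (INR (binom k j) * Cmod z ^ (k - j)) * (R ^ k * / (Cmod z + d) ^ k) * d ^ j)
          with (Cmod (a k) * R ^ k * ((INR (binom k j) * Cmod z ^ (k - j) * d ^ j) * / (Cmod z + d) ^ k)) by ring.
        apply Rmult_le_compat_l.
        * apply Rmult_le_pos; [apply Cmod_ge_0|apply pow_le; lra].
        * apply Rmult_le_compat_r; auto. left; apply Rinv_0_lt_compat; auto.
      + rewrite Rinv_r by lra. rewrite Rmult_1_r. apply HM.
    - exists l. eapply (Cconv_ext _ _ _ O); [|exact Hl].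
      intros n _. apply Csum_ext; intros k _. rewrite Cpow_1_l. ring. }
  set (b := fun j => epsilon (inhabits (RtoC 0)) (fun l =>
    Cconv (Csum (fun k => a k * (RtoC (INR (binom k j)) * z ^ (k - j)))%C) l)).
  assert (Hb : forall j,
    Cconv (Csum (fun k => a k * (RtoC (INR (binom k j)) * z ^ (k - j)))%C) (b j)).
  { intros j. unfold b. apply epsilon_spec, Hex. }
  exists b. split; [exact Hb|split].
  - intros d Hd Hzd j.
    assert (Hdj : 0 < d ^ j) by (apply pow_lt; auto).
    apply (proj2 (Rle_div_r _ _ _ Hdj)).
    replace (b j) with (b j - RtoC 0)%C by ring.
    apply (Cconv_bound _ _ _ _ O (Hb j)). intros n _.
    apply (proj1 (Rle_div_r _ _ _ Hdj)). replace (Csum (fun k => a k * (RtoC (INR (binom k j)) * z ^ (k - j)))%C n - RtoC 0)%C with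
      (Csum (fun k => a k * (RtoC (INR (binom k j)) * z ^ (k - j)))%C n) by ring.
    apply Rle_trans with (Rsum (fun k => Cmod (a (0 + k)%nat) * Cmod (RtoC (Cmod z + d)) ^ (0 + k)) n).
    + apply Rle_trans with (Rsum (fun k => Cmod (a k) * (INR (binom k j) * Cmod z ^ (k - j))) n * d ^ j).
      * apply Rmult_le_compat_r; [lra|]. eapply Rle_trans; [apply Cmod_Csum|].
        apply Rsum_le; intros k _. rewrite Cmod_mult, Hcm. lra.
      * rewrite Rmult_comm, <- Rsum_scal. apply Rsum_le; intros k _. simpl.
        rewrite Cmod_R, Rabs_pos_eq by lra.
        pose proof (binomial_term_le (Cmod z) d k j Hz0 (Rlt_le _ _ Hd)) as Hbt.
        pose proof (Cmod_ge_0 (a k)). nra.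
    + eapply Rle_trans; [apply (geometric_tail_bound a R M)|]; auto.
      * rewrite Cmod_R, Rabs_pos_eq; lra.
      * rewrite Cmod_R, Rabs_pos_eq by lra. simpl. unfold Rdiv; lra.
  - intros h l Hh Hl. pose proof (Cmod_ge_0 h) as Hh0.
    set (x := (Cmod z + Cmod h) / R).
    assert (Hx : 0 <= x < 1).
    { unfold x; split; [apply Rdiv_le_0_compat; lra|apply Rlt_div_l; lra]. }
    assert (Hdiff : forall n, Cmod (Csum (fun j => b j * h ^ j)%C n
         - Csum (fun k => a k * (z + h) ^ k)%C n)%C <= M * x ^ n / (1 - x)).
    { intros n.
      apply (Cconv_bound (fun m => Csum (fun j => h ^ j *
         Csum (fun k => a k * (RtoC (INR (binom k j)) * z ^ (k - j)))%C m)%C n) _ _ _ n).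
      - rewrite (Csum_ext (fun j => b j * h ^ j)%C (fun j => h ^ j * b j)%C) by (intros; ring).
        apply Cconv_Csum with (u := fun j m => (h ^ j *
         Csum (fun k => a k * (RtoC (INR (binom k j)) * z ^ (k - j)))%C m)%C).
        intros j _. apply Cconv_scal, Hb.
      - intros m Hm.
        rewrite (Csum_ext _ (fun j => Csum (fun k => h ^ j * (a k * (RtoC (INR (binom k j)) * z ^ (k - j))))%C m))
          by (intros; rewrite Csum_scal; auto).
        rewrite Csum_swap. replace m with (n + (m - n))%nat by lia. rewrite Csum_split.
        rewrite (Csum_ext _ (fun k => a k * (z + h) ^ k)%C n).
        2:{ intros k Hk. rewrite <- (binomial_formula z h k n Hk), <- Csum_scal.
            apply Csum_ext; intros; ring. }
        match goal with |- Cmod (?A + ?B - ?A)%C <= _ => replace (A + B - A)%C with B by ring end.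
        eapply Rle_trans; [apply Cmod_Csum|].
        eapply Rle_trans; [|unfold x; replace (Cmod z + Cmod h) with (Cmod (RtoC (Cmod z + Cmod h)));
           [apply (geometric_tail_bound a R M _ n (m - n))|]]; auto.
        + apply Rsum_le; intros k _. rewrite Cmod_R, Rabs_pos_eq by lra.
          eapply Rle_trans; [apply Cmod_Csum|].
          rewrite (Rsum_ext _ (fun j => Cmod (a (n + k)%nat) *
            (INR (binom (n + k) j) * Cmod z ^ (n + k - j) * Cmod h ^ j))).
          2:{ intros j _. rewrite !Cmod_mult, !Cmod_pow, Cmod_R, Rabs_pos_eq; [ring|apply pos_INR]. }
          rewrite Rsum_scal. apply Rmult_le_compat_l; [apply Cmod_ge_0|].
          rewrite <- (binomial_formula_R (Cmod z) (Cmod h) (n + k) (S (n + k))) by lia.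
          apply Rsum_mono; [lia|]. intros i.
          repeat apply Rmult_le_pos; try apply pow_le; auto. apply pos_INR.
        + rewrite Cmod_R, Rabs_pos_eq; lra.
        + rewrite Cmod_R, Rabs_pos_eq; lra. }
    intros eps He.
    destruct (Hl (eps / 2)) as [N1 HN1]; [lra|].
    destruct (geom_to_0 x (M / (1 - x)) (eps / 2) Hx) as [N2 HN2]; [lra|].
    exists (max N1 N2). intros n Hn.
    specialize (HN1 n ltac:(lia)). specialize (HN2 n ltac:(lia)).
    specialize (Hdiff n).
    pose proof (Cmod_minus_triangle (Csum (fun j => b j * h ^ j)%C n)
      (Csum (fun k => a k * (z + h) ^ k)%C n) l).
    unfold Rdiv in *. lra.
Qed.

Lemma expands_at : forall g z0 b R M z d, expands g z0 b R M ->
  0 < d -> Cmod (z - z0)%C + d < R ->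
  exists b', expands g z b' d (M / (1 - (Cmod (z - z0)%C + d) / R)).
Proof.
  intros g z0 b R M z d [HR [HM Hs]] Hd Hz.
  destruct (reexpand b R M (z - z0)%C HR ltac:(lra) HM) as [b' [_ [H2 H3]]].
  exists b'. split; [auto|split].
  - intros k. apply H2; auto.
  - intros h Hh. apply H3; [lra|].
    replace (z + h)%C with (z0 + ((z - z0) + h))%C by ring. apply Hs.
    eapply Rle_lt_trans; [apply Cmod_triangle|lra].
Qed.

Lemma expands_shrink : forall g z b d M d' M', expands g z b d M ->
  0 < d' <= d -> M <= M' -> expands g z b d' M'.
Proof.
  intros g z b d M d' M' [Hd [HM Hs]] Hd' HM'. split; [lra|split].
  - intros k. apply Rle_trans with M; auto. eapply Rle_trans; [|apply (HM k)].
    apply Rmult_le_compat_l; [apply Cmod_ge_0|]. apply pow_incr; lra.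
  - intros h Hh. apply Hs; lra.
Qed.

(** * Local notions in terms of the modulus *)

Lemma locally_Cmod : forall (z0 : C) (P : C -> Prop),
  @locally C_UniformSpace z0 P <-> exists d, 0 < d /\ forall z, Cmod (z - z0)%C < d -> P z.
Proof.
  intros z0 P. split.
  - intros [eps H]. exists eps. split; [apply cond_pos|]. intros z Hz. apply H.
    apply C_NormedModule_mixin_compat1. exact Hz.
  - intros [d [Hd H]].
    assert (Hs : 0 < sqrt 2) by (apply sqrt_lt_R0; lra).
    exists (mkposreal (d / sqrt 2) ltac:(apply Rdiv_lt_0_compat; auto)).
    intros z Hz. apply H. apply C_NormedModule_mixin_compat2 in Hz.
    simpl in Hz. replace (sqrt 2 * (d / sqrt 2)) with d in Hz by (field; lra). exact Hz.
Qed.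

Lemma analytic_expands : forall g z0, analytic_at g z0 -> exists b d M, 0 < M /\ expands g z0 b d M.
Proof.
  intros g z0 [b Hb]. apply locally_Cmod in Hb. destruct Hb as [d [Hd Hb]].
  assert (Hs : forall h, Cmod h < d -> series_to b h (g (z0 + h)%C)).
  { intros h Hh. apply is_Cpseries_iff.
    replace h with ((z0 + h) - z0)%C at 1 by ring. apply Hb.
    replace (z0 + h - z0)%C with h by ring. auto. }
  assert (Hm : Cmod (RtoC (d / 2)) = d / 2) by (rewrite Cmod_R, Rabs_pos_eq; lra).
  destruct (series_terms_bounded b (RtoC (d / 2)) (g (z0 + RtoC (d / 2))%C)) as [M [HM0 HM]].
  { apply Hs. rewrite Hm; lra. }
  exists b, (d / 2), M. split; auto. split; [lra|split].
  - intros k. rewrite Hm in HM; auto.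
  - intros h Hh. apply Hs; lra.
Qed.

Lemma expands_continuous : forall g z0 b d M, expands g z0 b d M ->
  forall eps, 0 < eps -> exists e, 0 < e /\
    forall z, Cmod (z - z0)%C < e -> Cmod (g z - g z0)%C < eps.
Proof.
  intros g z0 b d M [Hd [HM Hs]] eps He.
  assert (HM0 : 0 <= M).
  { eapply Rle_trans; [|apply (HM O)]. simpl. pose proof (Cmod_ge_0 (b O)). lra. }
  assert (Hg : g z0 = b O).
  { apply (series_unique b (RtoC 0)).
    - replace z0 with (z0 + RtoC 0)%C at 1 by ring. apply Hs. rewrite Cmod_0; auto.
    - intros e He'. exists 1%nat. intros n Hn. destruct n as [|n]; [lia|].
      rewrite Csum_S_l, Csum_zero.
      + replace (b O * RtoC 0 ^ 0 + RtoC 0 - b O)%C with (RtoC 0) by (simpl; ring).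
        rewrite Cmod_0; auto.
      + intros k _. simpl; ring. }
  set (e := Rmin (d / 2) (eps * d / (4 * (M + 1)))).
  assert (He1 : e <= d / 2) by apply Rmin_l.
  assert (He2 : e <= eps * d / (4 * (M + 1))) by apply Rmin_r.
  exists e. split.
  { apply Rmin_pos; [lra|]. apply Rdiv_lt_0_compat; nra. }
  intros z Hz.
  pose proof (Cmod_ge_0 (z - z0)%C) as Hz0.
  assert (HT := series_tail b d M (z - z0)%C 1 (g z) Hd ltac:(lra) (fun k _ => HM k)).
  assert (Hsz : series_to b (z - z0)%C (g z)).
  { replace (g z) with (g (z0 + (z - z0))%C) by (f_equal; ring). apply Hs; lra. }
  specialize (HT Hsz). simpl in HT.
  replace (0 + b O * 1)%C with (b O) in HT by ring. rewrite Hg.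
  eapply Rle_lt_trans; [exact HT|].
  set (x := Cmod (z - z0)%C) in *.
  assert (Hxd : x / d <= / 2) by (apply Rle_div_l; lra).
  assert (Hx0 : 0 <= x / d) by (apply Rdiv_le_0_compat; lra).
  apply Rle_lt_trans with (M * (x / d * 1) * 2).
  { unfold Rdiv at 1. apply Rmult_le_compat_l; [apply Rmult_le_pos; lra|].
    replace 2 with (/ (/ 2)) by field. apply Rinv_le_contravar; lra. }
  assert (x / d < eps / (4 * (M + 1))).
  { apply Rlt_div_l; auto. unfold Rdiv in *. lra. }
  apply Rle_lt_trans with ((M + 1) * (eps / (4 * (M + 1))) * 2).
  - nra.
  - replace ((M + 1) * (eps / (4 * (M + 1))) * 2) with (eps / 2) by (field; lra). lra.
Qed.

(** * Orthogonality on the circle and the Cauchy estimates *)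

Definition expi (t : R) : C := (cos t, sin t).

Lemma Cmod_expi : forall t, Cmod (expi t) = 1.
Proof.
  intros t. unfold Cmod, expi; simpl fst; simpl snd.
  pose proof (sin2_cos2 t) as H. unfold Rsqr in H.
  replace (cos t ^ 2 + sin t ^ 2) with 1 by (simpl; lra). apply sqrt_1.
Qed.

Lemma expi_plus : forall a b, expi (a + b) = (expi a * expi b)%C.
Proof.
  intros a b. unfold expi, Cmult; simpl. rewrite cos_plus, sin_plus. f_equal; ring.
Qed.

Lemma expi_0 : expi 0 = RtoC 1.
Proof. unfold expi. rewrite cos_0, sin_0. reflexivity. Qed.

Lemma expi_pow : forall t k, (expi t ^ k)%C = expi (INR k * t).
Proof.
  intros t k; induction k as [|k IH].
  - simpl. rewrite Rmult_0_l, expi_0. auto.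
  - rewrite Cpow_S, IH, <- expi_plus, S_INR. f_equal; ring.
Qed.

Lemma circle_point_expi : forall r t, circle_point r t = (RtoC r * expi t)%C.
Proof. intros r t. unfold circle_point, expi, Cmult, RtoC; simpl. f_equal; ring. Qed.

Lemma Cmod_circle : forall r t, 0 <= r -> Cmod (circle_point r t) = r.
Proof.
  intros r t Hr. rewrite circle_point_expi, Cmod_mult, Cmod_expi, Cmod_R, Rabs_pos_eq; lra.
Qed.

Lemma sin_cos_2PI_mult : forall d, sin (INR d * (2 * PI)) = 0 /\ cos (INR d * (2 * PI)) = 1.
Proof.
  intros d. replace (INR d * (2 * PI)) with (0 + 2 * INR d * PI) by ring.
  rewrite sin_period, cos_period, sin_0, cos_0. auto.
Qed.

Lemma trig_integral_0 : forall A B d, (0 < d)%nat ->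
  is_RInt (fun t => A * cos (INR d * t) + B * sin (INR d * t)) 0 (2 * PI) 0.
Proof.
  intros A B d Hd.
  assert (HD : 0 < INR d) by (apply lt_0_INR; auto).
  set (F := fun t => (A * sin (INR d * t) - B * cos (INR d * t)) / INR d).
  assert (HF : is_RInt (fun t => A * cos (INR d * t) + B * sin (INR d * t)) 0 (2 * PI)
     (minus (F (2 * PI)) (F 0))).
  { apply (@is_RInt_derive R_CompleteNormedModule F).
    - intros t _. unfold F. auto_derive; auto. field. lra.
    - intros t _. apply (@ex_derive_continuous R_AbsRing R_NormedModule).
      auto_derive. auto. }
  destruct (sin_cos_2PI_mult d) as [H1 H2].
  assert (E : minus (F (2 * PI)) (F 0) = 0).
  { unfold F, minus, plus, opp; simpl. rewrite H1, H2, !Rmult_0_r, sin_0, cos_0. field. lra. }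
  rewrite E in HF. exact HF.
Qed.

Lemma is_RInt_const_circle : forall c : R, is_RInt (fun _ => c) 0 (2 * PI) (2 * PI * c).
Proof.
  intros c. replace (2 * PI * c) with (scal (2 * PI - 0) c).
  - apply @is_RInt_const.
  - unfold scal; simpl; unfold mult; simpl; ring.
Qed.

Lemma expi_integral : forall (v : C) x n, 
  is_RInt (fun t => Re (v * (expi (- (INR n * t)) * expi (INR x * t)))%C) 0 (2 * PI)
    (if Nat.eq_dec x n then 2 * PI * Re v else 0).
Proof.
  intros v x n. destruct (Nat.eq_dec x n) as [E|E].
  - subst x. apply is_RInt_ext with (fun _ => Re v).
    + intros t _. rewrite <- expi_plus.
      replace (- (INR n * t) + INR n * t) with 0 by ring. rewrite expi_0.
      f_equal. ring.
    + apply is_RInt_const_circle.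
  - destruct (le_lt_dec x n) as [H|H].
    + apply is_RInt_ext with (fun t => Re v * cos (INR (n - x) * t) + Im v * sin (INR (n - x) * t)).
      2: apply trig_integral_0; lia.
      intros t _. rewrite <- expi_plus, minus_INR by lia.
      replace (- (INR n * t) + INR x * t) with (- ((INR n - INR x) * t)) by ring.
      unfold expi, Re, Im, Cmult; simpl. rewrite cos_neg, sin_neg. ring.
    + apply is_RInt_ext with (fun t => Re v * cos (INR (x - n) * t) + (- Im v) * sin (INR (x - n) * t)).
      2: apply trig_integral_0; lia.
      intros t _. rewrite <- expi_plus, minus_INR by lia.
      replace (- (INR n * t) + INR x * t) with ((INR x - INR n) * t) by ring.
      unfold expi, Re, Im, Cmult; simpl. ring.
Qed.

(** The Cauchy estimates need the gap [s = 1] between frequencies; larger gaps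
    come from polynomials in [z ^ s]. *)
Lemma fourier_coefficient : forall (x : nat -> C) (s : nat) n v m, (0 < s)%nat ->
  is_RInt (fun t => Re (v * (expi (- (INR (s * n) * t)) *
      Csum (fun l => x l * expi (INR (s * l) * t)) m))%C) 0 (2 * PI)
    (if lt_dec n m then 2 * PI * Re (v * x n)%C else 0).
Proof.
  intros x s n v m Hs. induction m as [|m IH].
  - destruct (lt_dec n 0); [lia|]. simpl.
    pose proof (is_RInt_const_circle 0) as H0. rewrite Rmult_0_r in H0.
    apply is_RInt_ext with (fun _ => 0); [|exact H0].
    intros t _. simpl. ring.
  - pose proof (expi_integral (v * x m)%C (s * m) (s * n)) as H.
    pose proof (is_RInt_plus _ _ _ _ _ _ IH H) as HP.
    match type of HP with is_RInt _ _ _ ?w => assert (Ew : w = (if lt_dec n (S m) then 2 * PI * Re (v * x n)%C else 0)) end.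
    { assert (HE : (s * m = s * n)%nat -> m = n)
        by (intros HE; apply (Nat.mul_cancel_l m n s); lia).
      unfold plus; simpl. destruct (lt_dec n m); destruct (lt_dec n (S m)); try lia;
      destruct (Nat.eq_dec (s * m) (s * n)) as [E|E]; try (specialize (HE E); lia).
      - ring.
      - specialize (HE E). subst. ring.
      - exfalso. apply E. f_equal. lia.
      - ring. }
    rewrite Ew in HP. eapply is_RInt_ext; [|exact HP].
    intros t _. unfold plus; simpl. unfold Re; simpl. ring.
Qed.

Lemma parseval : forall (x : nat -> C) (s : nat) m, (0 < s)%nat ->
  is_RInt (fun t => Cmod (Csum (fun l => x l * expi (INR (s * l) * t))%C m) ^ 2) 0 (2 * PI)
    (2 * PI * Rsum (fun l => Cmod (x l) ^ 2) m).
Proof.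
  intros x s m Hs. induction m as [|m IH].
  - simpl. apply is_RInt_ext with (fun _ => 0); [|apply is_RInt_const_circle].
    intros t _. rewrite Cmod_0. symmetry; apply Rmult_0_l.
  - pose proof (fourier_coefficient x s m (RtoC 2 * Cconj (x m))%C m Hs) as H1.
    destruct (lt_dec m m); [lia|].
    assert (H2 : is_RInt (fun _ => Cmod (x m) ^ 2) 0 (2 * PI) (2 * PI * Cmod (x m) ^ 2))
      by apply is_RInt_const_circle.
    pose proof (is_RInt_plus _ _ _ _ _ _ (is_RInt_plus _ _ _ _ _ _ IH H1) H2) as HP.
    match type of HP with is_RInt _ _ _ ?w => replace w with
      (2 * PI * Rsum (fun l => Cmod (x l) ^ 2) (S m)) in HP
      by (unfold plus; simpl; ring) end.
    eapply is_RInt_ext; [|exact HP].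
    intros t _. unfold plus. simpl Csum. cbv beta.
    set (D := Csum (fun l => x l * expi (INR (s * l) * t))%C m).
    set (u := INR (s * m) * t).
    rewrite !Cmod2_alt.
    replace (expi (- u)) with (Cconj (expi u)) by (unfold Cconj, expi; simpl; now rewrite cos_neg, sin_neg).
    pose proof (sin2_cos2 u) as Hsc. unfold Rsqr in Hsc.
    destruct D as [d1 d2]. destruct (x m) as [x1 x2].
    unfold expi, Re, Im, Cconj, Cmult, Cplus, RtoC; simpl.
    replace (x1 * (x1 * 1) + x2 * (x2 * 1)) with ((x1 * x1 + x2 * x2) * (sin u * sin u + cos u * cos u))
      by (rewrite Hsc; ring).
    ring.
Qed.

Lemma Re_le_Cmod : forall z, Re z <= Cmod z.
Proof. intros z. eapply Rle_trans; [apply Rle_abs|apply re_le_Cmod]. Qed.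

Lemma unit_phase : forall z : C, exists v, Cmod v = 1 /\ Re (v * z)%C = Cmod z.
Proof.
  intros z. destruct (Req_dec (Cmod z) 0) as [E|E].
  - exists (RtoC 1). split; [apply Cmod_1|]. apply Cmod_eq_0 in E. subst z.
    rewrite Cmod_0. simpl. ring.
  - assert (Hz : z <> RtoC 0) by (intros H; apply E; rewrite H; apply Cmod_0).
    exists (Cconj z / RtoC (Cmod z))%C. split.
    + rewrite Cmod_div, Cmod_conj, Cmod_R, Rabs_pos_eq; [field; auto|apply Cmod_ge_0|].
      intros H. apply E. apply RtoC_inj in H. auto.
    + replace (Cconj z / RtoC (Cmod z) * z)%C with (RtoC (Cmod z)); [reflexivity|].
      assert (E' : RtoC (Cmod z) <> RtoC 0) by (intros H; apply E; apply RtoC_inj; auto).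
      replace (Cconj z / RtoC (Cmod z) * z)%C with ((z * Cconj z) / RtoC (Cmod z))%C by (field; auto).
      rewrite <- Cmod2_conj. rewrite RtoC_pow. field. auto.
Qed.

(** The integral of a long partial sum against [expi (- n t)], rotated to make
    the result real, isolates the coefficient; the tail is uniformly small on
    the circle. *)
Lemma Cauchy_estimate : forall (a : nat -> C) (F : C -> C) R M rho B n,
  0 < rho < R -> (forall k, Cmod (a k) * R ^ k <= M) ->
  (forall z, Cmod z = rho -> series_to a z (F z)) ->
  (forall z, Cmod z = rho -> Cmod (F z) <= B) ->
  Cmod (a n) * rho ^ n <= B.
Proof.
  intros a F R M rho B n Hr HM HF HB.
  apply Rle_plus_epsilon. intros eps He.
  destruct (geom_to_0 (rho / R) (M / (1 - rho / R)) eps) as [N HN]; auto.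
  { split; [apply Rdiv_le_0_compat; lra|apply Rlt_div_l; lra]. }
  set (m := max N (S n)).
  destruct (unit_phase (a n * RtoC rho ^ n)%C) as [v [Hv1 Hv2]].
  pose proof (fourier_coefficient (fun l => a l * RtoC rho ^ l)%C 1 n v m Nat.lt_0_1) as HI.
  destruct (lt_dec n m) as [_|Hx]; [|unfold m in Hx; lia].
  rewrite Hv2 in HI. rewrite Cmod_mult, Cmod_pow, Cmod_R, Rabs_pos_eq in HI by lra.
  assert (HC : is_RInt (fun _ => B + eps) 0 (2 * PI) (2 * PI * (B + eps)))
    by apply is_RInt_const_circle.
  pose proof PI_RGT_0 as HPI.
  assert (HL : 2 * PI * (Cmod (a n) * rho ^ n) <= 2 * PI * (B + eps)).
  { apply (is_RInt_le _ _ 0 (2 * PI) _ _ ltac:(lra) HI HC).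
    intros t _. eapply Rle_trans; [apply Re_le_Cmod|].
    rewrite !Cmod_mult, Hv1, Cmod_expi, !Rmult_1_l.
    assert (Hz : Cmod (circle_point rho t) = rho) by (apply Cmod_circle; lra).
    rewrite (Csum_ext _ (fun k => a k * circle_point rho t ^ k)%C).
    2:{ intros k _. rewrite circle_point_expi, Cpow_mult_l, expi_pow, Nat.mul_1_l. ring. }
    pose proof (series_tail a R M (circle_point rho t) m (F (circle_point rho t)) ltac:(lra)
       ltac:(lra) (fun k _ => HM k) (HF _ Hz)) as HT.
    rewrite Hz in HT. specialize (HN m ltac:(unfold m; lia)).
    specialize (HB _ Hz).
    set (P := Csum (fun k => a k * circle_point rho t ^ k)%C m) in *.
    set (f := F (circle_point rho t)) in *.
    assert (HP : Cmod P <= Cmod f + Cmod (f - P)%C).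
    { replace P with (f + - (f - P))%C at 1 by ring. rewrite <- (Cmod_opp (f - P)%C).
      apply Cmod_triangle. }
    unfold Rdiv in *. lra. }
  apply Rmult_le_reg_l in HL; lra.
Qed.

(** * Taylor series at the origin *)

Lemma Cminus_0_r : forall z : C, (z - RtoC 0)%C = z.
Proof. intros; ring. Qed.

(** An expansion about one point re-expands about all nearby points with a fixed
    fraction of the radius and a fixed multiple of the bound, so compactness
    yields a common radius and a common bound.  Compactness is applied to a
    square: the points outside the disc receive neighbourhoods that avoid it, and
    radius and bound are tied together as [d] and [/ d] so that one positive
    function controls both. *)
Lemma uniform_expansion : forall (g : C -> C) rho, 0 < rho ->
  (forall z, Cmod z <= rho -> analytic_at g z) ->
  exists d M, 0 < d /\ forall z, Cmod z <= rho -> exists b, expands g z b d M.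
Proof.
  intros g rho Hrho Hg.
  assert (Hloc : forall u v : R, exists d : posreal,
    (Cmod (u, v) <= rho -> forall z, Cmod (z - (u, v))%C < 2 * d -> exists b, expands g z b d (/ d)) /\
    (rho < Cmod (u, v) -> forall z, Cmod (z - (u, v))%C < 2 * d -> rho < Cmod z)).
  { intros u v. destruct (Rle_lt_dec (Cmod (u, v)) rho) as [H|H].
    - destruct (analytic_expands g (u, v) (Hg _ H)) as [b [d [M [HM0 Hb]]]].
      assert (Hd : 0 < d) by apply Hb.
      assert (Hd' : 0 < Rmin (d / 4) (/ (4 * M))).
      { apply Rmin_pos; [lra|]. apply Rinv_0_lt_compat; lra. }
      (* at distance below d / 2 an expansion of radius d / 4 remains, and the
         geometric factor in its bound is at most 4 *)
      exists (mkposreal _ Hd'). simpl. split; [|intros; lra].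
      intros _ z Hz.
      pose proof (Rmin_l (d / 4) (/ (4 * M))) as H1.
      pose proof (Rmin_r (d / 4) (/ (4 * M))) as H2.
      destruct (expands_at g (u, v) b d M z (d / 4) Hb) as [b' Hb']; [lra|lra|].
      exists b'. eapply expands_shrink; [exact Hb'|lra|].
      apply Rle_trans with (4 * M).
      + unfold Rdiv at 1. rewrite (Rmult_comm 4). apply Rmult_le_compat_l; [lra|].
        replace 4 with (/ (/ 4)) at 2 by field. apply Rinv_le_contravar; [lra|].
        assert ((Cmod (z - (u, v))%C + d / 4) / d <= 3 / 4); [|lra].
        apply Rle_div_l; lra.
      + eapply Rle_trans; [right; symmetry; apply Rinv_inv|]. apply Rinv_le_contravar; auto.
    - exists (mkposreal ((Cmod (u, v) - rho) / 2) ltac:(lra)). simpl. split; [intros; lra|].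
      intros _ z Hz.
      pose proof (Cmod_minus_triangle (u, v) z (RtoC 0)) as HT.
      rewrite !Cminus_0_r, (Cmod_minus_sym (u, v) z) in HT. lra. }
  set (delta := fun u v => epsilon (inhabits (mkposreal 1 Rlt_0_1)) (fun d : posreal =>
    (Cmod (u, v) <= rho -> forall z, Cmod (z - (u, v))%C < 2 * d -> exists b, expands g z b d (/ d)) /\
    (rho < Cmod (u, v) -> forall z, Cmod (z - (u, v))%C < 2 * d -> rho < Cmod z))).
  destruct (compactness_value_2d (- rho) rho (- rho) rho delta) as [d Hd].
  exists d, (/ d). split; [apply cond_pos|]. intros z Hz.
  apply NNPP. intros Hn.
  pose proof (Rmax_Cmod z) as Hm.
  pose proof (Rmax_l (Rabs (fst z)) (Rabs (snd z))) as Hm1.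
  pose proof (Rmax_r (Rabs (fst z)) (Rabs (snd z))) as Hm2.
  apply (Hd (fst z) (snd z)).
  { apply Rabs_le_between; lra. }
  { apply Rabs_le_between; lra. }
  intros [u [v [_ [_ [Hu [Hv Hdd]]]]]]. apply Hn.
  assert (Hspec := epsilon_spec (inhabits (mkposreal 1 Rlt_0_1)) _ (Hloc u v)).
  cbv beta in Hspec. fold (delta u v) in Hspec.
  assert (Hdist : Cmod (z - (u, v))%C < 2 * delta u v).
  { apply Cmod_lt_box; simpl; [exact Hu|exact Hv]. }
  destruct Hspec as [S1 S2].
  destruct (Rle_lt_dec (Cmod (u, v)) rho) as [H|H].
  - destruct (S1 H z Hdist) as [b Hb]. exists b.
    pose proof (cond_pos d).
    eapply expands_shrink; [exact Hb|lra|]. apply Rinv_le_contravar; auto.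
  - specialize (S2 H z Hdist). lra.
Qed.

(** The step that enlarges the disc of convergence.  At every [z] in the disc
    of radius [rho] the coefficients of [g] are at most [M / d ^ n]; as functions
    of [z] they are power series with coefficients [binom (n + k) n * a (n + k)],
    so the Cauchy estimates bound those, and summing over [n] with the binomial
    formula bounds [a N * (r + d) ^ N] by a multiple of [N + 1] for [r < rho]. *)
Lemma taylor_coefficients_bound : forall (g : C -> C) (a : nat -> C) rho d M,
  0 < rho -> 
  (forall z, Cmod z < rho -> series_to a z (g z)) ->
  (forall z, Cmod z <= rho -> exists b, expands g z b d M) ->
  forall r N, 0 < r < rho -> Cmod (a N) * (r + d) ^ N <= INR (S N) * M.
Proof.
  intros g a rho d M Hrho Ha Hexp r N Hr.
  assert (Hd : 0 < d).
  { destruct (Hexp (RtoC 0)) as [b Hb]; [rewrite Cmod_0; lra|apply Hb]. }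
  set (R := (r + rho) / 2).
  assert (HR : r < R < rho) by (unfold R; lra).
  destruct (series_terms_bounded a (RtoC R) (g (RtoC R))) as [M1 [HM1 HM]].
  { apply Ha. rewrite Cmod_R, Rabs_pos_eq; lra. }
  rewrite Cmod_R, Rabs_pos_eq in HM by lra.
  assert (Hcoef : forall z, Cmod z < R -> exists b : nat -> C,
    (forall n, Cconv (Csum (fun k => a k * (RtoC (INR (binom k n)) * z ^ (k - n)))%C) (b n))
    /\ forall n, Cmod (b n) * d ^ n <= M).
  { intros z Hz. destruct (reexpand a R M1 z ltac:(lra) Hz HM) as [b [H1 [_ H3]]].
    exists b. split; auto.
    destruct (Hexp z ltac:(lra)) as [b' [_ [HM' Hs']]].
    assert (E : forall n, b n = b' n).
    { apply (series_coef_unique b b' (fun h => g (z + h)%C) (Rmin d (R - Cmod z))).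
      - apply Rmin_pos; lra.
      - intros h Hh. pose proof (Rmin_r d (R - Cmod z)). apply H3; [lra|].
        apply Ha. eapply Rle_lt_trans; [apply Cmod_triangle|lra].
      - intros h Hh. pose proof (Rmin_l d (R - Cmod z)). apply Hs'; lra. }
    intros n. rewrite E. apply HM'. }
  set (b := fun z => epsilon (inhabits (fun _ : nat => RtoC 0)) (fun b : nat -> C =>
    (forall n, Cconv (Csum (fun k => a k * (RtoC (INR (binom k n)) * z ^ (k - n)))%C) (b n))
    /\ forall n, Cmod (b n) * d ^ n <= M)).
  assert (Hb : forall z, Cmod z < R ->
    (forall n, Cconv (Csum (fun k => a k * (RtoC (INR (binom k n)) * z ^ (k - n)))%C) (b z n))
    /\ forall n, Cmod (b z n) * d ^ n <= M).
  { intros z Hz. unfold b. apply epsilon_spec. auto. }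
  assert (Hser : forall n z, Cmod z < R ->
    series_to (fun k => a (n + k)%nat * RtoC (INR (binom (n + k) n)))%C z (b z n)).
  { intros n z Hz. destruct (Hb z Hz) as [H1 _]. specialize (H1 n).
    apply (Cconv_shift _ _ n) in H1. eapply (Cconv_ext _ _ _ O); [|exact H1].
    intros m _. cbv beta. rewrite Nat.add_comm, Csum_split, Csum_zero.
    - rewrite (Csum_ext _ (fun k => a (n + k)%nat * RtoC (INR (binom (n + k) n)) * z ^ k)%C).
      + ring.
      + intros k _. replace (n + k - n)%nat with k by lia. ring.
    - intros k Hk. rewrite binom_gt by lia. simpl. ring. }
  assert (Hest : forall n k,
    Cmod (a (n + k)%nat) * INR (binom (n + k) n) * r ^ k * d ^ n <= M).
  { intros n k. set (r' := (r + R) / 2).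
    assert (Hr' : r < r' < R) by (unfold r'; lra).
    assert (Hdn : 0 < d ^ n) by (apply pow_lt; auto).
    apply (proj2 (Rle_div_r _ _ _ Hdn)).
    assert (Hmr : Cmod (RtoC r') = r') by (rewrite Cmod_R, Rabs_pos_eq; lra).
    destruct (series_terms_bounded _ _ _ (Hser n (RtoC r') ltac:(lra))) as [M2 [_ HM2]].
    rewrite Hmr in HM2.
    pose proof (Cauchy_estimate _ (fun z => b z n) r' M2 r (M / d ^ n) k ltac:(lra) HM2) as HC.
    cbv beta in HC. rewrite Cmod_mult, Cmod_R, Rabs_pos_eq in HC by apply pos_INR.
    apply HC.
    - intros z Hz. apply Hser; lra.
    - intros z Hz. apply (proj1 (Rle_div_r _ _ _ Hdn)). apply Hb; lra. }
  rewrite <- (binomial_formula_R r d N (S N)) by lia.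
  rewrite <- Rsum_scal, <- Rsum_const. apply Rsum_le. intros n Hn.
  specialize (Hest n (N - n)%nat). replace (n + (N - n))%nat with N in Hest by lia. lra.
Qed.

Lemma linear_times_geom_bounded : forall q, 0 <= q < 1 ->
  exists B, 0 < B /\ forall N, INR (S N) * q ^ N <= B.
Proof.
  intros q Hq. exists (/ (1 - q)). split; [apply Rinv_0_lt_compat; lra|].
  intros N. eapply Rle_trans; [|apply (Rsum_geom_le q (S N) Hq)].
  rewrite <- Rsum_const. apply Rsum_le. intros k Hk.
  replace N with (k + (N - k))%nat by lia. rewrite pow_add.
  rewrite <- (Rmult_1_r (q ^ k)) at 2. apply Rmult_le_compat_l; [apply pow_le; lra|].
  rewrite <- (pow1 (N - k)). apply pow_incr; lra.
Qed.

(** The largest disc about 0 on which the Taylor series represents [g] is the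
    whole unit disc: otherwise the coefficient bound extends the disc of
    convergence, and uniqueness of local coefficients carries the identity with
    [g] across the old boundary circle. *)
Theorem taylor_series_on_disc : forall g : HD,
  exists a : nat -> C, forall z, disc z -> series_to a z (g z).
Proof.
  intros g.
  destruct (analytic_expands g (RtoC 0)) as [a [d0 [M0 [HM0 [Hd0 [HMa Ha]]]]]].
  { apply HD_analytic. red. rewrite Cmod_0. lra. }
  assert (Ha0 : forall z, Cmod z < d0 -> series_to a z (g z)).
  { intros z Hz. replace z with (RtoC 0 + z)%C at 2 by ring. auto. }
  exists a.
  set (S := fun R => 0 < R <= 1 /\ forall z, Cmod z < R -> series_to a z (g z)).
  assert (HS0 : S (Rmin d0 1)).
  { split.
    - split; [apply Rmin_pos; lra|apply Rmin_r].
    - intros z Hz. apply Ha0. pose proof (Rmin_l d0 1). lra. }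
  destruct (completeness S) as [rho [Hub Hlub]].
  { exists 1. intros R [HR _]. lra. }
  { exists (Rmin d0 1). auto. }
  assert (Hrho : 0 < rho).
  { apply Rlt_le_trans with (Rmin d0 1); [apply HS0|apply Hub, HS0]. }
  assert (Hin : forall z, Cmod z < rho -> series_to a z (g z)).
  { intros z Hz. apply NNPP. intros Hn.
    assert (rho <= Cmod z); [|lra].
    apply Hlub. intros R [HR1 HR2]. apply Rnot_lt_le. intros Hlt. apply Hn, HR2; auto. }
  destruct (Rle_lt_dec 1 rho) as [H1|H1].
  { intros z Hz. apply Hin. red in Hz. lra. }
  exfalso.
  destruct (uniform_expansion g rho Hrho) as [d1 [M [Hd1 Hexp1]]].
  { intros z Hz. apply HD_analytic. red. lra. }
  set (d := Rmin d1 rho).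
  assert (Hd : 0 < d <= rho) by (split; [apply Rmin_pos; auto|apply Rmin_r]).
  assert (Hexp : forall z, Cmod z <= rho -> exists b, expands g z b d M).
  { intros z Hz. destruct (Hexp1 z Hz) as [b Hb]. exists b.
    eapply expands_shrink; [exact Hb| |lra]. split; [lra|apply Rmin_l]. }
  set (R1 := rho + d / 2).
  assert (HR1 : exists M1, forall N, Cmod (a N) * R1 ^ N <= M1).
  { set (q := R1 / (rho + 3 * d / 4)).
    assert (Hq : 0 <= q < 1).
    { unfold q, R1. split; [apply Rdiv_le_0_compat; lra|apply Rlt_div_l; lra]. }
    destruct (linear_times_geom_bounded q Hq) as [B [HB0 HB]].
    exists (B * M). intros N.
    pose proof (taylor_coefficients_bound g a rho d M Hrho Hin Hexp (rho - d / 4) N ltac:(lra)) as HT.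
    replace (rho - d / 4 + d) with (rho + 3 * d / 4) in HT by field.
    replace (R1 ^ N) with ((rho + 3 * d / 4) ^ N * q ^ N).
    2:{ rewrite <- Rpow_mult_distr. f_equal. unfold q. field. lra. }
    assert (HMp : 0 <= M).
    { destruct (Hexp (RtoC 0)) as [b [_ [Hb _]]]; [rewrite Cmod_0; lra|].
      eapply Rle_trans; [|apply (Hb O)]. simpl. pose proof (Cmod_ge_0 (b O)). lra. }
    rewrite <- Rmult_assoc.
    apply Rle_trans with (INR (Datatypes.S N) * M * q ^ N).
    - apply Rmult_le_compat_r; [apply pow_le; lra|exact HT].
    - specialize (HB N). replace (INR (Datatypes.S N) * M * q ^ N) with (INR (Datatypes.S N) * q ^ N * M) by ring.
      apply Rmult_le_compat_r; auto. }
  destruct HR1 as [M1 HM1].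
  assert (HR1 : 0 < R1) by (unfold R1; lra).
  assert (Hext : forall z, Cmod z < rho + d / 4 -> series_to a z (g z)).
  { intros z Hz. destruct (Rlt_le_dec (Cmod z) rho) as [Hlt|Hge]; [auto|].
    (* [z1] lies on the ray of [z], inside the old disc, and both the expansion
       of [g] about [z1] and the re-expanded Taylor series reach [z] *)
    set (z1 := (RtoC ((rho - d / 4) / Cmod z) * z)%C).
    assert (Hz1 : Cmod z1 = rho - d / 4).
    { unfold z1. rewrite Cmod_mult, Cmod_R, Rabs_pos_eq.
      - field. lra.
      - apply Rdiv_le_0_compat; lra. }
    assert (Hzz : Cmod (z - z1)%C < d / 2).
    { replace (z - z1)%C with (RtoC (1 - (rho - d / 4) / Cmod z) * z)%C
        by (unfold z1; rewrite RtoC_minus; ring).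
      assert (Hq1 : (rho - d / 4) / Cmod z <= 1) by (apply Rle_div_l; lra).
      rewrite Cmod_mult, Cmod_R, Rabs_pos_eq by lra.
      replace ((1 - (rho - d / 4) / Cmod z) * Cmod z) with (Cmod z - (rho - d / 4)) by (field; lra).
      lra. }
    destruct (Hexp z1 ltac:(lra)) as [b' [_ [_ Hs']]].
    destruct (reexpand a R1 M1 z1 HR1 ltac:(unfold R1; lra) HM1) as [b [_ [_ Hs]]].
    destruct (series_exists a R1 M1 z HR1 ltac:(unfold R1; lra) HM1) as [l Hl].
    assert (E : forall n, b n = b' n).
    { apply (series_coef_unique b b' (fun h => g (z1 + h)%C) (d / 4)); [lra| |].
      - intros h Hh. apply Hs; [unfold R1; lra|]. apply Hin.
        eapply Rle_lt_trans; [apply Cmod_triangle|lra].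
      - intros h Hh. apply Hs'; lra. }
    assert (Hbl : series_to b (z - z1)%C l).
    { apply Hs; [unfold R1; lra|]. replace (z1 + (z - z1))%C with z by ring. auto. }
    assert (Hbg : series_to b' (z - z1)%C (g z)).
    { replace (g z) with (g (z1 + (z - z1))%C) by (f_equal; ring). apply Hs'. lra. }
    assert (Hbg' : series_to b (z - z1)%C (g z)).
    { eapply (Cconv_ext _ _ _ O); [|exact Hbg]. intros n _. apply Csum_ext.
      intros k _. rewrite E. auto. }
    rewrite (series_unique _ _ _ _ Hbg' Hbl). exact Hl. }
  assert (Hmem : S (Rmin (rho + d / 4) 1)).
  { split.
    - split; [apply Rmin_pos; lra|apply Rmin_r].
    - intros z Hz. apply Hext. pose proof (Rmin_l (rho + d / 4) 1). lra. }
  apply Hub in Hmem. apply Rmin_case_strong with (P := fun x => x <= rho -> False) in Hmem; auto; intros; lra.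
Qed.

(** By Abel's lemma these are the coefficient sequences of the functions analytic
    in the unit disc. *)
Definition tame (a : nat -> C) : Prop :=
  forall r, 0 < r < 1 -> exists M, forall k, Cmod (a k) * r ^ k <= M.

Lemma tame_series : forall a z, tame a -> disc z -> exists l, series_to a z l.
Proof.
  intros a z Ha Hz. red in Hz. pose proof (Cmod_ge_0 z).
  destruct (Ha ((1 + Cmod z) / 2) ltac:(lra)) as [M HM].
  apply (series_exists a ((1 + Cmod z) / 2) M z); auto; lra.
Qed.

Lemma tame_of_series : forall a (F : C -> C),
  (forall z, disc z -> series_to a z (F z)) -> tame a.
Proof.
  intros a F H r Hr.
  assert (E : Cmod (RtoC r) = r) by (rewrite Cmod_R, Rabs_pos_eq; lra).
  destruct (series_terms_bounded a (RtoC r) (F (RtoC r))) as [M [_ HM]].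
  - apply H. red. lra.
  - rewrite E in HM. exists M. auto.
Qed.

Lemma HD_of_coefficients : forall a, tame a ->
  exists f : HD, forall z, disc z -> series_to a z (f z).
Proof.
  intros a Ha.
  set (f := fun z => epsilon (inhabits (RtoC 0)) (fun l => series_to a z l)).
  assert (Hf : forall z, disc z -> series_to a z (f z)).
  { intros z Hz. unfold f. apply epsilon_spec. apply tame_series; auto. }
  assert (Han : forall z, disc z -> analytic_at f z).
  { intros z Hz. red in Hz. pose proof (Cmod_ge_0 z) as Hz0. set (R := (1 + Cmod z) / 2).
    assert (HR : Cmod z < R < 1) by (unfold R; lra).
    destruct (Ha R ltac:(lra)) as [M HM].
    destruct (reexpand a R M z ltac:(lra) ltac:(lra) HM) as [b [_ [_ Hb]]].
    exists b. apply locally_Cmod. exists (R - Cmod z). split; [lra|].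
    intros y Hy. apply is_Cpseries_iff. apply Hb; [lra|].
    replace (z + (y - z))%C with y by ring. apply Hf. red.
    replace y with (z + (y - z))%C by ring.
    eapply Rle_lt_trans; [apply Cmod_triangle|lra]. }
  exists (mkHD f Han). exact Hf.
Qed.

Lemma HD_continuous : forall (f : HD) z0, disc z0 -> forall eps, 0 < eps ->
  exists e, 0 < e /\ forall z, Cmod (z - z0)%C < e -> Cmod (f z - f z0)%C < eps.
Proof.
  intros f z0 Hz0. destruct (analytic_expands f z0 (HD_analytic f z0 Hz0)) as [b [d [M [_ Hb]]]].
  apply (expands_continuous f z0 b d M Hb).
Qed.

Lemma compact_in_smaller_disc : forall K, compactC K -> (forall z, K z -> disc z) ->
  exists rho, 0 < rho < 1 /\ forall z, K z -> Cmod z <= rho.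
Proof.
  intros K HK HD.
  (* these concentric discs exhaust the unit disc *)
  destruct (HK nat (fun n z => Cmod z < 1 - / (INR n + 2))) as [l Hl].
  - intros n z Hz. apply locally_Cmod. exists (1 - / (INR n + 2) - Cmod z). split; [lra|].
    intros y Hy. pose proof (Cmod_triangle z (y - z)%C) as HT.
    replace (z + (y - z))%C with y in HT by ring. lra.
  - intros z Hz. specialize (HD z Hz). red in HD.
    destruct (archimed_cor1 (1 - Cmod z)) as [n [Hn Hn0]]; [lra|].
    exists n. assert (/ (INR n + 2) < / INR n); [|lra].
    apply lt_0_INR in Hn0. apply Rinv_lt_contravar; nra.
  - set (m := fold_right max O l).
    assert (Hm : forall i, In i l -> (i <= m)%nat).
    { unfold m. clear. induction l as [|x l IH]; simpl; intros i [].
      - subst. lia.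
      - specialize (IH i H). lia. }
    pose proof (pos_INR m) as Hmp.
    assert (Hi : 0 < / (INR m + 2) <= / 2).
    { split; [apply Rinv_0_lt_compat; lra|apply Rinv_le_contravar; lra]. }
    exists (1 - / (INR m + 2)). split; [lra|].
    intros z Hz. destruct (Hl z Hz) as [i [Hi1 Hi2]].
    apply Hm in Hi1. apply le_INR in Hi1. pose proof (pos_INR i).
    assert (/ (INR m + 2) <= / (INR i + 2)) by (apply Rinv_le_contravar; lra). lra.
Qed.

(** * The weighted shift on coefficients *)

(** In the coordinates [nu alpha k * a k] the weighted shift becomes the plain
    backward shift. *)
Definition nu (alpha : R) (k : nat) : R := Rpower (INR (S k)) alpha.

Lemma nu_pos : forall alpha k, 0 < nu alpha k.
Proof. intros. apply exp_pos. Qed.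

Lemma weight_nu : forall alpha k, weight alpha (S k) = nu alpha (S k) / nu alpha k.
Proof.
  intros alpha k. unfold weight, nu.
  assert (H : 0 < INR (S k)) by (apply lt_0_INR; lia).
  assert (H' : 0 < / INR (S k)) by (apply Rinv_0_lt_compat; auto).
  replace (INR (S (S k))) with ((1 + / INR (S k)) * INR (S k)).
  - rewrite <- Rpower_mult_distr by lra. field. apply Rgt_not_eq, exp_pos.
  - rewrite (S_INR (S k)). field. lra.
Qed.

Lemma nu_growth : forall alpha n k, nu alpha (n + k) <= Rpower (INR (S n)) (Rabs alpha) * Rpower (INR (S k)) (Rabs alpha).
Proof.
  intros alpha n k. unfold nu.
  assert (Hn : 0 < INR (S n)) by (apply lt_0_INR; lia).
  assert (Hk : 0 < INR (S k)) by (apply lt_0_INR; lia).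
  rewrite Rpower_mult_distr, <- mult_INR by auto.
  assert (H1 : 1 <= INR (S (n + k))) by (apply (le_INR 1); lia).
  apply Rle_trans with (Rpower (INR (S (n + k))) (Rabs alpha)).
  - apply Rle_Rpower; auto. apply Rle_abs.
  - apply Rle_Rpower_l; [apply Rabs_pos|]. split; [lra|]. apply le_INR. nia.
Qed.

Lemma exp_le_compat : forall x y, x <= y -> exp x <= exp y.
Proof. intros x y [H|H]; [left; apply exp_increasing; auto|rewrite H; lra]. Qed.

Lemma ln_le_pred : forall y, 0 < y -> ln y <= y - 1.
Proof.
  intros y Hy. pose proof (exp_ineq1_le (ln y)) as H. rewrite exp_ln in H by auto. lra.
Qed.

Lemma Rpower_le_exp : forall s eps, 0 < s -> 0 < eps ->
  exists B, 0 < B /\ forall x, 0 < x -> Rpower x s <= B * exp (eps * x).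
Proof.
  intros s eps Hs He. exists (exp (s * ln (s / eps))). split; [apply exp_pos|].
  intros x Hx. unfold Rpower. rewrite <- exp_plus. apply exp_le_compat.
  assert (Hse : 0 < s / eps) by (apply Rdiv_lt_0_compat; auto).
  assert (Hy : 0 < x * (eps / s)) by (apply Rmult_lt_0_compat; [auto|apply Rdiv_lt_0_compat; auto]).
  replace x with ((s / eps) * (x * (eps / s))) at 1 by (field; lra).
  rewrite ln_mult by auto. pose proof (ln_le_pred _ Hy) as H.
  apply Rmult_le_compat_l with (r := s) in H; [|lra].
  replace (s * (x * (eps / s) - 1)) with (eps * x - s) in H by (field; lra). lra.
Qed.

Lemma Rpower_geom_bounded : forall s q, 0 <= q < 1 ->
  exists B, 0 < B /\ forall k, Rpower (INR (S k)) s * q ^ k <= B.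
Proof.
  intros s q Hq. set (q' := Rmax q (/ 2)). set (s' := Rmax s 1).
  assert (Hq' : q <= q' < 1 /\ 0 < q').
  { unfold q'. pose proof (Rmax_l q (/ 2)). pose proof (Rmax_r q (/ 2)).
    assert (Rmax q (/ 2) < 1) by (apply Rmax_lub_lt; lra). lra. }
  assert (Hs' : s <= s' /\ 1 <= s') by (split; [apply Rmax_l|apply Rmax_r]).
  assert (He : 0 < - ln q').
  { pose proof (ln_le_pred q' ltac:(lra)). lra. }
  destruct (Rpower_le_exp s' (- ln q') ltac:(lra) He) as [B [HB0 HB]].
  exists (B * exp (- ln q')). split; [apply Rmult_lt_0_compat; [auto|apply exp_pos]|].
  intros k.
  assert (H1 : 1 <= INR (S k)) by (apply (le_INR 1); lia).
  apply Rle_trans with (B * exp (- ln q' * INR (S k)) * q' ^ k).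
  - apply Rmult_le_compat; [left; apply exp_pos|apply pow_le; lra| |apply pow_incr; lra].
    eapply Rle_trans; [apply Rle_Rpower; [exact H1|apply Hs']|]. apply HB. lra.
  - right. rewrite <- (Rpower_pow k q') by lra. unfold Rpower.
    rewrite Rmult_assoc, <- exp_plus. do 2 f_equal. rewrite S_INR. ring.
Qed.

Lemma tame_bound : forall (a : nat -> C) c s, 0 <= c ->
  (forall k, Cmod (a k) <= c * Rpower (INR (S k)) s) -> tame a.
Proof.
  intros a c s Hc H r Hr.
  destruct (Rpower_geom_bounded s r ltac:(lra)) as [B [HB0 HB]].
  exists (c * B). intros k.
  apply Rle_trans with (c * (Rpower (INR (S k)) s * r ^ k)).
  - rewrite <- Rmult_assoc. apply Rmult_le_compat_r; [apply pow_le; lra|auto].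
  - apply Rmult_le_compat_l; auto.
Qed.

Definition shift_coef (alpha : R) (n : nat) (a : nat -> C) (k : nat) : C :=
  (a (n + k)%nat * RtoC (nu alpha (n + k) / nu alpha k))%C.

Lemma shift_coef_tame : forall alpha n a, tame a -> tame (shift_coef alpha n a).
Proof.
  intros alpha n a Ha r Hr. set (r' := (1 + r) / 2).
  assert (Hr' : r < r' < 1) by (unfold r'; lra).
  destruct (Ha r' ltac:(lra)) as [M HM].
  destruct (Rpower_geom_bounded (2 * Rabs alpha) (r / r')) as [B [HB0 HB]].
  { split; [apply Rdiv_le_0_compat; lra|apply Rlt_div_l; lra]. }
  exists (M / r' ^ n * Rpower (INR (S n)) (Rabs alpha) * B). intros k.
  unfold shift_coef. rewrite Cmod_mult, Cmod_R.
  pose proof (nu_pos alpha (n + k)) as H1. pose proof (nu_pos alpha k) as H2.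
  rewrite Rabs_pos_eq by (apply Rdiv_le_0_compat; lra).
  assert (Hk1 : 1 <= INR (S k)) by (apply (le_INR 1); lia).
  assert (Hinv : / nu alpha k <= Rpower (INR (S k)) (Rabs alpha)).
  { unfold nu. rewrite <- Rpower_Ropp. apply Rle_Rpower; auto.
    rewrite <- Rabs_Ropp. apply Rle_abs. }
  pose proof (nu_growth alpha n k) as Hg.
  assert (HP : 0 < Rpower (INR (S n)) (Rabs alpha)) by apply exp_pos.
  assert (HQ : 0 < Rpower (INR (S k)) (Rabs alpha)) by apply exp_pos.
  assert (Hrat : nu alpha (n + k) / nu alpha k <=
     Rpower (INR (S n)) (Rabs alpha) * Rpower (INR (S k)) (2 * Rabs alpha)).
  { replace (2 * Rabs alpha) with (Rabs alpha + Rabs alpha) by ring. rewrite Rpower_plus.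
    rewrite <- Rmult_assoc. unfold Rdiv. apply Rmult_le_compat; try lra.
    left; apply Rinv_0_lt_compat; auto. }
  specialize (HM (n + k)%nat). rewrite pow_add in HM.
  assert (Hrn : 0 < r' ^ n) by (apply pow_lt; lra).
  assert (Hrk : 0 < r' ^ k) by (apply pow_lt; lra).
  assert (HA : Cmod (a (n + k)%nat) * r' ^ k <= M / r' ^ n).
  { apply (proj1 (Rle_div_r _ _ _ Hrn)). lra. }
  specialize (HB k).
  replace (r ^ k) with (r' ^ k * (r / r') ^ k).
  2:{ rewrite <- Rpow_mult_distr. f_equal. field. lra. }
  assert (Hq0 : 0 <= (r / r') ^ k) by (apply pow_le, Rdiv_le_0_compat; lra).
  pose proof (Cmod_ge_0 (a (n + k)%nat)) as Ha0.
  apply Rle_trans with ((Cmod (a (n + k)%nat) * r' ^ k) *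
    (Rpower (INR (S n)) (Rabs alpha) * (Rpower (INR (S k)) (2 * Rabs alpha) * (r / r') ^ k))).
  - replace (Cmod (a (n + k)%nat) * (nu alpha (n + k) / nu alpha k) * (r' ^ k * (r / r') ^ k))
      with ((Cmod (a (n + k)%nat) * r' ^ k) * ((nu alpha (n + k) / nu alpha k) * (r / r') ^ k)) by ring.
    apply Rmult_le_compat_l; [apply Rmult_le_pos; lra|].
    rewrite <- Rmult_assoc. apply Rmult_le_compat_r; auto.
  - rewrite (Rmult_assoc (M / r' ^ n)). apply Rmult_le_compat.
    + apply Rmult_le_pos; lra.
    + apply Rmult_le_pos; [lra|]. apply Rmult_le_pos; [left; apply exp_pos|auto].
    + exact HA.
    + apply Rmult_le_compat_l; [lra|exact HB].
Qed.

(** The function chosen in the definition of the shift may come with its own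
    coefficient sequence for [f]; uniqueness identifies it with [a]. *)
Lemma taylor_shift_coef : forall alpha (f : HD) a,
  (forall z, disc z -> series_to a z (f z)) ->
  forall z, disc z -> series_to (shift_coef alpha 1 a) z (taylor_shift alpha f z).
Proof.
  intros alpha f a Ha.
  assert (Hsh : forall a' k, (a' (S k) * RtoC (weight alpha (S k)))%C = shift_coef alpha 1 a' k).
  { intros a' k. unfold shift_coef. rewrite weight_nu. reflexivity. }
  assert (Hex : exists g, is_taylor_shift alpha f g).
  { destruct (HD_of_coefficients (shift_coef alpha 1 a)) as [g Hg].
    - apply shift_coef_tame. apply (tame_of_series a f Ha).
    - exists g, a. split; intros z Hz; apply is_Cpseries_iff; auto.
      eapply (Cconv_ext _ _ _ O); [|apply Hg; exact Hz].
      intros n _. apply Csum_ext. intros k _. rewrite Hsh. auto. }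
  destruct (epsilon_spec (inhabits f) _ Hex) as [a' [H1 H2]].
  fold (taylor_shift alpha f) in H2.
  assert (E : forall k, a' k = a k).
  { apply (series_coef_unique a' a f 1); [lra| |].
    - intros h Hh. apply is_Cpseries_iff. apply H1. exact Hh.
    - intros h Hh. apply Ha. exact Hh. }
  intros z Hz. specialize (H2 z Hz). apply is_Cpseries_iff in H2.
  eapply (Cconv_ext _ _ _ O); [|exact H2].
  intros n _. apply Csum_ext. intros k _. rewrite Hsh. unfold shift_coef. rewrite E. auto.
Qed.

Lemma taylor_shift_iter_coef : forall alpha (f : HD) a,
  (forall z, disc z -> series_to a z (f z)) ->
  forall n z, disc z ->
  series_to (shift_coef alpha n a) z (Nat.iter n (taylor_shift alpha) f z).
Proof.
  intros alpha f a Ha n; induction n as [|n IH]; intros z Hz.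
  - simpl. eapply (Cconv_ext _ _ _ O); [|apply (Ha z Hz)].
    intros m _. apply Csum_ext. intros k _. unfold shift_coef. simpl.
    replace (nu alpha k / nu alpha k) with 1 by (field; apply Rgt_not_eq, nu_pos). ring.
  - simpl. pose proof (taylor_shift_coef alpha _ _ IH z Hz) as H.
    eapply (Cconv_ext _ _ _ O); [|exact H].
    intros m _. apply Csum_ext. intros k _. unfold shift_coef.
    replace (S n + k)%nat with (n + (1 + k))%nat by lia.
    rewrite <- (Cmult_assoc (a _)), <- RtoC_mult.
    do 3 f_equal. field. split; apply Rgt_not_eq, nu_pos.
Qed.

(** * Real powers *)

(** Bernoulli's inequality for exponents below 1, that is, the weighted
    arithmetic-geometric inequality for [x] and 1. *)
Lemma Rpower_le_tangent : forall x a, 0 < x -> 0 < a < 1 -> Rpower x a <= 1 + a * (x - 1).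
Proof.
  intros x a Hx Ha. set (m := 1 + a * (x - 1)).
  assert (Hm : 0 < m) by (unfold m; nra).
  rewrite <- (exp_ln m Hm). unfold Rpower. apply exp_le_compat.
  assert (Hm' : 0 < / m) by (apply Rinv_0_lt_compat; auto).
  pose proof (ln_le_pred (x * / m) ltac:(apply Rmult_lt_0_compat; auto)) as H1.
  pose proof (ln_le_pred (/ m) Hm') as H2.
  rewrite ln_mult in H1 by auto. rewrite ln_Rinv in H1, H2 by auto.
  assert (H3 : a * (x * / m) + (1 - a) * / m = 1) by (unfold m in *; field; lra).
  nra.
Qed.

Lemma Rpower_ge_tangent : forall t p, 0 < t -> 1 < p -> 1 + p * (t - 1) <= Rpower t p.
Proof.
  intros t p Ht Hp.
  assert (Hp' : 0 < / p < 1).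
  { split; [apply Rinv_0_lt_compat; lra|]. rewrite <- Rinv_1. apply Rinv_lt_contravar; lra. }
  pose proof (Rpower_le_tangent (Rpower t p) (/ p) ltac:(apply exp_pos) Hp') as H.
  rewrite Rpower_mult, Rinv_r, Rpower_1 in H by lra.
  apply Rmult_le_compat_l with (r := p) in H; [|lra].
  replace (p * (1 + / p * (Rpower t p - 1))) with (p + (Rpower t p - 1)) in H by (field; lra).
  lra.
Qed.

Lemma pow_nonneg_pos : forall x a, 0 < x -> pow_nonneg x a = Rpower x a.
Proof. intros x a H. unfold pow_nonneg. destruct (Rlt_dec 0 x); [auto|lra]. Qed.

Lemma pow_nonneg_0 : forall x a, x <= 0 -> pow_nonneg x a = 0.
Proof. intros x a H. unfold pow_nonneg. destruct (Rlt_dec 0 x); [lra|auto]. Qed.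

Lemma pow_nonneg_ge_0 : forall x a, 0 <= pow_nonneg x a.
Proof. intros x a. unfold pow_nonneg. destruct (Rlt_dec 0 x); [left; apply exp_pos|lra]. Qed.

Lemma pow_nonneg_le : forall x y a, 0 <= a -> x <= y -> pow_nonneg x a <= pow_nonneg y a.
Proof.
  intros x y a Ha H. destruct (Rlt_le_dec 0 x) as [Hx|Hx].
  - rewrite !pow_nonneg_pos by lra. apply Rle_Rpower_l; lra.
  - rewrite (pow_nonneg_0 x) by auto. apply pow_nonneg_ge_0.
Qed.

Lemma pow_nonneg_mult : forall c x a, 0 < c -> 0 <= x ->
  pow_nonneg (c * x) a = Rpower c a * pow_nonneg x a.
Proof.
  intros c x a Hc Hx. destruct (Rlt_le_dec 0 x) as [H|H].
  - rewrite !pow_nonneg_pos by nra. rewrite Rpower_mult_distr; auto.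
  - rewrite !pow_nonneg_0 by nra. ring.
Qed.

(** Average the tangent line inequality at the point [lam * u + (1 - lam) * v]. *)
Lemma pow_nonneg_convex : forall u v lam p, 0 <= u -> 0 <= v -> 0 < lam < 1 -> 1 < p ->
  pow_nonneg (lam * u + (1 - lam) * v) p <= lam * pow_nonneg u p + (1 - lam) * pow_nonneg v p.
Proof.
  intros u v lam p Hu Hv Hl Hp. set (w := lam * u + (1 - lam) * v).
  destruct (Rlt_le_dec 0 w) as [Hw|Hw].
  2:{ rewrite (pow_nonneg_0 w) by auto. pose proof (pow_nonneg_ge_0 u p).
      pose proof (pow_nonneg_ge_0 v p). nra. }
  assert (Htan : forall x, 0 <= x -> Rpower w p * (1 + p * (x / w - 1)) <= pow_nonneg x p).
  { intros x Hx. assert (HW : 0 < Rpower w p) by apply exp_pos.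
    destruct (Rlt_le_dec 0 x) as [H|H].
    - rewrite pow_nonneg_pos by auto.
      assert (Hxw : 0 < x / w) by (apply Rdiv_lt_0_compat; auto).
      replace (Rpower x p) with (Rpower w p * Rpower (x / w) p).
      + apply Rmult_le_compat_l; [lra|]. apply Rpower_ge_tangent; auto.
      + rewrite Rpower_mult_distr by auto. f_equal. field. lra.
    - rewrite pow_nonneg_0 by auto. replace x with 0 by lra.
      unfold Rdiv; rewrite Rmult_0_l. nra. }
  pose proof (Htan u Hu) as H1. pose proof (Htan v Hv) as H2.
  rewrite (pow_nonneg_pos w) by auto.
  assert (E : lam * (Rpower w p * (1 + p * (u / w - 1))) +
     (1 - lam) * (Rpower w p * (1 + p * (v / w - 1))) = Rpower w p).
  { replace (lam * (Rpower w p * (1 + p * (u / w - 1))) +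
     (1 - lam) * (Rpower w p * (1 + p * (v / w - 1)))) with
     (Rpower w p * (1 + p * ((lam * u + (1 - lam) * v) / w - 1))) by (field; lra).
    fold w. field. lra. }
  nra.
Qed.

Lemma continuous_eps : forall (f : R -> R) x,
  (forall eps, 0 < eps -> exists d, 0 < d /\ forall y, Rabs (y - x) < d -> Rabs (f y - f x) < eps) ->
  continuous f x.
Proof.
  intros f x H. apply filterlim_locally. intros eps.
  destruct (H eps (cond_pos eps)) as [d [Hd Hy]].
  exists (mkposreal d Hd). intros y Hb. apply Hy, Hb.
Qed.

Lemma pow_nonneg_continuous : forall p x, 0 < p -> continuous (fun y => pow_nonneg y p) x.
Proof.
  intros p x Hp. destruct (Rtotal_order x 0) as [H|[H|H]].
  - apply continuous_ext_loc with (fun _ => 0).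
    + exists (mkposreal (- x) ltac:(lra)). intros y Hy.
      unfold ball in Hy; simpl in Hy; unfold AbsRing_ball, abs, minus, plus, opp in Hy; simpl in Hy.
      symmetry. apply pow_nonneg_0. apply Rabs_lt_between in Hy. lra.
    + apply continuous_const.
  - subst x. apply continuous_eps. intros eps He.
    exists (Rpower eps (/ p)). split; [apply exp_pos|]. intros y Hy.
    rewrite (pow_nonneg_0 0), Rminus_0_r by lra. rewrite Rminus_0_r in Hy.
    rewrite Rabs_pos_eq by apply pow_nonneg_ge_0.
    destruct (Rlt_le_dec 0 y) as [H|H].
    + rewrite pow_nonneg_pos by auto. rewrite Rabs_pos_eq in Hy by lra.
      replace eps with (Rpower (Rpower eps (/ p)) p).
      * apply Rlt_Rpower_l; auto.
      * rewrite Rpower_mult, Rinv_l, Rpower_1; lra.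
    + rewrite pow_nonneg_0 by auto. auto.
  - apply continuous_ext_loc with (fun y => Rpower y p).
    + exists (mkposreal x H). intros y Hy.
      unfold ball in Hy; simpl in Hy; unfold AbsRing_ball, abs, minus, plus, opp in Hy; simpl in Hy.
      symmetry. apply pow_nonneg_pos. apply Rabs_lt_between in Hy. lra.
    + apply (@ex_derive_continuous R_AbsRing R_NormedModule).
      unfold Rpower. auto_derive. auto.
Qed.

(** * Continuous curves and their integral norms *)

Definition ccont (F : R -> C) : Prop :=
  forall t eps, 0 < eps -> exists d, 0 < d /\
    forall t', Rabs (t' - t) < d -> Cmod (F t' - F t)%C < eps.

Lemma ccont_const : forall c, ccont (fun _ => c).
Proof.
  intros c t eps He. exists 1. split; [lra|]. intros t' _.
  replace (c - c)%C with (RtoC 0) by ring. rewrite Cmod_0; auto.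
Qed.

Lemma ccont_plus : forall F G, ccont F -> ccont G -> ccont (fun t => F t + G t)%C.
Proof.
  intros F G HF HG t eps He.
  destruct (HF t (eps / 2)) as [d1 [Hd1 H1]]; [lra|].
  destruct (HG t (eps / 2)) as [d2 [Hd2 H2]]; [lra|].
  exists (Rmin d1 d2). split; [apply Rmin_pos; auto|]. intros t' Ht.
  pose proof (Rmin_l d1 d2). pose proof (Rmin_r d1 d2).
  specialize (H1 t' ltac:(lra)). specialize (H2 t' ltac:(lra)).
  replace (F t' + G t' - (F t + G t))%C with ((F t' - F t) + (G t' - G t))%C by ring.
  eapply Rle_lt_trans; [apply Cmod_triangle|lra].
Qed.

Lemma ccont_mult : forall F G, ccont F -> ccont G -> ccont (fun t => F t * G t)%C.
Proof.
  intros F G HF HG t eps He.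
  pose proof (Cmod_ge_0 (F t)) as HF0. pose proof (Cmod_ge_0 (G t)) as HG0.
  set (e := Rmin 1 (eps / (2 * (Cmod (F t) + Cmod (G t) + 1)))).
  assert (He1 : 0 < e).
  { apply Rmin_pos; [lra|apply Rdiv_lt_0_compat; lra]. }
  destruct (HF t e He1) as [d1 [Hd1 H1]]. destruct (HG t e He1) as [d2 [Hd2 H2]].
  exists (Rmin d1 d2). split; [apply Rmin_pos; auto|]. intros t' Ht.
  pose proof (Rmin_l d1 d2). pose proof (Rmin_r d1 d2).
  specialize (H1 t' ltac:(lra)). specialize (H2 t' ltac:(lra)).
  replace (F t' * G t' - F t * G t)%C with
    ((F t' - F t) * (G t' - G t) + ((F t' - F t) * G t + F t * (G t' - G t)))%C by ring.
  eapply Rle_lt_trans; [apply Cmod_triangle|].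
  pose proof (Cmod_triangle ((F t' - F t) * G t)%C (F t * (G t' - G t))%C) as HT.
  rewrite !Cmod_mult in *.
  pose proof (Cmod_ge_0 (F t' - F t)%C). pose proof (Cmod_ge_0 (G t' - G t)%C).
  assert (Hee : e <= 1) by apply Rmin_l.
  assert (Hee2 : e * (2 * (Cmod (F t) + Cmod (G t) + 1)) <= eps).
  { apply (Rle_div_r e eps); [lra|apply Rmin_r]. }
  nra.
Qed.

Lemma ccont_Csum : forall (F : nat -> R -> C) n, (forall k, ccont (F k)) ->
  ccont (fun t => Csum (fun k => F k t) n).
Proof.
  intros F n H. induction n as [|n IH]; simpl.
  - apply ccont_const.
  - apply ccont_plus; auto.
Qed.

Lemma ccont_pow : forall F n, ccont F -> ccont (fun t => F t ^ n)%C.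
Proof.
  intros F n H. induction n as [|n IH]; simpl.
  - apply ccont_const.
  - apply ccont_mult; auto.
Qed.

Lemma ccont_opp : forall F, ccont F -> ccont (fun t => - F t)%C.
Proof.
  intros F H t eps He. destruct (H t eps He) as [d [Hd H1]]. exists d. split; auto.
  intros t' Ht. replace (- F t' - - F t)%C with (- (F t' - F t))%C by ring.
  rewrite Cmod_opp. auto.
Qed.

Lemma ccont_of_continuous : forall f g : R -> R, 
  (forall t, continuous f t) -> (forall t, continuous g t) -> ccont (fun t => (f t, g t)).
Proof.
  intros f g Hf Hg t eps He.
  pose proof (proj1 (filterlim_locally _ _) (Hf t) (mkposreal (eps / 2) ltac:(lra))) as [d1 H1].
  pose proof (proj1 (filterlim_locally _ _) (Hg t) (mkposreal (eps / 2) ltac:(lra))) as [d2 H2].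
  exists (Rmin d1 d2). split; [apply Rmin_pos; apply cond_pos|]. intros t' Ht.
  pose proof (Rmin_l d1 d2). pose proof (Rmin_r d1 d2).
  assert (B1 := H1 t' ltac:(change (Rabs (t' - t) < d1); lra)).
  assert (B2 := H2 t' ltac:(change (Rabs (t' - t) < d2); lra)).
  change (Rabs (f t' - f t) < eps / 2) in B1. change (Rabs (g t' - g t) < eps / 2) in B2.
  replace eps with (2 * (eps / 2)) by field.
  apply Cmod_lt_box; simpl; [exact B1|exact B2].
Qed.

Lemma ccont_circle : forall r, ccont (circle_point r).
Proof.
  intros r. apply ccont_of_continuous; intros t;
    apply (@ex_derive_continuous R_AbsRing R_NormedModule); auto_derive; auto.
Qed.

Lemma ccont_HD_circle : forall (f : HD) r, 0 < r < 1 -> ccont (fun t => f (circle_point r t)).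
Proof.
  intros f r Hr t eps He.
  assert (Hd : disc (circle_point r t)) by (red; rewrite Cmod_circle; lra).
  destruct (HD_continuous f _ Hd eps He) as [e [He' H]].
  destruct (ccont_circle r t e He') as [d [Hd' H']].
  exists d. split; auto.
Qed.

Lemma ccont_integrand : forall F p, ccont F -> 0 < p ->
  ex_RInt (fun t => pow_nonneg (Cmod (F t)) p) 0 (2 * PI).
Proof.
  intros F p HF Hp. apply (@ex_RInt_continuous R_CompleteNormedModule).
  intros t _. apply (continuous_comp (fun t => Cmod (F t)) (fun y => pow_nonneg y p)).
  - apply continuous_eps. intros eps He. destruct (HF t eps He) as [d [Hd H]].
    exists d. split; auto. intros y Hy. eapply Rle_lt_trans; [|apply (H y Hy)].
    pose proof (Cmod_triangle (F y - F t)%C (F t)) as H1.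
    replace (F y - F t + F t)%C with (F y) in H1 by ring.
    pose proof (Cmod_triangle (F t - F y)%C (F y)) as H2.
    replace (F t - F y + F y)%C with (F t) in H2 by ring.
    rewrite (Cmod_minus_sym (F t)) in H2. apply Rabs_le. lra.
  - apply pow_nonneg_continuous; auto.
Qed.

(** Upper bounds for the integral means of a curve.  Requiring [0 < X] lets the
    triangle inequality follow from convexity with the weights [X / (X + Y)] and
    [Y / (X + Y)]. *)
Definition norm_bound (p : Rbar) (F : R -> C) (X : R) : Prop :=
  0 < X /\ ccont F /\
  match p with
  | Finite p => RInt (fun t => pow_nonneg (Cmod (F t)) p) 0 (2 * PI) <= 2 * PI * Rpower X p
  | _ => forall t, Cmod (F t) <= X
  end.

Lemma two_PI_pos : 0 < 2 * PI.
Proof. pose proof PI_RGT_0. lra. Qed.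

Lemma RInt_const_circle : forall c, RInt (fun _ => c) 0 (2 * PI) = 2 * PI * c.
Proof. intros c. apply is_RInt_unique, is_RInt_const_circle. Qed.

Lemma norm_bound_weaken : forall p F X Y, Rbar_lt 1 p -> norm_bound p F X -> X <= Y -> norm_bound p F Y.
Proof.
  intros p F X Y Hp [HX [HF H]] HXY. split; [lra|split; auto].
  pose proof two_PI_pos.
  destruct p as [p| |]; try (intros t; specialize (H t); lra).
  simpl in Hp. eapply Rle_trans; [exact H|]. apply Rmult_le_compat_l; [lra|].
  apply Rle_Rpower_l; lra.
Qed.

Lemma norm_bound_sup : forall p F X, Rbar_lt 1 p -> 0 < X -> ccont F ->
  (forall t, Cmod (F t) <= X) -> norm_bound p F X.
Proof.
  intros p F X Hp HX HF H. split; [auto|split; auto].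
  destruct p as [p| |]; auto. simpl in Hp.
  rewrite <- RInt_const_circle. pose proof two_PI_pos.
  apply RInt_le; [lra|apply ccont_integrand; auto; lra| |].
  - exists (2 * PI * Rpower X p). apply is_RInt_const_circle.
  - intros t _. rewrite <- pow_nonneg_pos by auto. apply pow_nonneg_le; [lra|auto].
Qed.

Lemma norm_bound_mult : forall p F h X B, Rbar_lt 1 p -> norm_bound p F X -> ccont h -> 0 < B ->
  (forall t, Cmod (h t) <= B) -> norm_bound p (fun t => h t * F t)%C (B * X).
Proof.
  intros p F h X B Hp [HX [HF H]] Hh HB HhB.
  assert (Hc : ccont (fun t => h t * F t)%C) by (apply ccont_mult; auto).
  assert (Hle : forall t, Cmod (h t * F t)%C <= B * Cmod (F t)).
  { intros t. rewrite Cmod_mult. apply Rmult_le_compat_r; [apply Cmod_ge_0|auto]. }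
  split; [apply Rmult_lt_0_compat; auto|split; auto].
  pose proof two_PI_pos.
  destruct p as [p| |].
  2,3: intros t; eapply Rle_trans; [apply Hle|]; apply Rmult_le_compat_l; [lra|auto].
  simpl in Hp.
  apply Rle_trans with (RInt (fun t => scal (Rpower B p) (pow_nonneg (Cmod (F t)) p)) 0 (2 * PI)).
  - apply RInt_le; [lra|apply ccont_integrand; auto; lra| |].
    + apply (@ex_RInt_scal R_NormedModule). apply ccont_integrand; auto; lra.
    + intros t _. unfold scal; simpl; unfold mult; simpl.
      rewrite <- pow_nonneg_mult by (auto; apply Cmod_ge_0).
      apply pow_nonneg_le; [lra|auto].
  - rewrite (@RInt_scal R_CompleteNormedModule) by (apply ccont_integrand; auto; lra).
    unfold scal; simpl; unfold mult; simpl.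
    rewrite <- Rpower_mult_distr by auto.
    assert (0 < Rpower B p) by apply exp_pos. nra.
Qed.

Lemma norm_bound_plus : forall p F G X Y, Rbar_lt 1 p ->
  norm_bound p F X -> norm_bound p G Y -> norm_bound p (fun t => F t + G t)%C (X + Y).
Proof.
  intros p F G X Y Hp [HX [HF HFX]] [HY [HG HGY]].
  assert (Hc : ccont (fun t => F t + G t)%C) by (apply ccont_plus; auto).
  split; [lra|split; auto].
  pose proof two_PI_pos as HPI.
  destruct p as [p| |].
  2,3: intros t; eapply Rle_trans; [apply Cmod_triangle|];
    specialize (HFX t); specialize (HGY t); lra.
  simpl in Hp.
  set (S := X + Y). set (lam := X / S).
  assert (HS : 0 < S) by (unfold S; lra).
  assert (Hl : 0 < lam < 1).
  { unfold lam. split; [apply Rdiv_lt_0_compat; lra|apply Rlt_div_l; unfold S; lra]. }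
  assert (Hl' : 1 - lam = Y / S) by (unfold lam, S; field; lra).
  assert (HSX : 0 < S / X) by (apply Rdiv_lt_0_compat; lra).
  assert (HSY : 0 < S / Y) by (apply Rdiv_lt_0_compat; lra).
  set (f1 := fun t => scal (lam * Rpower (S / X) p) (pow_nonneg (Cmod (F t)) p)).
  set (f2 := fun t => scal ((1 - lam) * Rpower (S / Y) p) (pow_nonneg (Cmod (G t)) p)).
  assert (E1 : ex_RInt f1 0 (2 * PI)).
  { apply (@ex_RInt_scal R_NormedModule). apply ccont_integrand; auto; lra. }
  assert (E2 : ex_RInt f2 0 (2 * PI)).
  { apply (@ex_RInt_scal R_NormedModule). apply ccont_integrand; auto; lra. }
  apply Rle_trans with (RInt (fun t => plus (f1 t) (f2 t)) 0 (2 * PI)).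
  - apply RInt_le; [lra|apply ccont_integrand; auto; lra|apply (@ex_RInt_plus R_NormedModule); auto|].
    intros t _. unfold f1, f2, plus, scal; simpl; unfold mult; simpl.
    pose proof (Cmod_ge_0 (F t)) as H1. pose proof (Cmod_ge_0 (G t)) as H2.
    apply Rle_trans with (pow_nonneg (lam * (S / X * Cmod (F t)) + (1 - lam) * (S / Y * Cmod (G t))) p).
    + apply pow_nonneg_le; [lra|]. eapply Rle_trans; [apply Cmod_triangle|].
      right. rewrite Hl'. unfold lam. field. lra.
    + eapply Rle_trans; [apply pow_nonneg_convex; auto; apply Rmult_le_pos; lra|].
      rewrite !pow_nonneg_mult by auto. lra.
  - rewrite (@RInt_plus R_CompleteNormedModule) by auto. unfold f1, f2.
    rewrite !(@RInt_scal R_CompleteNormedModule) by (apply ccont_integrand; auto; lra).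
    unfold plus, scal; simpl; unfold mult; simpl.
    assert (K1 : Rpower (S / X) p * Rpower X p = Rpower S p).
    { rewrite Rpower_mult_distr by auto. f_equal. field. lra. }
    assert (K2 : Rpower (S / Y) p * Rpower Y p = Rpower S p).
    { rewrite Rpower_mult_distr by auto. f_equal. field. lra. }
    assert (P1 : 0 < lam * Rpower (S / X) p) by (apply Rmult_lt_0_compat; [lra|apply exp_pos]).
    assert (P2 : 0 < (1 - lam) * Rpower (S / Y) p) by (apply Rmult_lt_0_compat; [lra|apply exp_pos]).
    apply Rmult_le_compat_l with (r := lam * Rpower (S / X) p) in HFX; [|lra].
    apply Rmult_le_compat_l with (r := (1 - lam) * Rpower (S / Y) p) in HGY; [|lra].
    replace (lam * Rpower (S / X) p * (2 * PI * Rpower X p)) with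
      (2 * PI * lam * (Rpower (S / X) p * Rpower X p)) in HFX by ring.
    replace ((1 - lam) * Rpower (S / Y) p * (2 * PI * Rpower Y p)) with
      (2 * PI * (1 - lam) * (Rpower (S / Y) p * Rpower Y p)) in HGY by ring.
    rewrite K1 in HFX. rewrite K2 in HGY. lra.
Qed.

Lemma norm_bound_Csum : forall p (F : nat -> R -> C) (X : nat -> R) B n, Rbar_lt 1 p -> 0 < B ->
  (forall i, norm_bound p (F i) (X i)) ->
  norm_bound p (fun t => Csum (fun i => F i t) n) (Rsum X n + B).
Proof.
  intros p F X B n Hp HB H. induction n as [|n IH]; simpl.
  - rewrite Rplus_0_l. apply norm_bound_sup; auto; [apply ccont_const|].
    intros t; rewrite Cmod_0; lra.
  - replace (Rsum X n + X n + B) with (Rsum X n + B + X n) by ring.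
    apply norm_bound_plus; auto.
Qed.

Lemma norm_bound_M_p : forall p (f : C -> C) r X, Rbar_lt 1 p ->
  norm_bound p (fun t => f (circle_point r t)) X -> Rbar_le (M_p p f r) X.
Proof.
  intros p f r X Hp [HX [HF H]]. pose proof two_PI_pos as HPI.
  destruct p as [p| |]; [| |destruct Hp].
  - simpl in Hp. simpl.
    apply Rle_trans with (pow_nonneg (Rpower X p) (/ p)).
    + apply pow_nonneg_le; [left; apply Rinv_0_lt_compat; lra|].
      apply Rmult_le_reg_l with (2 * PI); auto. rewrite <- Rmult_assoc, Rinv_r, Rmult_1_l by lra.
      exact H.
    + rewrite pow_nonneg_pos by apply exp_pos. rewrite Rpower_mult, Rinv_r, Rpower_1; lra.
  - simpl. destruct (Lub_Rbar_correct (fun x => exists t, 0 <= t <= 2 * PI /\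
        x = Cmod (f (circle_point r t)))) as [_ Hl].
    apply Hl. intros x [t [_ Ht]]. subst x. simpl. auto.
Qed.

(** * Polynomials with many coefficients 1 and small means *)

Definition is_one (x : R) : R := if Req_EM_T x 1 then 1 else 0.

Lemma is_one_ge_0 : forall x, 0 <= is_one x.
Proof. intros x. unfold is_one. destruct (Req_EM_T x 1); lra. Qed.

Definition gap_poly (c : nat -> R) (s m : nat) (z : C) : C :=
  Csum (fun l => RtoC (c l) * z ^ (s * l))%C m.

(** A block places a copy of a pattern at each coefficient 1 of a kernel, so a
    kernel needs a fixed proportion of them; the other coefficients only have to
    stay bounded.  The order is [2 ^ e], and the means may grow like its power
    [theta], uniformly in the radius [r] and in the gap [s] between copies. *)
Definition is_kernel (p : Rbar) (theta : R) (c : nat -> nat -> R) (A : R) : Prop :=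
  0 < A /\ forall e,
    (forall l, Rabs (c e l) <= 1) /\
    (forall l, (4 * 2 ^ e <= l)%nat -> c e l = 0) /\
    INR (2 ^ e) <= Rsum (fun l => is_one (c e l)) (4 * 2 ^ e) /\
    forall s r, (0 < s)%nat -> 0 < r < 1 ->
      norm_bound p (fun t => gap_poly (c e) s (4 * 2 ^ e) (circle_point r t))
        (A * Rpower (INR (2 ^ e)) theta).

Lemma pow2_pos : forall e, (0 < 2 ^ e)%nat.
Proof. intros e. apply Nat.neq_0_lt_0, Nat.pow_nonzero. lia. Qed.

Lemma INR_pow2_pos : forall e, 0 < INR (2 ^ e).
Proof. intros e. apply lt_0_INR, pow2_pos. Qed.

Lemma ccont_gap_poly : forall c s m r, ccont (fun t => gap_poly c s m (circle_point r t)).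
Proof.
  intros c s m r. apply (ccont_Csum (fun l t => RtoC (c l) * circle_point r t ^ (s * l))%C).
  intros k. apply ccont_mult; [apply ccont_const|apply ccont_pow, ccont_circle].
Qed.

(** * Rudin-Shapiro polynomials *)

Fixpoint rudin_shapiro (e : nat) : (nat -> R) * (nat -> R) :=
  match e with
  | O => (fun l => if Nat.eq_dec l 0 then 1 else 0, fun l => if Nat.eq_dec l 0 then 1 else 0)
  | S e => let P := fst (rudin_shapiro e) in let Q := snd (rudin_shapiro e) in
    (fun l => if lt_dec l (2 ^ e) then P l else Q (l - 2 ^ e)%nat,
     fun l => if lt_dec l (2 ^ e) then P l else - Q (l - 2 ^ e)%nat)
  end.

Lemma rudin_shapiro_sign : forall e l, (l < 2 ^ e)%nat ->
  (fst (rudin_shapiro e) l = 1 \/ fst (rudin_shapiro e) l = -1) /\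
  (snd (rudin_shapiro e) l = 1 \/ snd (rudin_shapiro e) l = -1).
Proof.
  induction e as [|e IH]; intros l Hl.
  - simpl in *. destruct (Nat.eq_dec l 0); [auto|lia].
  - cbn [rudin_shapiro fst snd]. destruct (lt_dec l (2 ^ e)) as [H|H].
    + destruct (IH l H). auto.
    + rewrite Nat.pow_succ_r' in Hl. destruct (IH (l - 2 ^ e)%nat ltac:(lia)) as [_ [E|E]]; rewrite E.
      * split; [auto|right; lra].
      * split; [auto|left; lra].
Qed.

Lemma rudin_shapiro_support : forall e l, (2 ^ e <= l)%nat ->
  fst (rudin_shapiro e) l = 0 /\ snd (rudin_shapiro e) l = 0.
Proof.
  induction e as [|e IH]; intros l Hl.
  - simpl in *. destruct (Nat.eq_dec l 0); [lia|auto].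
  - cbn [rudin_shapiro fst snd]. rewrite Nat.pow_succ_r' in Hl. destruct (lt_dec l (2 ^ e)) as [H|H]; [lia|].
    destruct (IH (l - 2 ^ e)%nat ltac:(lia)) as [_ E]. rewrite E. split; ring.
Qed.

Lemma rudin_shapiro_split : forall (c1 c2 : nat -> R) m w,
  Csum (fun l => RtoC (if lt_dec l m then c1 l else c2 (l - m)%nat) * w ^ l)%C (m + m) =
  (Csum (fun l => RtoC (c1 l) * w ^ l)%C m + w ^ m * Csum (fun l => RtoC (c2 l) * w ^ l)%C m)%C.
Proof.
  intros c1 c2 m w. rewrite Csum_split, <- Csum_scal. f_equal.
  - apply Csum_ext. intros k Hk. destruct (lt_dec k m); [auto|lia].
  - apply Csum_ext. intros k Hk. destruct (lt_dec (m + k) m); [lia|].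
    replace (m + k - m)%nat with k by lia. rewrite Cpow_add_r. ring.
Qed.

Lemma parallelogram : forall a b : C,
  Cmod (a + b)%C ^ 2 + Cmod (a - b)%C ^ 2 = 2 * (Cmod a ^ 2 + Cmod b ^ 2).
Proof.
  intros [a1 a2] [b1 b2]. rewrite !Cmod2_alt. unfold Re, Im; simpl. ring.
Qed.

Lemma Cmod_pow_le_1 : forall w n, Cmod w <= 1 -> Cmod (w ^ n)%C <= 1.
Proof.
  intros w n H. rewrite Cmod_pow. rewrite <- (pow1 n). apply pow_incr.
  split; [apply Cmod_ge_0|auto].
Qed.

(** The parallelogram identity doubles the energy at each step, on the whole
    closed disc since [w ^ (2 ^ e)] only decreases the modulus there. *)
Lemma rudin_shapiro_energy : forall e w, Cmod w <= 1 ->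
  Cmod (Csum (fun l => RtoC (fst (rudin_shapiro e) l) * w ^ l)%C (2 ^ e)) ^ 2 +
  Cmod (Csum (fun l => RtoC (snd (rudin_shapiro e) l) * w ^ l)%C (2 ^ e)) ^ 2
    <= 2 * INR (2 ^ e).
Proof.
  induction e as [|e IH]; intros w Hw.
  - simpl. replace (0 + 1 * 1)%C with (RtoC 1) by ring. rewrite Cmod_1. lra.
  - specialize (IH w Hw).
    rewrite Nat.pow_succ_r'. replace (2 * 2 ^ e)%nat with (2 ^ e + 2 ^ e)%nat by lia.
    cbn [rudin_shapiro fst snd].
    rewrite rudin_shapiro_split.
    rewrite (rudin_shapiro_split _ (fun l => - snd (rudin_shapiro e) l)).
    rewrite (Csum_ext (fun l => RtoC (- snd (rudin_shapiro e) l) * w ^ l)%C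
       (fun l => (- (1)) * (RtoC (snd (rudin_shapiro e) l) * w ^ l))%C)
      by (intros; rewrite RtoC_opp; ring).
    rewrite Csum_scal.
    set (P := Csum (fun l => RtoC (fst (rudin_shapiro e) l) * w ^ l)%C (2 ^ e)) in *.
    set (Q := Csum (fun l => RtoC (snd (rudin_shapiro e) l) * w ^ l)%C (2 ^ e)) in *.
    replace (P + w ^ (2 ^ e) * (- (1) * Q))%C with (P - w ^ (2 ^ e) * Q)%C by ring.
    rewrite parallelogram, plus_INR.
    assert (HQ : Cmod (w ^ (2 ^ e) * Q)%C ^ 2 <= Cmod Q ^ 2).
    { apply pow_incr. split; [apply Cmod_ge_0|]. rewrite Cmod_mult.
      pose proof (Cmod_pow_le_1 w (2 ^ e) Hw). pose proof (Cmod_ge_0 Q). nra. }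
    lra.
Qed.

Lemma Rsum_shift_le : forall f n m k, (n + m <= k)%nat -> (forall i, 0 <= f i) ->
  Rsum (fun i => f (n + i)%nat) m <= Rsum f k.
Proof.
  intros f n m k H Hf. eapply Rle_trans; [|apply (Rsum_mono f (n + m) k H Hf)].
  rewrite Rsum_split. pose proof (Rsum_nonneg f n (fun i _ => Hf i)). lra.
Qed.

(** In the order [4 * 2 ^ e] the second and fourth quarters carry opposite
    signs, so exactly half of their coefficients are 1. *)
Lemma rudin_shapiro_kernel : forall p, Rbar_lt 1 p ->
  is_kernel p (/ 2) (fun e => fst (rudin_shapiro (S (S e)))) 3.
Proof.
  intros p Hp. split; [lra|]. intros e.
  assert (E4 : (2 ^ S (S e) = 4 * 2 ^ e)%nat) by (rewrite !Nat.pow_succ_r'; lia).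
  pose proof (pow2_pos e) as He0.
  split; [|split; [|split]].
  - intros l. destruct (le_lt_dec (2 ^ S (S e)) l) as [H|H].
    + rewrite (proj1 (rudin_shapiro_support _ _ H)), Rabs_R0. lra.
    + destruct (rudin_shapiro_sign _ _ H) as [[E|E] _]; rewrite E;
      [rewrite Rabs_R1|rewrite Rabs_left]; lra.
  - intros l Hl. apply rudin_shapiro_support. lia.
  - set (f := fun l => is_one (fst (rudin_shapiro (S (S e))) l)).
    replace (4 * 2 ^ e)%nat with ((2 ^ e + 2 ^ e) + (2 ^ e + 2 ^ e))%nat by lia.
    rewrite Rsum_split.
    assert (Hf : forall i, 0 <= f i) by (intros; apply is_one_ge_0).
    pose proof (Rsum_shift_le f (2 ^ e) (2 ^ e) (2 ^ e + 2 ^ e) ltac:(lia) Hf) as H1.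
    pose proof (Rsum_shift_le (fun k => f (2 ^ e + 2 ^ e + k)%nat) (2 ^ e) (2 ^ e) (2 ^ e + 2 ^ e) ltac:(lia)
       (fun i => Hf _)) as H2.
    cbv beta in H2.
    assert (H3 : INR (2 ^ e) <= Rsum (fun i => f (2 ^ e + i)%nat) (2 ^ e) +
       Rsum (fun i => f (2 ^ e + 2 ^ e + (2 ^ e + i))%nat) (2 ^ e)).
    { rewrite <- Rsum_plus. rewrite <- (Rmult_1_r (INR (2 ^ e))), <- Rsum_const.
      apply Rsum_le. intros i Hi. unfold f.
      replace (fst (rudin_shapiro (S (S e))) (2 ^ e + i)%nat) with (snd (rudin_shapiro e) i).
      2:{ cbn [rudin_shapiro fst snd]. rewrite Nat.pow_succ_r'.
          destruct (lt_dec (2 ^ e + i) (2 * 2 ^ e)); [|lia].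
          destruct (lt_dec (2 ^ e + i) (2 ^ e)); [lia|]. f_equal; lia. }
      replace (fst (rudin_shapiro (S (S e))) (2 ^ e + 2 ^ e + (2 ^ e + i))%nat) with (- snd (rudin_shapiro e) i).
      2:{ cbn [rudin_shapiro fst snd]. rewrite Nat.pow_succ_r'.
          destruct (lt_dec (2 ^ e + 2 ^ e + (2 ^ e + i)) (2 * 2 ^ e)); [lia|].
          destruct (lt_dec (2 ^ e + 2 ^ e + (2 ^ e + i) - 2 * 2 ^ e) (2 ^ e)); [lia|].
          do 2 f_equal; lia. }
      destruct (rudin_shapiro_sign e i Hi) as [_ [E|E]]; rewrite E; unfold is_one.
      - destruct (Req_EM_T 1 1); [|lra]. destruct (Req_EM_T (-(1)) 1); lra.
      - destruct (Req_EM_T (-1) 1); [lra|]. destruct (Req_EM_T (- -1) 1); lra. }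
    lra.
  - intros s r Hs Hr. pose proof (INR_pow2_pos e) as He.
    apply norm_bound_sup; auto.
    + apply Rmult_lt_0_compat; [lra|apply exp_pos].
    + apply ccont_gap_poly.
    + intros t.
      assert (Hw : Cmod (circle_point r t ^ s)%C <= 1).
      { apply Cmod_pow_le_1. rewrite Cmod_circle; lra. }
      pose proof (rudin_shapiro_energy (S (S e)) _ Hw) as H.
      rewrite E4 in H. unfold gap_poly.
      rewrite (Csum_ext _ (fun l => RtoC (fst (rudin_shapiro (S (S e))) l) * (circle_point r t ^ s) ^ l)%C)
        by (intros; rewrite Cpow_mult_r; auto).
      set (P := Csum _ _) in *.
      (* the constant 3 exceeds the square root of 8 *)
      assert (HP : Cmod P ^ 2 <= 8 * INR (2 ^ e)).
      { match type of H with ?x + ?y ^ 2 <= _ => pose proof (pow2_ge_0 y) end.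
        rewrite mult_INR in H. simpl (INR 4) in H. lra. }
      apply Rsqr_incr_0_var.
      * rewrite !Rsqr_pow2. rewrite Rpow_mult_distr.
        rewrite <- (Rpower_pow 2 (Rpower _ _)) by apply exp_pos.
        rewrite Rpower_mult. replace (/ 2 * INR 2) with 1 by (simpl; field).
        rewrite Rpower_1 by auto. lra.
      * apply Rmult_le_pos; [lra|left; apply exp_pos].
Qed.

(** * Trapezoidal kernels *)

(** The convolution of the indicators of [0, m) and [0, 2m), divided by [m], for
    [m = 2 ^ e]; its plateau at height 1 is [m - 1, 2m). *)
Definition trapezoid (e l : nat) : R :=
  / INR (2 ^ e) * Rsum (fun i => if le_dec i l then if lt_dec l (i + 2 * 2 ^ e) then 1 else 0 else 0) (2 ^ e).

Lemma trapezoid_factors : forall e s z,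
  gap_poly (trapezoid e) s (4 * 2 ^ e) z =
  (RtoC (/ INR (2 ^ e)) * (Csum (fun l => RtoC 1 * z ^ (s * l)) (2 ^ e) *
     Csum (fun l => RtoC 1 * z ^ (s * l)) (2 * 2 ^ e)))%C.
Proof.
  intros e s z. unfold gap_poly, trapezoid.
  rewrite (Csum_ext _ (fun l => RtoC (/ INR (2 ^ e)) * Csum (fun i =>
     z ^ (s * l) * RtoC (if le_dec i l then if lt_dec l (i + 2 * 2 ^ e) then 1 else 0 else 0)) (2 ^ e))%C).
  2:{ intros l _. rewrite RtoC_mult, RtoC_Rsum, Csum_scal. ring. }
  rewrite Csum_scal, Csum_swap. f_equal.
  rewrite Cmult_comm, <- Csum_scal. apply Csum_ext. intros i Hi.
  rewrite Cmult_comm, <- Csum_scal.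
  replace (4 * 2 ^ e)%nat with (i + (2 * 2 ^ e + (2 * 2 ^ e - i)))%nat by lia.
  rewrite Csum_split, Csum_zero.
  2:{ intros k Hk. destruct (le_dec i k); [lia|]. ring. }
  rewrite Csum_split, (Csum_zero _ (2 * 2 ^ e - i)).
  2:{ intros k Hk. destruct (le_dec i (i + (2 * 2 ^ e + k))); [|lia].
      destruct (lt_dec (i + (2 * 2 ^ e + k)) (i + 2 * 2 ^ e)); [lia|]. ring. }
  rewrite (Csum_ext _ (fun l => RtoC 1 * z ^ (s * i) * (RtoC 1 * z ^ (s * l)))%C (2 * 2 ^ e)).
  - ring.
  - intros k Hk. destruct (le_dec i (i + k)); [|lia].
    destruct (lt_dec (i + k) (i + 2 * 2 ^ e)); [|lia].
    rewrite Nat.mul_add_distr_l, Cpow_add_r. ring.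
Qed.

Lemma Cmod_geometric_le : forall s m z, Cmod z <= 1 ->
  Cmod (Csum (fun l => RtoC 1 * z ^ (s * l))%C m) <= INR m.
Proof.
  intros s m z Hz. eapply Rle_trans; [apply Cmod_Csum|].
  rewrite <- (Rmult_1_r (INR m)), <- Rsum_const. apply Rsum_le. intros k _.
  rewrite Cmod_mult, Cmod_1, Rmult_1_l. apply Cmod_pow_le_1; auto.
Qed.

Lemma geometric_energy : forall s m r, (0 < s)%nat -> 0 < r < 1 ->
  exists v, v <= 2 * PI * INR m /\
  is_RInt (fun t => Cmod (Csum (fun l => RtoC 1 * circle_point r t ^ (s * l))%C m) ^ 2) 0 (2 * PI) v.
Proof.
  intros s m r Hs Hr.
  exists (2 * PI * Rsum (fun l => Cmod (RtoC r ^ (s * l))%C ^ 2) m). split.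
  - apply Rmult_le_compat_l; [left; apply two_PI_pos|].
    rewrite <- (Rmult_1_r (INR m)), <- Rsum_const. apply Rsum_le. intros k _.
    rewrite <- (pow1 2). apply pow_incr. split; [apply Cmod_ge_0|].
    apply Cmod_pow_le_1. rewrite Cmod_R, Rabs_pos_eq; lra.
  - eapply is_RInt_ext; [|apply (parseval (fun l => RtoC r ^ (s * l))%C s m Hs)].
    intros t _. cbv beta. do 2 f_equal. apply Csum_ext. intros k _.
    rewrite circle_point_expi, Cpow_mult_l, expi_pow. ring.
Qed.

(** The kernel is the product of two geometric sums, so its mean of order 1 is
    bounded by Parseval's identity and its supremum is at most [2 * 2 ^ e];
    bounding [|K| ^ p] by [sup |K| ^ (p - 1) * |K|] gives the mean of order [p]. *)
Lemma trapezoid_kernel : forall p, 1 < p -> is_kernel (Finite p) ((p - 1) / p) trapezoid 3.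
Proof.
  intros p Hp. split; [lra|]. intros e.
  pose proof (pow2_pos e) as He0. pose proof (INR_pow2_pos e) as He.
  assert (Hi : 0 < / INR (2 ^ e)) by (apply Rinv_0_lt_compat; auto).
  split; [|split; [|split]].
  - intros l. unfold trapezoid.
    set (f := fun i => if le_dec i l then if lt_dec l (i + 2 * 2 ^ e) then 1 else 0 else 0).
    assert (Hf : forall i, 0 <= f i <= 1).
    { intros i. unfold f. destruct (le_dec i l); [destruct (lt_dec l (i + 2 * 2 ^ e))|]; lra. }
    pose proof (Rsum_nonneg f (2 ^ e) (fun i _ => proj1 (Hf i))) as H1.
    assert (H2 : Rsum f (2 ^ e) <= INR (2 ^ e)).
    { rewrite <- (Rmult_1_r (INR (2 ^ e))), <- Rsum_const. apply Rsum_le. intros i _. apply Hf. }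
    rewrite Rabs_pos_eq by (apply Rmult_le_pos; lra).
    apply Rmult_le_reg_l with (INR (2 ^ e)); auto. rewrite <- Rmult_assoc, Rinv_r by lra. lra.
  - intros l Hl. unfold trapezoid.
    rewrite (Rsum_ext _ (fun _ => 0)); [rewrite Rsum_const; ring|].
    intros i H. destruct (le_dec i l); auto. destruct (lt_dec l (i + 2 * 2 ^ e)); [lia|auto].
  - eapply Rle_trans; [|apply (Rsum_shift_le (fun l => is_one (trapezoid e l)) (2 ^ e) (2 ^ e) (4 * 2 ^ e));
      [lia|intros; apply is_one_ge_0]].
    rewrite <- (Rmult_1_r (INR (2 ^ e))) at 1. rewrite <- Rsum_const. apply Rsum_le. intros l Hl.
    unfold is_one. destruct (Req_EM_T (trapezoid e (2 ^ e + l)) 1) as [|Hn]; [lra|].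
    exfalso. apply Hn. unfold trapezoid. rewrite (Rsum_ext _ (fun _ => 1)).
    + rewrite Rsum_const. field. lra.
    + intros i H. destruct (le_dec i (2 ^ e + l)); [|lia].
      destruct (lt_dec (2 ^ e + l) (i + 2 * 2 ^ e)); [auto|lia].
  - intros s r Hs Hr. set (m := INR (2 ^ e)) in *.
    set (K := fun t => gap_poly (trapezoid e) s (4 * 2 ^ e) (circle_point r t)).
    assert (HK : ccont K) by apply ccont_gap_poly.
    split; [apply Rmult_lt_0_compat; [lra|apply exp_pos]|split; [exact HK|]].
    destruct (geometric_energy s (2 ^ e) r Hs Hr) as [v1 [Hv1 HI1]].
    destruct (geometric_energy s (2 * 2 ^ e) r Hs Hr) as [v2 [Hv2 HI2]].
    set (A := fun t => Csum (fun l => RtoC 1 * circle_point r t ^ (s * l))%C (2 ^ e)) in *.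
    set (B := fun t => Csum (fun l => RtoC 1 * circle_point r t ^ (s * l))%C (2 * 2 ^ e)) in *.
    assert (H2m : INR (2 * 2 ^ e) = 2 * m) by (rewrite mult_INR; reflexivity).
    rewrite H2m in Hv2. fold m in Hv1.
    assert (EK : forall t, Cmod (K t) = / m * (Cmod (A t) * Cmod (B t))).
    { intros t. unfold K. rewrite trapezoid_factors; fold m; rewrite !Cmod_mult, Cmod_R, Rabs_pos_eq by lra.
      reflexivity. }
    assert (Hz : forall t, Cmod (circle_point r t) <= 1) by (intros; rewrite Cmod_circle; lra).
    assert (HA : forall t, 0 <= Cmod (A t) <= m).
    { intros t. split; [apply Cmod_ge_0|]. apply Cmod_geometric_le; auto. }
    assert (HB : forall t, 0 <= Cmod (B t) <= 2 * m).
    { intros t. split; [apply Cmod_ge_0|]. rewrite <- H2m. apply Cmod_geometric_le; auto. }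
    set (Q := Rpower (2 * m) (p - 1)).
    assert (HQ : 0 < Q) by apply exp_pos.
    assert (HI : is_RInt (fun t => scal (Q * (/ m / 2)) (plus (Cmod (A t) ^ 2) (Cmod (B t) ^ 2))) 0 (2 * PI)
       (scal (Q * (/ m / 2)) (plus v1 v2))).
    { apply (@is_RInt_scal R_NormedModule), (@is_RInt_plus R_NormedModule); auto. }
    apply Rle_trans with (scal (Q * (/ m / 2)) (plus v1 v2)).
    + rewrite <- (is_RInt_unique _ _ _ _ HI). pose proof two_PI_pos.
      apply RInt_le; [lra|apply ccont_integrand; [exact HK|lra]|eexists; exact HI|].
      intros t _. unfold scal, plus; simpl; unfold mult; simpl. fold (K t).
      specialize (HA t). specialize (HB t). specialize (EK t).
      set (x := Cmod (A t)) in *. set (y := Cmod (B t)) in *.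
      assert (Hk1 : Cmod (K t) <= 2 * m).
      { rewrite EK. apply Rmult_le_reg_l with m; auto. rewrite <- Rmult_assoc, Rinv_r by lra. nra. }
      assert (Hk2 : Cmod (K t) <= / m / 2 * (x ^ 2 + y ^ 2)).
      { rewrite EK. unfold Rdiv. rewrite Rmult_assoc. apply Rmult_le_compat_l; [lra|].
        pose proof (pow2_ge_0 (x - y)). nra. }
      apply Rle_trans with (Q * Cmod (K t)).
      * destruct (Rlt_le_dec 0 (Cmod (K t))) as [H0|H0].
        -- rewrite pow_nonneg_pos by auto. replace p with ((p - 1) + 1) at 1 by ring.
           rewrite Rpower_plus, Rpower_1 by auto. apply Rmult_le_compat_r; [lra|].
           unfold Q. apply Rle_Rpower_l; lra.
        -- rewrite pow_nonneg_0 by auto. apply Rmult_le_pos; [lra|apply Cmod_ge_0].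
      * rewrite Rmult_assoc. apply Rmult_le_compat_l; [lra|].
        replace (x * (x * 1) + y * (y * 1)) with (x ^ 2 + y ^ 2) by (simpl; ring). exact Hk2.
    + unfold scal, plus; simpl; unfold mult; simpl. pose proof two_PI_pos as HPI.
      apply Rle_trans with (Q * (/ m / 2) * (2 * PI * (3 * m))).
      * apply Rmult_le_compat_l; [apply Rmult_le_pos; lra|]. lra.
      * replace (Q * (/ m / 2) * (2 * PI * (3 * m))) with (2 * PI * (3 / 2 * Q)) by (field; lra).
        apply Rmult_le_compat_l; [lra|].
        rewrite <- Rpower_mult_distr by (try lra; apply exp_pos).
        rewrite Rpower_mult. replace ((p - 1) / p * p) with (p - 1) by (field; lra).
        unfold Q. rewrite <- Rpower_mult_distr by lra.
        rewrite <- Rmult_assoc. apply Rmult_le_compat_r; [left; apply exp_pos|].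
        replace p with ((p - 1) + 1) at 2 by ring. rewrite Rpower_plus, Rpower_1 by lra.
        assert (Rpower 2 (p - 1) <= Rpower 3 (p - 1)) by (apply Rle_Rpower_l; lra).
        assert (0 < Rpower 2 (p - 1)) by apply exp_pos. lra.
Qed.

Lemma kernel_exists : forall p q, Rbar_lt 1 p -> conjugate p q ->
  exists c A, is_kernel p (/ Rmax 2 q) c A.
Proof.
  intros p q Hp Hq. destruct (Rle_lt_dec q 2) as [H|H].
  - rewrite Rmax_left by auto. exists (fun e => fst (rudin_shapiro (S (S e)))), 3.
    apply rudin_shapiro_kernel; auto.
  - rewrite Rmax_right by lra. destruct p as [p| |]; [| |destruct Hp].
    + simpl in Hp, Hq. exists trapezoid, 3.
      replace (/ q) with ((p - 1) / p).
      * apply trapezoid_kernel; auto.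
      * replace (/ q) with (1 - / p) by lra. field. lra.
    + simpl in Hq. lra.
Qed.

(** * Lacunary sums *)

Lemma pow_le_exp : forall r n, 0 < r < 1 -> r ^ n <= exp (- ((1 - r) * INR n)).
Proof.
  intros r n Hr.
  replace (- ((1 - r) * INR n)) with (INR n * (r - 1)) by ring.
  rewrite <- (exp_ln (r ^ n)) by (apply pow_lt; lra).
  rewrite ln_pow by lra. apply exp_le_compat. apply Rmult_le_compat_l; [apply pos_INR|].
  apply ln_le_pred; lra.
Qed.

Lemma telescope_step : forall Q Y Y', 1 < Q -> 0 < Y -> Q * Y <= Y' ->
  (Q - 1) / Q * (Y / (1 + Y) ^ 2) <= / (1 + Y) - / (1 + Y').
Proof.
  intros Q Y Y' HQ HY HY'.
  apply Rle_trans with (/ (1 + Y) - / (1 + Q * Y)).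
  - replace (/ (1 + Y) - / (1 + Q * Y)) with ((Q - 1) * Y * / (1 + Y) * / (1 + Q * Y))
      by (field; split; nra).
    replace ((Q - 1) / Q * (Y / (1 + Y) ^ 2)) with ((Q - 1) * Y * / (1 + Y) * / (Q * (1 + Y)))
      by (field; split; nra).
    apply Rmult_le_compat_l.
    + apply Rmult_le_pos; [nra|left; apply Rinv_0_lt_compat; lra].
    + apply Rinv_le_contravar; nra.
  - assert (/ (1 + Y') <= / (1 + Q * Y)); [|lra].
    apply Rinv_le_contravar; nra.
Qed.

(** With [x = (1 - r) * N i] and [Y = x ^ tau], the exponential decay of [r ^ N i]
    makes each term a bounded multiple of [Y / (1 + Y) ^ 2], and lacunarity makes
    the latter telescope against [Y / (1 + Y)]. *)
Lemma lacunary_sum_le : forall tau, 0 < tau -> exists B, 0 < B /\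
  forall (N : nat -> nat) r n, 0 < r < 1 -> (forall i, (1 <= N i)%nat) ->
    (forall i, (4 * N i <= N (S i))%nat) ->
    Rsum (fun i => Rpower (INR (N i)) tau * r ^ N i) n <= B * Rpower (1 - r) (- tau).
Proof.
  intros tau Ht.
  destruct (Rpower_le_exp (2 * tau) 1 ltac:(lra) Rlt_0_1) as [B [HB0 HB]].
  set (Q := Rpower 4 tau).
  assert (HQ : 1 < Q).
  { unfold Q. rewrite <- (Rpower_O 4) by lra. apply Rpower_lt; lra. }
  assert (Hc : 0 < (Q - 1) / Q) by (apply Rdiv_lt_0_compat; lra).
  exists ((2 + 2 * B) / ((Q - 1) / Q)). split; [apply Rdiv_lt_0_compat; lra|].
  intros N r n Hr HN1 HN4. set (y := 1 - r).
  assert (Hy : 0 < y) by (unfold y; lra).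
  assert (HNp : forall i, 0 < INR (N i)) by (intros; apply lt_0_INR; specialize (HN1 i); lia).
  set (Y := fun i => Rpower (y * INR (N i)) tau).
  assert (HY : forall i, 0 < Y i) by (intros; apply exp_pos).
  assert (HYY : forall i, Q * Y i <= Y (S i)).
  { intros i. unfold Q, Y. specialize (HNp i).
    rewrite Rpower_mult_distr by nra. apply Rle_Rpower_l; [lra|].
    specialize (HN4 i). apply le_INR in HN4. rewrite mult_INR in HN4. simpl (INR 4) in HN4. nra. }
  assert (Hterm : forall i, Rpower (INR (N i)) tau * r ^ N i <=
     Rpower y (- tau) * ((2 + 2 * B) * (Y i / (1 + Y i) ^ 2))).
  { intros i. specialize (HNp i). specialize (HY i).
    assert (Hxp : 0 < y * INR (N i)) by (apply Rmult_lt_0_compat; auto).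
    assert (E : Rpower (INR (N i)) tau = Rpower y (- tau) * Y i).
    { unfold Y. rewrite <- Rpower_mult_distr, <- Rmult_assoc, <- Rpower_plus by auto.
      replace (- tau + tau) with 0 by ring. rewrite Rpower_O by auto. ring. }
    rewrite E, Rmult_assoc. apply Rmult_le_compat_l; [left; apply exp_pos|].
    apply Rle_trans with (Y i * exp (- (y * INR (N i)))).
    - apply Rmult_le_compat_l; [lra|apply pow_le_exp; auto].
    - replace ((2 + 2 * B) * (Y i / (1 + Y i) ^ 2)) with (Y i * ((2 + 2 * B) / (1 + Y i) ^ 2))
        by (field; lra).
      apply Rmult_le_compat_l; [lra|].
      assert (H2 : 0 < (1 + Y i) ^ 2) by (apply pow_lt; lra).
      apply (proj1 (Rle_div_r _ _ _ H2)).
      assert (H1 : Y i ^ 2 <= B * exp (y * INR (N i))).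
      { specialize (HB _ Hxp). rewrite Rmult_1_l in HB. replace (Y i ^ 2) with (Rpower (y * INR (N i)) (2 * tau)); auto.
        unfold Y. rewrite <- (Rpower_pow 2) by apply exp_pos. rewrite Rpower_mult. f_equal. simpl; ring. }
      assert (HE : exp (- (y * INR (N i))) * exp (y * INR (N i)) = 1).
      { rewrite <- exp_plus. replace (- (y * INR (N i)) + y * INR (N i)) with 0 by ring. apply exp_0. }
      assert (He1 : exp (- (y * INR (N i))) <= 1).
      { rewrite <- exp_0. apply exp_le_compat. lra. }
      assert (He0 : 0 < exp (- (y * INR (N i)))) by apply exp_pos.
      apply Rle_trans with (exp (- (y * INR (N i))) * (2 + 2 * (B * exp (y * INR (N i))))).
      + apply Rmult_le_compat_l; [lra|]. pose proof (pow2_ge_0 (Y i - 1)). nra.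
      + replace (exp (- (y * INR (N i))) * (2 + 2 * (B * exp (y * INR (N i))))) with
          (2 * exp (- (y * INR (N i))) + 2 * B * (exp (- (y * INR (N i))) * exp (y * INR (N i)))) by ring.
        rewrite HE. lra. }
  assert (Htel : forall m, (Q - 1) / Q * Rsum (fun i => Y i / (1 + Y i) ^ 2) m <= / (1 + Y O) - / (1 + Y m)).
  { induction m as [|m IH]; [simpl; lra|].
    cbn [Rsum]. rewrite Rmult_plus_distr_l.
    pose proof (telescope_step Q (Y m) (Y (S m)) HQ (HY m) (HYY m)) as HT. lra. }
  specialize (Htel n).
  assert (H0 : 0 < / (1 + Y n)) by (apply Rinv_0_lt_compat; specialize (HY n); lra).
  assert (H1 : / (1 + Y O) <= 1).
  { rewrite <- Rinv_1. apply Rinv_le_contravar; specialize (HY O); lra. }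
  eapply Rle_trans; [apply Rsum_le; intros i _; apply Hterm|].
  rewrite Rsum_scal, Rsum_scal.
  rewrite (Rmult_comm (_ / _)). apply Rmult_le_compat_l; [left; apply exp_pos|].
  unfold Rdiv at 2. apply Rmult_le_compat_l; [lra|].
  rewrite <- (Rmult_1_l (/ _)). apply (proj1 (Rle_div_r _ _ _ Hc)). lra.
Qed.

Lemma lacunary_sum_bounded : forall tau, tau < 0 -> exists B, 0 < B /\
  forall (N : nat -> nat) r n, 0 < r < 1 -> (forall i, (1 <= N i)%nat) ->
    (forall i, (4 * N i <= N (S i))%nat) ->
    Rsum (fun i => Rpower (INR (N i)) tau * r ^ N i) n <= B.
Proof.
  intros tau Ht. set (q := Rpower 4 tau).
  assert (Hq : 0 < q < 1).
  { split; [apply exp_pos|]. unfold q. rewrite <- (Rpower_O 4) by lra. apply Rpower_lt; lra. }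
  exists (/ (1 - q)). split; [apply Rinv_0_lt_compat; lra|].
  intros N r n Hr HN1 HN4.
  eapply Rle_trans; [|apply (Rsum_geom_le q n); lra].
  apply Rsum_le. intros i _.
  assert (H4 : forall i, 4 ^ i <= INR (N i)).
  { clear i. induction i as [|i IH].
    - simpl. apply (le_INR 1), HN1.
    - specialize (HN4 i). apply le_INR in HN4. rewrite mult_INR in HN4. simpl (INR 4) in HN4. simpl pow. lra. }
  assert (Hp : 0 < 4 ^ i) by (apply pow_lt; lra).
  apply Rle_trans with (Rpower (INR (N i)) tau * 1).
  - apply Rmult_le_compat_l; [left; apply exp_pos|]. rewrite <- (pow1 (N i)). apply pow_incr; lra.
  - rewrite Rmult_1_r.
    replace (q ^ i) with (Rpower (4 ^ i) tau).
    + replace tau with (- (- tau)) by ring. rewrite !(Rpower_Ropp _ (- tau)).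
      apply Rinv_le_contravar; [apply exp_pos|]. apply Rle_Rpower_l; [lra|]. split; auto.
    + unfold q. rewrite <- (Rpower_pow i 4) by lra. rewrite <- (Rpower_pow i (Rpower 4 tau)) by apply exp_pos.
      rewrite !Rpower_mult. f_equal. ring.
Qed.

(** * The weights of the density *)

Lemma exp_neg_le : forall x, 0 <= x <= 1 -> exp (- x) <= 1 - x / 2.
Proof.
  intros x Hx. rewrite exp_Ropp.
  apply Rle_trans with (/ (1 + x)).
  - apply Rinv_le_contravar; [lra|apply exp_ineq1_le].
  - apply Rmult_le_reg_l with (1 + x); [lra|]. rewrite Rinv_r by lra. nra.
Qed.

Lemma Rpower_1_l : forall a, Rpower 1 a = 1.
Proof. intros a. unfold Rpower. rewrite ln_1, Rmult_0_r. apply exp_0. Qed.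

(** Up to a constant the weight of [1, n] is carried by the last
    [n ^ (1 - gamma)] integers, because [(n + 1) ^ gamma - n ^ gamma] is at least
    [gamma / (n + 1) ^ (1 - gamma)]. *)
Lemma beta_sum_le : forall gamma n, 0 < gamma < 1 -> (1 <= n)%nat ->
  sum_n_m (beta gamma) 1 n <= 2 / gamma * Rpower (INR n) (1 - gamma) * beta gamma n.
Proof.
  intros gamma n Hg Hn. induction n as [|n IH]; [lia|].
  destruct (Nat.eq_dec n 0) as [E|E].
  - subst n. rewrite sum_n_n. simpl INR. rewrite Rpower_1_l, Rmult_1_r.
    assert (0 < beta gamma 1) by apply exp_pos.
    assert (1 <= 2 / gamma) by (apply (Rle_div_r 1 2 gamma); lra). nra.
  - specialize (IH ltac:(lia)). rewrite sum_n_Sm by lia.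
    change (sum_n_m (beta gamma) 1 n + beta gamma (S n) <=
      2 / gamma * Rpower (INR (S n)) (1 - gamma) * beta gamma (S n)).
    set (x := INR (S n)). set (L := Rpower x (1 - gamma)).
    assert (Hn1 : 1 <= INR n) by (apply (le_INR 1); lia).
    assert (Hx : x = INR n + 1) by apply S_INR.
    assert (HL : 1 <= L).
    { unfold L. rewrite <- (Rpower_O x) at 1 by lra. apply Rle_Rpower; lra. }
    assert (HLn : Rpower (INR n) (1 - gamma) <= L).
    { unfold L. apply Rle_Rpower_l; lra. }
    assert (Hbp : 0 < beta gamma (S n)) by apply exp_pos.
    assert (HLx : L * Rpower x gamma = x).
    { unfold L. rewrite <- Rpower_plus. replace (1 - gamma + gamma) with 1 by ring.
      apply Rpower_1. lra. }
    assert (Hpow : Rpower (INR n) gamma <= Rpower x gamma - gamma / L).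
    { replace (INR n) with (x * (INR n / x)) by (field; lra).
      assert (Hq : 0 < INR n / x) by (apply Rdiv_lt_0_compat; lra).
      rewrite <- Rpower_mult_distr by lra.
      pose proof (Rpower_le_tangent (INR n / x) gamma Hq Hg) as HT.
      assert (HP : 0 < Rpower x gamma) by apply exp_pos.
      apply Rmult_le_compat_l with (r := Rpower x gamma) in HT; [|lra].
      eapply Rle_trans; [exact HT|]. right.
      assert (Hp : Rpower x gamma = x / L).
      { apply (Rmult_eq_reg_l L); [|lra]. rewrite HLx. field. lra. }
      rewrite Hp. replace (INR n) with (x - 1) by lra. field. lra. }
    assert (Hb : beta gamma n <= beta gamma (S n) * (1 - gamma / L / 2)).
    { unfold beta. apply Rle_trans with (exp (Rpower x gamma + - (gamma / L))).
      - apply exp_le_compat. lra.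
      - rewrite exp_plus. apply Rmult_le_compat_l; [left; apply exp_pos|].
        apply exp_neg_le. split; [apply Rdiv_le_0_compat; lra|apply Rle_div_l; lra]. }
    assert (Hbn : 0 < beta gamma n) by apply exp_pos.
    assert (Hg2 : 0 < 2 / gamma) by (apply Rdiv_lt_0_compat; lra).
    apply Rle_trans with (2 / gamma * L * (beta gamma (S n) * (1 - gamma / L / 2)) + beta gamma (S n)).
    + apply Rplus_le_compat_r. eapply Rle_trans; [exact IH|].
      apply Rmult_le_compat; try lra.
      * apply Rmult_le_pos; [lra|left; apply exp_pos].
      * apply Rmult_le_compat_l; lra.
    + right. field. lra.
Qed.

Lemma beta_window : forall gamma N W, 0 < gamma < 1 -> (1 <= N)%nat ->
  INR W <= Rpower (INR N) (1 - gamma) ->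
  beta gamma (N + W) <= exp gamma * beta gamma N.
Proof.
  intros gamma N W Hg HN HW. unfold beta. rewrite <- exp_plus. apply exp_le_compat.
  assert (HN1 : 1 <= INR N) by (apply (le_INR 1); auto).
  pose proof (pos_INR W) as HW0.
  rewrite plus_INR. replace (INR N + INR W) with (INR N * (1 + INR W / INR N)) by (field; lra).
  assert (Hq : 0 <= INR W / INR N) by (apply Rdiv_le_0_compat; lra).
  rewrite <- Rpower_mult_distr by lra.
  pose proof (Rpower_le_tangent (1 + INR W / INR N) gamma ltac:(lra) Hg) as HT.
  assert (HP : 0 < Rpower (INR N) gamma) by apply exp_pos.
  apply Rmult_le_compat_l with (r := Rpower (INR N) gamma) in HT; [|lra].
  eapply Rle_trans; [exact HT|].
  assert (HE : Rpower (INR N) (1 - gamma) * Rpower (INR N) gamma = INR N).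
  { rewrite <- Rpower_plus. replace (1 - gamma + gamma) with 1 by ring. apply Rpower_1. lra. }
  assert (HF : Rpower (INR N) gamma * (INR W / INR N) <= 1).
  { apply Rmult_le_reg_l with (INR N); [lra|].
    replace (INR N * (Rpower (INR N) gamma * (INR W / INR N))) with (INR W * Rpower (INR N) gamma) by (field; lra).
    rewrite Rmult_1_r. rewrite <- HE at 2. apply Rmult_le_compat_r; lra. }
  replace (1 + INR W / INR N - 1) with (INR W / INR N) by ring. nra.
Qed.

Lemma LimSup_pos : forall u c, 0 < c ->
  (forall n0, exists n, (n0 <= n)%nat /\ c <= u n) -> Rbar_lt 0 (LimSup_seq u).
Proof.
  intros u c Hc H. unfold LimSup_seq. destruct (ex_LimSup_seq u) as [l Hl]; simpl.
  destruct l as [l| |]; simpl in *; auto.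
  - apply Rnot_le_lt. intros Hle.
    destruct (Hl (mkposreal c Hc)) as [_ [n0 Hn0]]. simpl in Hn0.
    destruct (H n0) as [n [Hn Hu]]. specialize (Hn0 n Hn). lra.
  - destruct (Hl 0) as [n0 Hn0]. destruct (H n0) as [n [Hn Hu]]. specialize (Hn0 n Hn). lra.
Qed.

(** The kernels have orders that are powers of 2, so the windows are placed where
    their natural length [N ^ (1 - gamma)] is nearly one. *)
Lemma window_position : forall gamma E, 0 < gamma < 1 -> exists N, (2 ^ E <= N)%nat /\
  INR (2 ^ E) <= Rpower (INR N) (1 - gamma) <= 2 * INR (2 ^ E).
Proof.
  intros gamma E Hg.
  set (m := INR (2 ^ E)).
  assert (Hm : 1 <= m).
  { apply (le_INR 1). pose proof (Nat.pow_nonzero 2 E). lia. }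
  set (x := Rpower m (/ (1 - gamma))).
  assert (Hig : 1 <= / (1 - gamma)).
  { rewrite <- Rinv_1. apply Rinv_le_contravar; lra. }
  assert (Hxm : m <= x).
  { unfold x. rewrite <- (Rpower_1 m) at 1 by lra. apply Rle_Rpower; lra. }
  destruct (nfloor_ex x ltac:(lra)) as [n [Hn1 Hn2]].
  exists (S n).
  assert (HN : x <= INR (S n) <= 2 * x) by (rewrite S_INR; lra).
  assert (Ex : Rpower x (1 - gamma) = m).
  { unfold x. rewrite Rpower_mult, Rinv_l, Rpower_1; lra. }
  split; [apply INR_le; fold m; lra|]. split.
  - rewrite <- Ex. apply Rle_Rpower_l; lra.
  - apply Rle_trans with (Rpower (2 * x) (1 - gamma)); [apply Rle_Rpower_l; lra|].
    rewrite <- Rpower_mult_distr, Ex by lra. apply Rmult_le_compat_r; [lra|].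
    rewrite <- (Rpower_1 2) at 2 by lra. apply Rle_Rpower; lra.
Qed.

(** * A countable dense family of polynomials *)

Definition code_rat (x : nat) : R :=
  let (a, y) := of_nat x in let (b, D) := of_nat y in (INR a - INR b) / INR (S D).

Definition code_complex (x : nat) : C :=
  let (a, b) := of_nat x in (code_rat a, code_rat b).

Fixpoint digit (k c : nat) : nat :=
  match k with O => fst (of_nat c) | S k => digit k (snd (of_nat c)) end.

(** A pattern is a pair of a length and a code of its list of coefficients,
    together with a third component that repeats each pattern at arbitrarily large
    indices. *)
Definition pattern_length (j : nat) : nat := fst (of_nat (fst (of_nat j))).

Definition pattern (j k : nat) : C :=
  if lt_dec k (pattern_length j) then code_complex (digit k (snd (of_nat (fst (of_nat j))))) else RtoC 0.

Lemma code_rat_dense : forall y eps, 0 < eps -> exists x, Rabs (code_rat x - y) < eps.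
Proof.
  assert (Hpos : forall y eps, 0 <= y -> 0 < eps -> exists a D, Rabs (INR a / INR (S D) - y) < eps).
  { intros y eps Hy He. destruct (archimed_cor1 eps He) as [D [HD HD0]].
    destruct D as [|D]; [lia|].
    assert (HS : 0 < INR (S D)) by (apply lt_0_INR; lia).
    destruct (nfloor_ex (y * INR (S D))) as [a [Ha1 Ha2]]; [apply Rmult_le_pos; lra|].
    exists a, D. apply Rle_lt_trans with (/ INR (S D)); [|auto].
    replace (INR a / INR (S D) - y) with ((INR a - y * INR (S D)) * / INR (S D)) by (field; lra).
    assert (Hi : 0 < / INR (S D)) by (apply Rinv_0_lt_compat; auto).
    rewrite Rabs_mult, (Rabs_pos_eq (/ _)) by lra. rewrite <- (Rmult_1_l (/ _)) at 2.
    apply Rmult_le_compat_r; [lra|]. apply Rabs_le. lra. }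
  intros y eps He. destruct (Rle_lt_dec 0 y) as [H|H].
  - destruct (Hpos y eps H He) as [a [D Ha]].
    exists (to_nat (a, to_nat (O, D))). unfold code_rat. rewrite !cancel_of_to.
    simpl (INR 0). rewrite Rminus_0_r. auto.
  - destruct (Hpos (- y) eps ltac:(lra) He) as [a [D Ha]].
    exists (to_nat (O, to_nat (a, D))). unfold code_rat. rewrite !cancel_of_to.
    simpl (INR 0). rewrite <- Rabs_Ropp.
    replace (- ((0 - INR a) / INR (S D) - y)) with (INR a / INR (S D) - - y); auto.
    field. apply Rgt_not_eq, lt_0_INR. lia.
Qed.

Lemma code_complex_dense : forall z eps, 0 < eps -> exists x, Cmod (code_complex x - z)%C < eps.
Proof.
  intros [z1 z2] eps He.
  destruct (code_rat_dense z1 (eps / 2)) as [a Ha]; [lra|].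
  destruct (code_rat_dense z2 (eps / 2)) as [b Hb]; [lra|].
  exists (to_nat (a, b)). unfold code_complex. rewrite cancel_of_to.
  replace ((code_rat a, code_rat b) - (z1, z2))%C with
    (RtoC (code_rat a - z1) + Ci * RtoC (code_rat b - z2))%C.
  - eapply Rle_lt_trans; [apply Cmod_triangle|].
    rewrite Cmod_mult, Cmod_Ci, !Cmod_R. lra.
  - unfold Ci, RtoC, Cplus, Cminus, Cmult, Copp; simpl. apply injective_projections; simpl; ring.
Qed.

Lemma digit_surjective : forall n (x : nat -> nat), exists c, forall k, (k < n)%nat -> digit k c = x k.
Proof.
  induction n as [|n IH]; intros x.
  - exists O. intros; lia.
  - destruct (IH (fun k => x (S k))) as [c Hc].
    exists (to_nat (x O, c)). intros [|k] Hk; cbn [digit]; rewrite cancel_of_to; cbn [fst snd]; auto.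
    apply Hc. lia.
Qed.

Lemma choice_fun : forall (A B : Type) (P : A -> B -> Prop),
  (forall x, exists y, P x y) -> exists f, forall x, P x (f x).
Proof.
  intros A B P H.
  exists (fun x => proj1_sig (constructive_indefinite_description _ (H x))).
  intros x. apply proj2_sig.
Qed.

Lemma pattern_dense : forall (v : nat -> C) n eps j0, 0 < eps ->
  exists j, (j0 <= j)%nat /\ pattern_length j = n /\
    forall k, (k < n)%nat -> Cmod (pattern j k - v k)%C < eps.
Proof.
  intros v n eps j0 He.
  destruct (choice_fun _ _ _ (fun k => code_complex_dense (v k) eps He)) as [x Hx].
  destruct (digit_surjective n x) as [c Hc].
  exists (to_nat (to_nat (n, c), j0)).
  assert (HL : pattern_length (to_nat (to_nat (n, c), j0)) = n).
  { unfold pattern_length. rewrite cancel_of_to. cbn [fst snd]. rewrite cancel_of_to. auto. }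
  split; [|split; [exact HL|]].
  - pose proof (to_nat_non_decreasing (to_nat (n, c)) j0). lia.
  - intros k Hk. unfold pattern. rewrite HL. destruct (lt_dec k n); [|lia].
    rewrite cancel_of_to. cbn [fst snd]. rewrite cancel_of_to. cbn [fst snd]. rewrite Hc by auto. apply Hx.
Qed.

(** * Functions assembled from blocks *)

Lemma Csum_mult_length : forall f s L,
  Csum f (s * L) = Csum (fun l => Csum (fun k => f (s * l + k)%nat) s) L.
Proof.
  intros f s L. induction L as [|L IH].
  - rewrite Nat.mul_0_r. auto.
  - rewrite Nat.mul_succ_r, Csum_split, IH. auto.
Qed.

Lemma nu_ratio_le : forall alpha N x, (1 <= N)%nat -> (N <= x <= 2 * N)%nat ->
  nu alpha x / nu alpha N <= Rpower 2 (Rabs alpha).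
Proof.
  intros alpha N x HN Hx. unfold nu.
  assert (H1 : 0 < INR (S N)) by (apply lt_0_INR; lia).
  assert (H2 : INR (S N) <= INR (S x)) by (apply le_INR; lia).
  assert (H3 : INR (S x) <= 2 * INR (S N)).
  { replace 2 with (INR 2) by (simpl; ring). rewrite <- mult_INR. apply le_INR. lia. }
  replace (INR (S x)) with (INR (S N) * (INR (S x) / INR (S N))) by (field; lra).
  assert (Hq1 : 1 <= INR (S x) / INR (S N)) by (apply (Rle_div_r 1); lra).
  assert (Hq2 : INR (S x) / INR (S N) <= 2) by (apply Rle_div_l; lra).
  rewrite <- Rpower_mult_distr by lra.
  replace (Rpower (INR (S N)) alpha * Rpower (INR (S x) / INR (S N)) alpha / Rpower (INR (S N)) alpha)
    with (Rpower (INR (S x) / INR (S N)) alpha) by (field; apply Rgt_not_eq, exp_pos).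
  apply Rle_trans with (Rpower (INR (S x) / INR (S N)) (Rabs alpha)).
  - apply Rle_Rpower; [auto|apply Rle_abs].
  - apply Rle_Rpower_l; [apply Rabs_pos|lra].
Qed.

Section Blocks.

(** Block [i] is the polynomial
    [nu (N i) ^ -1 * z ^ N i * (sum of u i k * z ^ k) * (sum of ker i l * z ^ (s i * l))]:
    copies of one pattern, weighted by a kernel, spaced by [s i] and starting at
    [N i]. *)
Variable alpha : R.
Variable u : nat -> nat -> C.
Variable ker : nat -> nat -> R.
Variables s len N : nat -> nat.
Hypothesis s_pos : forall i, (1 <= s i)%nat.
Hypothesis u_support : forall i k, (s i <= k)%nat -> u i k = RtoC 0.
Hypothesis u_size : forall i, Rsum (fun k => Cmod (u i k)) (s i) <= INR (s i).
Hypothesis ker_le_1 : forall i l, Rabs (ker i l) <= 1.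
Hypothesis ker_support : forall i l, (len i <= l)%nat -> ker i l = 0.
Hypothesis s_le_N : forall i, (4 * s i <= N i)%nat.
Hypothesis width_le_N : forall i, (s i * len i <= N i)%nat.
Hypothesis N_lacunary : forall i, (4 * N i <= N (S i))%nat.

Definition block_coef (i x : nat) : C :=
  if lt_dec x (N i) then RtoC 0 else
  (RtoC (/ nu alpha (N i)) * u i ((x - N i) mod s i) * RtoC (ker i ((x - N i) / s i)))%C.

Definition total_coef (x : nat) : C := Csum (fun i => block_coef i x) (S x).

Lemma N_pos : forall i, (1 <= N i)%nat.
Proof. intros i. specialize (s_le_N i). specialize (s_pos i). lia. Qed.

Lemma N_mono : forall i j, (i < j)%nat -> (4 * N i <= N j)%nat.
Proof.
  intros i j Hij. induction j as [|j IH]; [lia|].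
  pose proof (N_lacunary j). destruct (Nat.eq_dec i j); [subst; auto|].
  specialize (IH ltac:(lia)). lia.
Qed.

Lemma N_gt : forall i, (i < N i)%nat.
Proof.
  induction i as [|i IH]; [apply N_pos|]. pose proof (N_lacunary i). lia.
Qed.

Lemma block_coef_outside : forall i x, (x < N i \/ N i + s i * len i <= x)%nat ->
  block_coef i x = RtoC 0.
Proof.
  intros i x H. unfold block_coef. destruct (lt_dec x (N i)) as [|Hx]; auto.
  rewrite ker_support; [ring|].
  pose proof (s_pos i). apply Nat.div_le_lower_bound; lia.
Qed.

Lemma block_coef_at : forall i l k, (k < s i)%nat ->
  block_coef i (N i + (s i * l + k)) = (RtoC (/ nu alpha (N i)) * u i k * RtoC (ker i l))%C.
Proof.
  intros i l k Hk. unfold block_coef.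
  destruct (lt_dec (N i + (s i * l + k)) (N i)); [lia|].
  replace (N i + (s i * l + k) - N i)%nat with (s i * l + k)%nat by lia.
  rewrite <- (Nat.div_unique (s i * l + k) (s i) l k) by lia.
  rewrite <- (Nat.mod_unique (s i * l + k) (s i) l k) by lia. auto.
Qed.

Lemma total_coef_eq_block : forall i x, (N i <= x < N (S i))%nat ->
  total_coef x = block_coef i x.
Proof.
  intros i x Hx. unfold total_coef. apply (Csum_single (fun i => block_coef i x)).
  - pose proof (N_gt i). lia.
  - intros j _ Hj. apply block_coef_outside.
    destruct (Nat.lt_trichotomy j i) as [H|[H|H]]; [|lia|].
    + right. pose proof (N_mono j i H). pose proof (width_le_N j). lia.
    + left. destruct (Nat.eq_dec j (S i)); [subst; lia|].
      pose proof (N_mono (S i) j ltac:(lia)). pose proof (N_pos (S i)). lia.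
Qed.

Lemma total_coef_before : forall x, (x < N 0)%nat -> total_coef x = RtoC 0.
Proof.
  intros x Hx. apply Csum_zero. intros i _. apply block_coef_outside. left.
  destruct i as [|i]; auto. pose proof (N_mono 0 (S i) ltac:(lia)). lia.
Qed.

Lemma total_coef_cases : forall x, total_coef x = RtoC 0 \/
  exists i, (N i <= x < N i + s i * len i)%nat /\ total_coef x = block_coef i x.
Proof.
  intros x. destruct (classic (exists i, (i < S x)%nat /\ block_coef i x <> RtoC 0)) as [[i [_ Hi]]|H].
  - right. exists i.
    assert (Hx : (N i <= x < N i + s i * len i)%nat).
    { destruct (lt_dec x (N i)) as [H|H]; [exfalso; apply Hi, block_coef_outside; lia|].
      destruct (le_lt_dec (N i + s i * len i) x) as [H'|H'];
        [exfalso; apply Hi, block_coef_outside; lia|lia]. }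
    split; auto. apply total_coef_eq_block.
    pose proof (N_lacunary i). pose proof (width_le_N i). lia.
  - left. apply Csum_zero. intros i Hi. apply NNPP. intros Hn. apply H. eauto.
Qed.

Lemma u_le_s : forall i k, Cmod (u i k) <= INR (s i).
Proof.
  intros i k. destruct (le_lt_dec (s i) k) as [H|H].
  - rewrite u_support, Cmod_0 by auto. apply pos_INR.
  - eapply Rle_trans; [|apply u_size].
    pose proof (Rsum_mono (fun k => Cmod (u i k)) (S k) (s i) H (fun k => Cmod_ge_0 _)) as H1.
    cbn [Rsum] in H1.
    pose proof (Rsum_nonneg (fun k => Cmod (u i k)) k (fun k _ => Cmod_ge_0 _)). lra.
Qed.

Lemma block_coef_le : forall i x, (N i <= x < N i + s i * len i)%nat ->
  Cmod (block_coef i x) * nu alpha x <= Rpower 2 (Rabs alpha) * INR (s i).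
Proof.
  intros i x Hx. unfold block_coef. destruct (lt_dec x (N i)); [lia|].
  pose proof (nu_pos alpha (N i)) as H1. pose proof (nu_pos alpha x) as H2.
  assert (Hi : 0 < / nu alpha (N i)) by (apply Rinv_0_lt_compat; auto).
  rewrite !Cmod_mult, !Cmod_R, (Rabs_pos_eq (/ _)) by lra.
  pose proof (nu_ratio_le alpha (N i) x (N_pos i) ltac:(pose proof (width_le_N i); lia)) as H3.
  unfold Rdiv in H3.
  pose proof (u_le_s i ((x - N i) mod s i)) as H4.
  pose proof (ker_le_1 i ((x - N i) / s i)) as H5.
  set (y := Cmod (u i ((x - N i) mod s i))) in *. set (c := Rabs (ker i ((x - N i) / s i))) in *.
  assert (Hy : 0 <= y) by apply Cmod_ge_0. assert (Hc : 0 <= c) by apply Rabs_pos.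
  replace (/ nu alpha (N i) * y * c * nu alpha x) with ((nu alpha x * / nu alpha (N i)) * (y * c)) by ring.
  apply Rmult_le_compat; auto.
  - apply Rmult_le_pos; lra.
  - apply Rmult_le_pos; auto.
  - nra.
Qed.

(** The growth is polynomial because the pattern of a block is no larger than
    the position of the block. *)
Lemma total_coef_tame : tame total_coef.
Proof.
  apply (tame_bound _ (Rpower 2 (Rabs alpha)) (1 - alpha)); [left; apply exp_pos|].
  intros x. assert (HP : 0 < Rpower 2 (Rabs alpha)) by apply exp_pos.
  destruct (total_coef_cases x) as [E|[i [Hx E]]]; rewrite E.
  - rewrite Cmod_0. apply Rmult_le_pos; left; apply exp_pos.
  - pose proof (block_coef_le i x Hx) as H. pose proof (nu_pos alpha x) as Hn.
    apply Rmult_le_reg_r with (nu alpha x); auto.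
    eapply Rle_trans; [exact H|]. rewrite Rmult_assoc. apply Rmult_le_compat_l; [lra|].
    unfold nu. rewrite <- Rpower_plus. replace (1 - alpha + alpha) with 1 by ring.
    rewrite Rpower_1 by (apply lt_0_INR; lia). apply le_INR. pose proof (s_le_N i). lia.
Qed.

(** Beyond the pattern, the shifted coefficients grow at a rate that does not
    depend on the block: later copies in the same block have size at most [s i],
    and the patterns of later blocks are small compared with their distance. *)
Lemma shifted_coef_far : forall i l k, (l < len i)%nat -> (s i <= k)%nat ->
  Cmod (shift_coef alpha (N i + s i * l) total_coef k)
    <= Rpower 2 (Rabs alpha) * Rpower (INR (S k)) (1 - alpha).
Proof.
  intros i l k Hl Hk. unfold shift_coef. set (n := (N i + s i * l)%nat).
  assert (Hn : (n < N i + s i * len i)%nat) by (unfold n; specialize (s_pos i); nia).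
  assert (HP : 0 < Rpower 2 (Rabs alpha)) by apply exp_pos.
  pose proof (nu_pos alpha (n + k)) as H1. pose proof (nu_pos alpha k) as H2.
  rewrite Cmod_mult, Cmod_R, Rabs_pos_eq by (apply Rdiv_le_0_compat; lra).
  destruct (total_coef_cases (n + k)) as [E|[j [Hx E]]]; rewrite E.
  - rewrite Cmod_0, Rmult_0_l. apply Rmult_le_pos; left; apply exp_pos.
  - pose proof (block_coef_le j (n + k) Hx) as H.
    assert (Hsk : (s j <= S k)%nat).
    { destruct (Nat.lt_trichotomy j i) as [Hj|[Hj|Hj]].
      - pose proof (N_mono j i Hj). pose proof (width_le_N j). unfold n in Hx. lia.
      - subst; lia.
      - pose proof (N_mono i j Hj). pose proof (width_le_N i). pose proof (s_le_N j). lia. }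
    apply le_INR in Hsk.
    apply Rmult_le_reg_r with (nu alpha k); auto.
    replace (Cmod (block_coef j (n + k)) * (nu alpha (n + k) / nu alpha k) * nu alpha k)
      with (Cmod (block_coef j (n + k)) * nu alpha (n + k)) by (field; lra).
    eapply Rle_trans; [exact H|]. rewrite Rmult_assoc. apply Rmult_le_compat_l; [lra|].
    unfold nu. rewrite <- Rpower_plus. replace (1 - alpha + alpha) with 1 by ring.
    rewrite Rpower_1 by (apply lt_0_INR; lia). auto.
Qed.

(** A slot is a position [N i + s i * l] with [ker i l = 1].  There the shifted
    coefficients are those of the pattern up to the factors
    [nu x / nu (N i)], which are close to 1 throughout a short window. *)
Lemma shifted_coef_near : forall i l delta, (l < len i)%nat -> ker i l = 1 -> 
  (forall x, (N i <= x < N i + s i * len i)%nat ->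
     Rsum (fun k => Cmod (u i k) / nu alpha k) (s i) * Rabs (nu alpha x / nu alpha (N i) - 1) <= delta) ->
  Rsum (fun k => Cmod (shift_coef alpha (N i + s i * l) total_coef k - u i k * RtoC (/ nu alpha k))%C) (s i)
    <= delta.
Proof.
  intros i l delta Hl Hker Hd.
  set (A := Rsum (fun k => Cmod (u i k) / nu alpha k) (s i)) in *.
  assert (Hterm : forall k, 0 <= Cmod (u i k) / nu alpha k).
  { intros k. apply Rdiv_le_0_compat; [apply Cmod_ge_0|apply nu_pos]. }
  assert (Hx : forall k, (k < s i)%nat -> (N i <= N i + (s i * l + k) < N i + s i * len i)%nat) by (intros; nia).
  assert (Hdelta : 0 <= delta).
  { specialize (s_pos i). eapply Rle_trans; [|apply (Hd _ (Hx O ltac:(lia)))].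
    apply Rmult_le_pos; [|apply Rabs_pos]. apply Rsum_nonneg. auto. }
  (* the general case divides by [A], which vanishes for the zero pattern *)
  destruct (Req_dec A 0) as [E0|E0].
  - apply Rle_trans with (1 * 0); [|lra]. rewrite <- E0. unfold A. rewrite <- Rsum_scal.
    assert (Hz : forall k, (k < s i)%nat -> u i k = RtoC 0).
    { intros k Hk. apply Cmod_eq_0.
      assert (Cmod (u i k) / nu alpha k = 0).
      { apply Rle_antisym; auto.
        pose proof (Rsum_mono (fun k => Cmod (u i k) / nu alpha k) (S k) (s i) Hk Hterm) as H1.
        cbn [Rsum] in H1. pose proof (Rsum_nonneg _ k (fun k _ => Hterm k)) as H2.
        fold A in H1. lra. }
      pose proof (nu_pos alpha k) as Hp.
      replace (Cmod (u i k)) with (Cmod (u i k) / nu alpha k * nu alpha k) by (field; lra).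
      rewrite H; ring. }
    apply Rsum_le. intros k Hk. unfold shift_coef. rewrite <- Nat.add_assoc.
    rewrite (total_coef_eq_block i).
    2:{ specialize (Hx k Hk). pose proof (N_lacunary i). pose proof (width_le_N i). lia. }
    rewrite block_coef_at, Hz by auto.
    match goal with |- Cmod ?x <= _ => replace x with (RtoC 0) by ring end.
    rewrite Cmod_0. rewrite Rmult_1_l. unfold Rdiv. lra.
  - assert (HA : 0 < A).
    { assert (0 <= A) by (apply Rsum_nonneg; auto). lra. }
    apply Rle_trans with (Rsum (fun k => delta / A * (Cmod (u i k) / nu alpha k)) (s i)).
    2:{ rewrite Rsum_scal. fold A. right. field. lra. }
    apply Rsum_le. intros k Hk. unfold shift_coef. rewrite <- Nat.add_assoc.
    rewrite (total_coef_eq_block i).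
    2:{ specialize (Hx k Hk). pose proof (N_lacunary i). pose proof (width_le_N i). lia. }
    rewrite block_coef_at, Hker by auto.
    pose proof (nu_pos alpha (N i)) as H1. pose proof (nu_pos alpha k) as H2.
    set (x := (N i + (s i * l + k))%nat).
    replace (RtoC (/ nu alpha (N i)) * u i k * RtoC 1 * RtoC (nu alpha x / nu alpha k) - u i k * RtoC (/ nu alpha k))%C
      with (u i k * RtoC (/ nu alpha k * (nu alpha x / nu alpha (N i) - 1)))%C.
    2:{ unfold Rdiv. rewrite !RtoC_mult, RtoC_minus, RtoC_mult. ring. }
    rewrite Cmod_mult, Cmod_R, Rabs_mult, (Rabs_pos_eq (/ _)) by (left; apply Rinv_0_lt_compat; auto).
    specialize (Hd x (Hx k Hk)).
    assert (Hr : Rabs (nu alpha x / nu alpha (N i) - 1) <= delta / A).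
    { apply (proj1 (Rle_div_r _ _ _ HA)). lra. }
    rewrite <- Rmult_assoc, Rmult_comm. apply Rmult_le_compat_r; [apply Hterm|exact Hr].
Qed.

Definition block_poly (i : nat) (z : C) : C :=
  (RtoC (/ nu alpha (N i)) * z ^ N i * Csum (fun k => u i k * z ^ k) (s i) * gap_poly (ker i) (s i) (len i) z)%C.

Lemma block_coef_sum : forall i z,
  Csum (fun k => block_coef i (N i + k) * z ^ (N i + k))%C (s i * len i) = block_poly i z.
Proof.
  intros i z. rewrite Csum_mult_length. unfold block_poly, gap_poly. rewrite <- Csum_scal.
  apply Csum_ext. intros l Hl.
  set (w := (RtoC (ker i l) * z ^ (s i * l))%C).
  rewrite (Csum_ext _ (fun k => RtoC (/ nu alpha (N i)) * z ^ N i * w * (u i k * z ^ k))%C).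
  - rewrite Csum_scal. ring.
  - intros k Hk. rewrite block_coef_at by auto. rewrite !Cpow_add_r. unfold w. ring.
Qed.

Lemma partial_sum_blocks : forall I z,
  Csum (fun x => total_coef x * z ^ x)%C (N I) = Csum (fun i => block_poly i z) I.
Proof.
  induction I as [|I IH]; intros z.
  - simpl. apply Csum_zero. intros x Hx. rewrite total_coef_before by auto. ring.
  - pose proof (N_lacunary I). pose proof (width_le_N I).
    replace (N (S I)) with (N I + (s I * len I + (N (S I) - N I - s I * len I)))%nat by lia.
    rewrite Csum_split, IH. cbn [Csum]. f_equal.
    rewrite Csum_split, (Csum_zero _ (N (S I) - N I - s I * len I)).
    + rewrite <- block_coef_sum. rewrite (Csum_ext _ (fun k => block_coef I (N I + k) * z ^ (N I + k))%C).
      * ring.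
      * intros k Hk. rewrite (total_coef_eq_block I) by lia. auto.
    + intros k Hk. rewrite (total_coef_eq_block I) by lia.
      rewrite block_coef_outside by lia. ring.
Qed.

(** On each circle the blocks from some index on contribute at most 1 in total;
    another 1 keeps the bound of an empty sum of blocks positive. *)
Lemma blocks_norm_bound : forall p (f : HD) r X, Rbar_lt 1 p -> 0 < r < 1 ->
  (forall z, disc z -> series_to total_coef z (f z)) ->
  (forall i, norm_bound p (fun t => block_poly i (circle_point r t)) (X i)) ->
  exists I, norm_bound p (fun t => f (circle_point r t)) (Rsum X I + 2).
Proof.
  intros p f r X Hp Hr Hf HX.
  set (R := (1 + r) / 2). assert (HR : r < R < 1) by (unfold R; lra).
  destruct (total_coef_tame R ltac:(lra)) as [M HM].
  destruct (geom_to_0 (r / R) (M / (1 - r / R)) 1) as [I HI]; [|lra|].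
  { split; [apply Rdiv_le_0_compat; lra|apply Rlt_div_l; lra]. }
  exists I. specialize (HI (N I) ltac:(pose proof (N_gt I); lia)).
  set (S := fun t => Csum (fun i => block_poly i (circle_point r t)) I).
  assert (HS : norm_bound p S (Rsum X I + 1)).
  { apply (norm_bound_Csum p (fun i t => block_poly i (circle_point r t))); auto; lra. }
  assert (HT : norm_bound p (fun t => f (circle_point r t) + - S t)%C 1).
  { apply norm_bound_sup; auto; [lra| |].
    - apply ccont_plus; [apply ccont_HD_circle; auto|apply ccont_opp, HS].
    - intros t. assert (Hz : Cmod (circle_point r t) = r) by (apply Cmod_circle; lra).
      pose proof (series_tail total_coef R M (circle_point r t) (N I) (f (circle_point r t))
        ltac:(lra) ltac:(lra) (fun k _ => HM k) (Hf (circle_point r t) ltac:(red; lra))) as H.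
      rewrite partial_sum_blocks, Hz in H. unfold S. unfold Cminus in H. unfold Rdiv in *. lra. }
  pose proof (norm_bound_plus p _ _ _ _ Hp HS HT) as H.
  replace (Rsum X I + 1 + 1) with (Rsum X I + 2) in H by ring.
  destruct H as [H0 [_ H]]. split; [auto|split].
  - apply ccont_HD_circle; auto.
  - assert (E : forall t, (S t + (f (circle_point r t) + - S t))%C = f (circle_point r t)) by (intros; ring).
    destruct p as [p| |].
    + erewrite RInt_ext; [exact H|]. intros t _. cbv beta. rewrite E. auto.
    + intros t. rewrite <- E. apply H.
    + intros t. rewrite <- E. apply H.
Qed.

End Blocks.

(** * Orbits near a given function *)

Lemma series_tail_disc : forall (a : nat -> C) R M rho z n l,
  0 <= rho < R -> Cmod z <= rho ->
  (forall k, (n <= k)%nat -> Cmod (a k) * R ^ k <= M) ->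
  series_to a z l ->
  Cmod (l - Csum (fun k => a k * z ^ k)%C n)%C <= M * (rho / R) ^ n / (1 - rho / R).
Proof.
  intros a R M rho z n l HR Hz HM Hl.
  eapply Rle_trans; [apply (series_tail a R M z n l ltac:(lra) ltac:(lra) HM Hl)|].
  assert (HM0 : 0 <= M).
  { eapply Rle_trans; [|apply (HM n); lia].
    apply Rmult_le_pos; [apply Cmod_ge_0|apply pow_le; lra]. }
  assert (H1 : 0 <= Cmod z / R) by (apply Rdiv_le_0_compat; [apply Cmod_ge_0|lra]).
  assert (H2 : Cmod z / R <= rho / R).
  { apply Rmult_le_compat_r; [left; apply Rinv_0_lt_compat; lra|auto]. }
  assert (H3 : rho / R < 1) by (apply Rlt_div_l; lra).
  unfold Rdiv at 1 4. apply Rmult_le_compat.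
  - apply Rmult_le_pos; [auto|apply pow_le; auto].
  - left; apply Rinv_0_lt_compat; lra.
  - apply Rmult_le_compat_l; auto. apply pow_incr; lra.
  - apply Rinv_le_contravar; lra.
Qed.

Lemma Csum_diff_le : forall (a b : nat -> C) z n, Cmod z <= 1 ->
  Cmod (Csum (fun k => a k * z ^ k) n - Csum (fun k => b k * z ^ k) n)%C
    <= Rsum (fun k => Cmod (a k - b k)%C) n.
Proof.
  intros a b z n Hz. rewrite <- Csum_minus. eapply Rle_trans; [apply Cmod_Csum|].
  apply Rsum_le. intros k _. replace (a k * z ^ k - b k * z ^ k)%C with ((a k - b k) * z ^ k)%C by ring.
  rewrite Cmod_mult. pose proof (Cmod_pow_le_1 z k Hz). pose proof (Cmod_ge_0 (a k - b k)%C). nra.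
Qed.

(** Four errors of a quarter of [eps] each: the tails of [F] and of [G], the
    deviation of [F] from the pattern [w], and that of the pattern from [G]. *)
Lemma close_from_coefficients : forall (a b w : nat -> C) (F G : C) R rho Ma Mb s d eps z,
  0 <= rho < R -> R <= 1 -> Cmod z <= rho ->
  series_to a z F -> series_to b z G ->
  (forall k, (s <= k)%nat -> Cmod (a k) * R ^ k <= Ma) ->
  (forall k, (d <= k)%nat -> Cmod (b k) * R ^ k <= Mb) ->
  Ma * (rho / R) ^ s / (1 - rho / R) < eps / 4 ->
  Mb * (rho / R) ^ d / (1 - rho / R) < eps / 4 ->
  (d <= s)%nat -> (forall k, (d <= k)%nat -> w k = RtoC 0) ->
  Rsum (fun k => Cmod (a k - w k)%C) s <= eps / 4 ->
  Rsum (fun k => Cmod (w k - b k)%C) d <= eps / 4 ->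
  Cmod (F - G)%C < eps.
Proof.
  intros a b w F G R rho Ma Mb s d eps z HR HR1 Hz HF HG Ha Hb HTa HTb Hds Hw Haw Hwb.
  pose proof (series_tail_disc a R Ma rho z s F HR Hz Ha HF) as H1.
  pose proof (series_tail_disc b R Mb rho z d G HR Hz Hb HG) as H2.
  pose proof (Csum_diff_le a w z s ltac:(lra)) as H3.
  pose proof (Csum_diff_le w b z d ltac:(lra)) as H4.
  rewrite (Csum_extend (fun k => w k * z ^ k)%C d s Hds) in H3.
  2:{ intros k Hk. rewrite Hw by lia. ring. }
  set (SA := Csum (fun k => a k * z ^ k)%C s) in *.
  set (SB := Csum (fun k => b k * z ^ k)%C d) in *.
  set (SW := Csum (fun k => w k * z ^ k)%C d) in *.
  pose proof (Cmod_minus_triangle F SA G) as T1.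
  pose proof (Cmod_minus_triangle SA SW G) as T2.
  pose proof (Cmod_minus_triangle SW SB G) as T3.
  rewrite (Cmod_minus_sym SB G) in T3. lra.
Qed.

(** * Density of the slots of a block *)

Lemma sum_n_m_Rsum : forall (h : nat -> R) n, sum_n_m h 1 n = Rsum (fun k => h (S k)) n.
Proof.
  intros h n. induction n as [|n IH].
  - rewrite sum_n_m_zero by lia. reflexivity.
  - rewrite sum_n_Sm by lia. rewrite IH. reflexivity.
Qed.

Lemma beta_mono : forall gamma m n, 0 < gamma -> (1 <= m <= n)%nat -> beta gamma m <= beta gamma n.
Proof.
  intros gamma m n Hg H. unfold beta. apply exp_le_compat, Rle_Rpower_l; [lra|].
  split; [apply lt_0_INR; lia|apply le_INR; lia].
Qed.

(** The slots of a block are distinct and have weight at least [beta gamma N]. *)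
Lemma slots_sum_lower : forall gamma (E : nat -> Prop) N s L (c : nat -> R), 0 < gamma ->
  (1 <= s)%nat -> (1 <= N)%nat ->
  (forall l, (l < L)%nat -> c l = 1 -> E (N + s * l)%nat) ->
  Rsum (fun l => is_one (c l)) L * beta gamma N <= sum_n_m (restrict E (beta gamma)) 1 (N + s * L).
Proof.
  intros gamma E N s L c Hg Hs HN HE. rewrite sum_n_m_Rsum.
  set (h := fun k => restrict E (beta gamma) (S k)).
  assert (Hh : forall k, 0 <= h k).
  { intros k. unfold h, restrict. destruct (excluded_middle_informative (E (S k))); [left; apply exp_pos|lra]. }
  apply Rle_trans with (Rsum h (N - 1 + s * L)); [|apply Rsum_mono; [lia|auto]].
  induction L as [|L IH].
  - cbn [Rsum]. rewrite Rmult_0_l. apply Rsum_nonneg. auto.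
  - specialize (IH (fun l Hl => HE l ltac:(lia))). cbn [Rsum].
    apply Rle_trans with (Rsum h (S (N - 1 + s * L))).
    2:{ apply Rsum_mono; [nia|auto]. }
    cbn [Rsum]. rewrite Rmult_plus_distr_r. apply Rplus_le_compat; auto.
    unfold is_one. destruct (Req_EM_T (c L) 1) as [H1|H1]; [|rewrite Rmult_0_l; auto].
    rewrite Rmult_1_l. unfold h, restrict. replace (S (N - 1 + s * L)) with (N + s * L)%nat by lia.
    destruct (excluded_middle_informative (E (N + s * L)%nat)) as [_|Hn].
    + apply beta_mono; auto. lia.
    + exfalso. apply Hn, HE; auto.
Qed.

(** The weights in a window of length [N ^ (1 - gamma)] are all comparable with
    [beta gamma N], and the total weight up to its end is at most a constant
    multiple of [N ^ (1 - gamma) * beta gamma N].  So the density at the end of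
    the window is at least the proportion of slots in it, up to a constant. *)
Lemma slots_density : forall gamma (E : nat -> Prop) N s L (c : nat -> R) m Q, 0 < gamma < 1 ->
  (1 <= s)%nat -> (1 <= N)%nat -> (s * L <= N)%nat ->
  (forall l, (l < L)%nat -> c l = 1 -> E (N + s * l)%nat) ->
  0 < m <= Rsum (fun l => is_one (c l)) L -> 0 < Q ->
  INR (s * L) <= Rpower (INR N) (1 - gamma) <= 2 * (Q * m) ->
  gamma / (8 * exp gamma * Q) <=
    sum_n_m (restrict E (beta gamma)) 1 (N + s * L) / sum_n_m (beta gamma) 1 (N + s * L).
Proof.
  intros gamma E N s L c m Q Hg Hs HN HsL HE Hm HQ HR.
  pose proof (slots_sum_lower gamma E N s L c ltac:(lra) Hs HN HE) as Hnum.
  pose proof (beta_sum_le gamma (N + s * L) Hg ltac:(lia)) as Hden.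
  pose proof (beta_window gamma N (s * L) Hg HN ltac:(apply HR)) as Hwin.
  assert (HbN : 0 < beta gamma N) by apply exp_pos.
  assert (HN0 : 0 < INR N) by (apply lt_0_INR; lia).
  assert (HP : Rpower (INR (N + s * L)) (1 - gamma) <= 2 * (2 * (Q * m))).
  { apply Rle_trans with (Rpower (2 * INR N) (1 - gamma)).
    - apply Rle_Rpower_l; [lra|]. split; [apply lt_0_INR; lia|].
      replace 2 with (INR 2) by (simpl; ring). rewrite <- mult_INR. apply le_INR. lia.
    - rewrite <- Rpower_mult_distr by lra. apply Rmult_le_compat; try (left; apply exp_pos); [|apply HR].
      rewrite <- (Rpower_1 2) at 2 by lra. apply Rle_Rpower; lra. }
  assert (He : 0 < exp gamma) by apply exp_pos.
  assert (Hbb : 0 < beta gamma (N + s * L)) by apply exp_pos.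
  assert (Hg2 : 0 < 2 / gamma) by (apply Rdiv_lt_0_compat; lra).
  assert (HQm : 0 < Q * m) by (apply Rmult_lt_0_compat; lra).
  assert (Hden2 : sum_n_m (beta gamma) 1 (N + s * L) <=
     2 / gamma * (2 * (2 * (Q * m))) * (exp gamma * beta gamma N)).
  { eapply Rle_trans; [exact Hden|]. apply Rmult_le_compat; auto; try lra.
    - apply Rmult_le_pos; [lra|left; apply exp_pos].
    - apply Rmult_le_compat_l; lra. }
  assert (Hpos : 0 < sum_n_m (beta gamma) 1 (N + s * L)).
  { rewrite sum_n_m_Rsum. replace (N + s * L)%nat with (S (N + s * L - 1)) by lia. cbn [Rsum].
    pose proof (Rsum_nonneg (fun k => beta gamma (S k)) (N + s * L - 1)
      (fun k _ => Rlt_le _ _ (exp_pos _))).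
    assert (0 < beta gamma (S (N + s * L - 1))) by apply exp_pos. lra. }
  apply (proj1 (Rle_div_r _ _ _ Hpos)).
  eapply Rle_trans; [|exact Hnum].
  apply Rle_trans with (gamma / (8 * exp gamma * Q) *
    (2 / gamma * (2 * (2 * (Q * m))) * (exp gamma * beta gamma N))).
  - apply Rmult_le_compat_l; auto. apply Rdiv_le_0_compat; [lra|].
    apply Rmult_lt_0_compat; [|auto]. lra.
  - replace (gamma / (8 * exp gamma * Q) * (2 / gamma * (2 * (2 * (Q * m))) * (exp gamma * beta gamma N)))
      with (m * beta gamma N) by (field; lra).
    apply Rmult_le_compat_r; lra.
Qed.

(** * Choice of the parameters *)

Lemma pow2_unbounded : forall x : R, exists n, forall m, (n <= m)%nat -> x <= INR (2 ^ m).
Proof.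
  intros x. destruct (nfloor_ex (Rmax x 0)) as [n [_ Hn]]; [apply Rmax_r|].
  exists (S n). intros m Hm. pose proof (Rmax_l x 0).
  assert (Hp : (S n <= 2 ^ m)%nat) by (pose proof (Nat.pow_gt_lin_r 2 m); lia).
  apply le_INR in Hp. rewrite S_INR in Hp. lra.
Qed.

(** The gap [s] is at least the index of the pattern, so later approximations of a
    function use wider gaps; [lam] records how much smaller than its window a
    kernel must be to absorb both the gap and the size of the pattern. *)
Lemma pattern_parameters : forall theta j, 0 < theta -> exists sl : nat * nat,
  let s := fst sl in let lam := snd sl in
  (1 <= s)%nat /\ (j <= s)%nat /\ (pattern_length j <= s)%nat /\
  Rsum (fun k => Cmod (pattern j k)) s <= INR s /\ (4 * s <= 2 ^ lam)%nat /\
  Rsum (fun k => Cmod (pattern j k)) s + 1 <= Rpower (INR (2 ^ lam)) theta.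
Proof.
  intros theta j Ht. set (A := Rsum (fun k => Cmod (pattern j k)) (pattern_length j)).
  assert (HA : 0 <= A) by (apply Rsum_nonneg; intros; apply Cmod_ge_0).
  assert (HAs : forall s, (pattern_length j <= s)%nat -> Rsum (fun k => Cmod (pattern j k)) s = A).
  { intros s Hs. replace s with (pattern_length j + (s - pattern_length j))%nat by lia.
    rewrite Rsum_split. fold A. rewrite (Rsum_ext _ (fun _ => 0)).
    - rewrite Rsum_const. ring.
    - intros k _. unfold pattern.
      destruct (lt_dec (pattern_length j + k) (pattern_length j)); [lia|]. apply Cmod_0. }
  destruct (nfloor_ex A HA) as [n [_ Hn]].
  set (s := (1 + j + pattern_length j + n)%nat).
  destruct (pow2_unbounded (Rmax (INR (4 * s)) (Rpower (A + 1) (/ theta)))) as [lam Hlam].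
  specialize (Hlam lam (Nat.le_refl _)).
  exists (s, lam). cbn [fst snd].
  pose proof (Rmax_l (INR (4 * s)) (Rpower (A + 1) (/ theta))) as H1.
  pose proof (Rmax_r (INR (4 * s)) (Rpower (A + 1) (/ theta))) as H2.
  rewrite HAs by (unfold s; lia).
  repeat split; try (unfold s; lia).
  - apply Rle_trans with (INR n + 1); [lra|]. rewrite <- S_INR. apply le_INR. unfold s; lia.
  - apply INR_le. lra.
  - replace (A + 1) with (Rpower (Rpower (A + 1) (/ theta)) theta).
    + apply Rle_Rpower_l; [lra|]. split; [apply exp_pos|lra].
    + rewrite Rpower_mult, Rinv_l, Rpower_1; lra.
Qed.

Lemma Rpower_near_1 : forall a eps, 0 < eps -> exists d, 0 < d /\
  forall y, Rabs (y - 1) < d -> Rabs (Rpower y a - 1) < eps.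
Proof.
  intros a eps He.
  assert (Hc : continuous (fun y => Rpower y a) 1).
  { apply (@ex_derive_continuous R_AbsRing R_NormedModule). unfold Rpower. auto_derive. lra. }
  destruct (proj1 (filterlim_locally _ _) Hc (mkposreal eps He)) as [d Hd].
  exists d. split; [apply cond_pos|]. intros y Hy. specialize (Hd y Hy).
  rewrite Rpower_1_l in Hd. exact Hd.
Qed.

(** A window of length [N ^ (1 - gamma)] is short compared with [N]. *)
Lemma nu_almost_constant : forall gamma alpha B eps, 0 < gamma < 1 -> 0 <= B -> 0 < eps ->
  exists E0, forall E N, (E0 <= E)%nat -> (2 ^ E <= N)%nat ->
    INR (2 ^ E) <= Rpower (INR N) (1 - gamma) ->
    forall x, (N <= x <= N + 2 ^ E)%nat -> B * Rabs (nu alpha x / nu alpha N - 1) <= eps.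
Proof.
  intros gamma alpha B eps Hg HB He.
  destruct (Rpower_near_1 alpha (eps / (B + 1))) as [d [Hd Hn]]; [apply Rdiv_lt_0_compat; lra|].
  destruct (pow2_unbounded (Rpower (2 / d) (/ gamma))) as [E0 HE0].
  exists E0. intros E N HE HN HR x Hx. specialize (HE0 E HE).
  pose proof (INR_pow2_pos E) as H2E.
  assert (HNp : INR (2 ^ E) <= INR N) by (apply le_INR; auto).
  assert (HN1 : INR (S N) = INR N + 1) by apply S_INR.
  assert (HX : INR N <= INR x <= INR N + INR (2 ^ E)).
  { rewrite <- plus_INR. split; apply le_INR; lia. }
  set (y := INR (S x) / INR (S N)).
  assert (Hy : nu alpha x / nu alpha N = Rpower y alpha).
  { unfold nu. replace (INR (S x)) with (INR (S N) * y) by (unfold y; field; lra).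
    rewrite <- Rpower_mult_distr; [field; apply Rgt_not_eq, exp_pos|lra|].
    unfold y. apply Rdiv_lt_0_compat; [rewrite S_INR|]; lra. }
  assert (Hgam : 2 / d <= Rpower (INR N) gamma).
  { replace (2 / d) with (Rpower (Rpower (2 / d) (/ gamma)) gamma).
    - apply Rle_Rpower_l; [lra|]. split; [apply exp_pos|lra].
    - rewrite Rpower_mult, Rinv_l, Rpower_1; try lra. apply Rdiv_lt_0_compat; lra. }
  assert (HE1 : Rpower (INR N) (1 - gamma) * Rpower (INR N) gamma = INR N).
  { rewrite <- Rpower_plus. replace (1 - gamma + gamma) with 1 by ring. apply Rpower_1. lra. }
  assert (Hyd : Rabs (y - 1) < d).
  { replace (y - 1) with ((INR x - INR N) / INR (S N)).
    2:{ unfold y. rewrite (S_INR x), HN1. field. lra. }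
    rewrite Rabs_pos_eq by (apply Rdiv_le_0_compat; lra).
    apply Rlt_div_l; [lra|].
    assert (H1 : Rpower (INR N) (1 - gamma) * (2 / d) <= INR N).
    { apply Rle_trans with (Rpower (INR N) (1 - gamma) * Rpower (INR N) gamma); [|lra].
      apply Rmult_le_compat_l; [left; apply exp_pos|auto]. }
    apply Rmult_le_compat_l with (r := d) in H1; [|lra].
    replace (d * (Rpower (INR N) (1 - gamma) * (2 / d))) with (2 * Rpower (INR N) (1 - gamma)) in H1 by (field; lra).
    nra. }
  rewrite Hy. specialize (Hn y Hyd).
  apply Rle_trans with (B * (eps / (B + 1))); [apply Rmult_le_compat_l; lra|].
  apply Rle_trans with ((B + 1) * (eps / (B + 1))); [|right; field; lra].
  apply Rmult_le_compat_r; [|lra]. left. apply Rdiv_lt_0_compat; lra.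
Qed.

Lemma block_position : forall gamma alpha B eps lam P, 0 < gamma < 1 -> 0 <= B -> 0 < eps ->
  exists EN : nat * nat, let E := fst EN in let N := snd EN in
    (lam <= E)%nat /\ (P <= N)%nat /\ (2 ^ E <= N)%nat /\
    INR (2 ^ E) <= Rpower (INR N) (1 - gamma) <= 2 * INR (2 ^ E) /\
    forall x, (N <= x <= N + 2 ^ E)%nat -> B * Rabs (nu alpha x / nu alpha N - 1) <= eps.
Proof.
  intros gamma alpha B eps lam P Hg HB He.
  destruct (nu_almost_constant gamma alpha B eps Hg HB He) as [E0 HE0].
  set (E := (lam + E0 + P)%nat).
  destruct (window_position gamma E Hg) as [N [HN HR]].
  exists (E, N). cbn [fst snd].
  assert (HP : (P <= 2 ^ E)%nat) by (pose proof (Nat.pow_gt_lin_r 2 E); unfold E in *; lia).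
  repeat split; try apply HR; try (unfold E in *; lia).
  apply (HE0 E N); auto; [unfold E; lia|apply HR].
Qed.

(** * Assembly *)

Lemma inv_nu_le : forall alpha N, (2 <= N)%nat ->
  / nu alpha N <= Rpower 2 (Rabs alpha) * Rpower (INR N) (- alpha).
Proof.
  intros alpha N HN.
  pose proof (nu_ratio_le (- alpha) (N - 1) N ltac:(lia) ltac:(lia)) as H.
  rewrite Rabs_Ropp in H. unfold nu in H. replace (S (N - 1)) with N in H by lia.
  unfold nu. rewrite <- Rpower_Ropp.
  assert (HP : 0 < Rpower (INR N) (- alpha)) by apply exp_pos.
  apply Rmult_le_compat_r with (r := Rpower (INR N) (- alpha)) in H; [|lra].
  unfold Rdiv in H. rewrite Rmult_assoc, Rinv_l, Rmult_1_r in H by lra. exact H.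
Qed.

Definition pattern_index (i : nat) : nat := fst (of_nat i).

Lemma pattern_index_often : forall j n0, exists i, (n0 <= i)%nat /\ pattern_index i = j.
Proof.
  intros j n0. exists (to_nat (j, n0)). split.
  - pose proof (to_nat_non_decreasing j n0). lia.
  - unfold pattern_index. rewrite cancel_of_to. auto.
Qed.

(** In block [i] the amplitude of the pattern is absorbed by using the kernel of
    order [2 ^ (E - lam)] only, where [2 ^ lam] depends on the pattern alone: the
    block then satisfies a norm estimate without any reference to the pattern,
    while the slots keep a positive proportion of the window. *)
Lemma universal_function : forall gamma p theta alpha c A,
  0 < gamma < 1 -> Rbar_lt 1 p -> 0 < theta -> is_kernel p theta c A ->
  exists (f : HD) (N : nat -> nat) (D : R),
    U_freq_hypercyclic gamma (taylor_shift alpha) f /\ 0 < D /\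
    (forall i, (1 <= N i)%nat) /\ (forall i, (4 * N i <= N (S i))%nat) /\
    forall r, 0 < r < 1 -> exists n,
      norm_bound p (fun t => f (circle_point r t))
        (Rsum (fun i => D * (Rpower (INR (N i)) ((1 - gamma) * theta - alpha) * r ^ N i)) n + 2).
Proof.
  intros gamma p theta alpha c A Hg Hp Ht [HA Hker].
  destruct (choice_fun _ _ _ (fun j => pattern_parameters theta j Ht)) as [sl Hsl].
  set (s := fun j => fst (sl j)). set (lam := fun j => snd (sl j)).
  set (T := fun j => Rsum (fun k => Cmod (pattern j k) / nu alpha k) (s j)).
  assert (HT : forall j, 0 <= T j).
  { intros j. apply Rsum_nonneg. intros k _. apply Rdiv_le_0_compat; [apply Cmod_ge_0|apply nu_pos]. }
  destruct (choice_fun _ _ _ (fun jP : nat * nat => block_position gamma alpha (T (fst jP)) (/ INR (S (fst jP)))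
     (lam (fst jP)) (4 * snd jP + 4 * s (fst jP)) Hg (HT (fst jP))
     (Rinv_0_lt_compat _ (lt_0_INR _ (Nat.lt_0_succ (fst jP)))))) as [next Hnext].
  (* the blocks are placed one after the other, [EN i] being the pair of the
     exponent of the window length and of the position *)
  set (EN := fix EN i := match i with O => next (pattern_index 0, 0%nat)
     | S i' => next (pattern_index (S i'), snd (EN i')) end).
  set (E := fun i => fst (EN i)). set (N := fun i => snd (EN i)).
  set (e := fun i => (E i - lam (pattern_index i))%nat).
  assert (HEN : forall i, (lam (pattern_index i) <= E i)%nat /\ (4 * s (pattern_index i) <= N i)%nat /\
    (2 ^ E i <= N i)%nat /\
    INR (2 ^ E i) <= Rpower (INR (N i)) (1 - gamma) <= 2 * INR (2 ^ E i) /\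
    forall x, (N i <= x <= N i + 2 ^ E i)%nat ->
      T (pattern_index i) * Rabs (nu alpha x / nu alpha (N i) - 1) <= / INR (S (pattern_index i))).
  { intros i. destruct i as [|i].
    - destruct (Hnext (pattern_index 0, 0%nat)) as [H1 [H2 [H3 [H4 H5]]]]. cbn [fst snd] in *.
      unfold E, N; cbn [EN]. repeat split; auto; try apply H4; lia.
    - destruct (Hnext (pattern_index (S i), snd (EN i))) as [H1 [H2 [H3 [H4 H5]]]]. cbn [fst snd] in *.
      unfold E, N; cbn [EN]. repeat split; auto; try apply H4; lia. }
  assert (HN4 : forall i, (4 * N i <= N (S i))%nat).
  { intros i. destruct (Hnext (pattern_index (S i), snd (EN i))) as [_ [H2 _]]. cbn [fst snd] in *.
    unfold N at 2; cbn [EN]. unfold N. lia. }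
  assert (Hs : forall j, (1 <= s j)%nat) by (intros j; apply (Hsl j)).
  assert (Hw : forall i, (s (pattern_index i) * (4 * 2 ^ e i) <= 2 ^ E i)%nat).
  { intros i. destruct (Hsl (pattern_index i)) as [_ [_ [_ [_ [H _]]]]].
    fold (s (pattern_index i)) in H. fold (lam (pattern_index i)) in H.
    destruct (HEN i) as [HE _]. replace (E i) with (lam (pattern_index i) + e i)%nat by (unfold e; lia).
    rewrite Nat.pow_add_r. nia. }
  assert (HwN : forall i, (s (pattern_index i) * (4 * 2 ^ e i) <= N i)%nat).
  { intros i. specialize (Hw i). destruct (HEN i) as [_ [_ [H _]]]. lia. }
  assert (HsN : forall i, (4 * s (pattern_index i) <= N i)%nat) by (intros i; apply (HEN i)).
  assert (HuS : forall i k, (s (pattern_index i) <= k)%nat -> pattern (pattern_index i) k = RtoC 0).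
  { intros i k Hk. destruct (Hsl (pattern_index i)) as [_ [_ [H _]]].
    fold (s (pattern_index i)) in H. unfold pattern.
    destruct (lt_dec k (pattern_length (pattern_index i))); [lia|auto]. }
  assert (HuA : forall i, Rsum (fun k => Cmod (pattern (pattern_index i) k)) (s (pattern_index i)) <= INR (s (pattern_index i)))
    by (intros i; apply (Hsl (pattern_index i))).
  assert (Hk1 : forall i l, Rabs (c (e i) l) <= 1) by (intros i; apply (Hker (e i))).
  assert (Hk0 : forall i l, (4 * 2 ^ e i <= l)%nat -> c (e i) l = 0) by (intros i; apply (Hker (e i))).
  assert (Hs' : forall i, (1 <= s (pattern_index i))%nat) by (intros; apply Hs).
  set (a := total_coef alpha (fun i => pattern (pattern_index i)) (fun i => c (e i)) (fun i => s (pattern_index i)) N).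
  assert (Hatame : tame a).
  { unfold a. apply total_coef_tame with (len := fun i => (4 * 2 ^ e i)%nat); auto. }
  destruct (HD_of_coefficients a Hatame) as [f Hf].
  exists f, N, (A * Rpower 2 (Rabs alpha)).
  assert (HP2 : 0 < Rpower 2 (Rabs alpha)) by apply exp_pos.
  assert (HN1 : forall i, (4 <= N i)%nat) by (intros i; specialize (HsN i); specialize (Hs' i); lia).
  split; [|split; [|split; [|split]]]; auto.
  - intros U HU [g Ug]. destruct (HU g Ug) as [K [eps [HKc [HKd [He HUg]]]]].
    destruct (taylor_series_on_disc g) as [b Hb].
    destruct (compact_in_smaller_disc K HKc HKd) as [rho [Hrho HK]].
    set (R := (1 + rho) / 2). assert (HR : rho < R < 1) by (unfold R; lra).
    assert (Hq : 0 <= rho / R < 1).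
    { split; [apply Rdiv_le_0_compat; lra|apply Rlt_div_l; lra]. }
    destruct (tame_of_series b g Hb R ltac:(lra)) as [Mb HMb].
    destruct (geom_to_0 (rho / R) (Mb / (1 - rho / R)) (eps / 4) Hq ltac:(lra)) as [d Hd].
    specialize (Hd d (Nat.le_refl _)).
    destruct (Rpower_geom_bounded (1 - alpha) R ltac:(lra)) as [B0 [HB00 HB0]].
    set (Ma := Rpower 2 (Rabs alpha) * B0).
    destruct (geom_to_0 (rho / R) (Ma / (1 - rho / R)) (eps / 4) Hq ltac:(lra)) as [j1 Hj1].
    destruct (archimed_cor1 (eps / 4) ltac:(lra)) as [j2 [Hj2 Hj20]].
    set (V := Rsum (fun k => / nu alpha k) d).
    assert (HV : 0 <= V) by (apply Rsum_nonneg; intros; left; apply Rinv_0_lt_compat, nu_pos).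
    (* patterns describe functions in the coordinates of the plain shift, hence
       the factors [nu]; a large index [j] makes the gap wide enough *)
    destruct (pattern_dense (fun k => b k * RtoC (nu alpha k))%C d (eps / 4 / (V + 1)) (j1 + j2))
      as [j [Hj [Hjd Hju]]].
    { apply Rdiv_lt_0_compat; lra. }
    assert (Hjs : (j <= s j)%nat) by apply (Hsl j).
    assert (Hds : (d <= s j)%nat) by (rewrite <- Hjd; apply (Hsl j)).
    set (w := fun k => (pattern j k * RtoC (/ nu alpha k))%C).
    assert (Hw0 : forall k, (d <= k)%nat -> w k = RtoC 0).
    { intros k Hk. unfold w, pattern. rewrite Hjd. destruct (lt_dec k d); [lia|]. ring. }
    assert (Hwb : Rsum (fun k => Cmod (w k - b k)%C) d <= eps / 4).
    { apply Rle_trans with (Rsum (fun k => eps / 4 / (V + 1) * / nu alpha k) d).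
      - apply Rsum_le. intros k Hk. pose proof (nu_pos alpha k) as Hn.
        assert (Hi : 0 < / nu alpha k) by (apply Rinv_0_lt_compat; auto).
        replace (w k - b k)%C with ((pattern j k - b k * RtoC (nu alpha k)) * RtoC (/ nu alpha k))%C.
        + rewrite Cmod_mult, Cmod_R, Rabs_pos_eq by lra. apply Rmult_le_compat_r; [lra|]. left; auto.
        + assert (E1 : (RtoC (nu alpha k) * RtoC (/ nu alpha k))%C = RtoC 1)
            by (rewrite <- RtoC_mult, Rinv_r by lra; reflexivity).
          transitivity (pattern j k * RtoC (/ nu alpha k)
            - b k * (RtoC (nu alpha k) * RtoC (/ nu alpha k)))%C; [ring|].
          rewrite E1. unfold w. ring.
      - rewrite Rsum_scal. fold V. apply Rle_trans with (eps / 4 / (V + 1) * (V + 1)); [|right; field; lra].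
        apply Rmult_le_compat_l; [|lra]. left. apply Rdiv_lt_0_compat; lra. }
    assert (Hslot : forall i l, pattern_index i = j -> (l < 4 * 2 ^ e i)%nat -> c (e i) l = 1 ->
       U (Nat.iter (N i + s j * l) (taylor_shift alpha) f)).
    { intros i l Hi Hl Hc. apply HUg. intros z Hz.
      assert (Hzr : Cmod z <= rho) by auto.
      apply (close_from_coefficients (shift_coef alpha (N i + s j * l) a) b w _ _ R rho Ma Mb (s j) d eps z);
        auto; try lra.
      - apply taylor_shift_iter_coef; [exact Hf|red; lra].
      - intros k Hk.
        assert (Hfar : Cmod (shift_coef alpha (N i + s j * l) a k) <=
           Rpower 2 (Rabs alpha) * Rpower (INR (S k)) (1 - alpha)).
        { rewrite <- Hi. unfold a.
          apply (shifted_coef_far alpha (fun i => pattern (pattern_index i)) (fun i => c (e i))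
            (fun i => s (pattern_index i)) (fun i => (4 * 2 ^ e i)%nat) N); auto. rewrite Hi; auto. }
        apply Rle_trans with (Rpower 2 (Rabs alpha) * (Rpower (INR (S k)) (1 - alpha) * R ^ k)).
        + rewrite <- Rmult_assoc. apply Rmult_le_compat_r; [apply pow_le; lra|exact Hfar].
        + apply Rmult_le_compat_l; [lra|apply HB0].
      - specialize (Hj1 (s j) ltac:(lia)). unfold Rdiv in *. lra.
      - apply Rle_trans with (/ INR (S j)).
        + unfold w. rewrite <- Hi. unfold a.
          apply (shifted_coef_near alpha (fun i => pattern (pattern_index i)) (fun i => c (e i))
            (fun i => s (pattern_index i)) (fun i => (4 * 2 ^ e i)%nat) N); auto.
          intros x Hx. destruct (HEN i) as [_ [_ [_ [_ H5]]]]. apply H5.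
          specialize (Hw i). lia.
        + assert (/ INR (S j) <= / INR j2); [|lra].
          apply Rinv_le_contravar; [apply lt_0_INR; auto|apply le_INR; lia]. }
    apply LimSup_pos with (gamma / (8 * exp gamma * INR (2 ^ lam j))).
    { apply Rdiv_lt_0_compat; [lra|]. apply Rmult_lt_0_compat; [|apply INR_pow2_pos].
      apply Rmult_lt_0_compat; [lra|apply exp_pos]. }
    (* the quotient is large at the end of each of the blocks that use [j] *)
    intros n0. destruct (pattern_index_often j n0) as [i [Hi0 Hi]].
    exists (N i + s j * (4 * 2 ^ e i))%nat. split.
    + pose proof (N_gt (fun i => s (pattern_index i)) N Hs' HsN HN4 i). lia.
    + destruct (HEN i) as [HE1 [HE2 [HE3 [HE4 _]]]]. rewrite Hi in HE1.
      assert (H2 : INR (2 ^ E i) = INR (2 ^ lam j) * INR (2 ^ e i)).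
      { rewrite <- mult_INR, <- Nat.pow_add_r. f_equal. f_equal. unfold e. rewrite Hi. lia. }
      apply (slots_density gamma _ (N i) (s j) (4 * 2 ^ e i) (c (e i)) (INR (2 ^ e i))); auto.
      * specialize (HN1 i). lia.
      * specialize (HwN i). rewrite Hi in HwN. exact HwN.
      * split; [apply INR_pow2_pos|apply (Hker (e i))].
      * apply INR_pow2_pos.
      * rewrite <- H2. split; [|apply HE4]. eapply Rle_trans; [|apply HE4].
        apply le_INR. specialize (Hw i). rewrite Hi in Hw. exact Hw.
  - apply Rmult_lt_0_compat; auto.
  - intros i. specialize (HN1 i). lia.
  - intros r Hr.
    apply (blocks_norm_bound alpha (fun i => pattern (pattern_index i)) (fun i => c (e i))
      (fun i => s (pattern_index i)) (fun i => (4 * 2 ^ e i)%nat) N); auto.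
    intros i. unfold block_poly.
    destruct (Hsl (pattern_index i)) as [_ [_ [_ [_ [_ HA1]]]]].
    fold (s (pattern_index i)) in HA1. fold (lam (pattern_index i)) in HA1.
    set (j := pattern_index i) in *.
    set (Aj := Rsum (fun k => Cmod (pattern j k)) (s j)) in *.
    assert (HAj : 0 <= Aj) by (apply Rsum_nonneg; intros; apply Cmod_ge_0).
    destruct (HEN i) as [HE1 [_ [_ [HE4 _]]]]. fold j in HE1.
    pose proof (nu_pos alpha (N i)) as Hn.
    assert (Hin : 0 < / nu alpha (N i)) by (apply Rinv_0_lt_compat; auto).
    assert (Hrn : 0 < r ^ N i) by (apply pow_lt; lra).
    destruct (Hker (e i)) as [_ [_ [_ Hnb]]].
    specialize (Hnb (s j) r ltac:(apply Hs) Hr).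
    apply norm_bound_weaken with (/ nu alpha (N i) * r ^ N i * (Aj + 1) * (A * Rpower (INR (2 ^ e i)) theta)); auto.
    + apply (norm_bound_mult p (fun t => gap_poly (c (e i)) (s j) (4 * 2 ^ e i) (circle_point r t))
        (fun t => RtoC (/ nu alpha (N i)) * circle_point r t ^ N i *
           Csum (fun k => pattern j k * circle_point r t ^ k) (s j))%C); auto.
      * repeat apply ccont_mult; [apply ccont_const|apply ccont_pow, ccont_circle|].
        apply (ccont_Csum (fun k t => pattern j k * circle_point r t ^ k)%C). intros k.
        apply ccont_mult; [apply ccont_const|apply ccont_pow, ccont_circle].
      * apply Rmult_lt_0_compat; [apply Rmult_lt_0_compat; auto|lra].
      * intros t. assert (Hz : Cmod (circle_point r t) = r) by (apply Cmod_circle; lra).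
        rewrite !Cmod_mult, Cmod_pow, Hz, Cmod_R, Rabs_pos_eq by lra.
        apply Rmult_le_compat_l; [apply Rmult_le_pos; lra|].
        apply Rle_trans with Aj; [|lra].
        eapply Rle_trans; [apply Cmod_Csum|]. apply Rsum_le. intros k _.
        rewrite Cmod_mult. pose proof (Cmod_pow_le_1 (circle_point r t) k ltac:(lra)).
        pose proof (Cmod_ge_0 (pattern j k)). nra.
    + set (x := Rpower (INR (2 ^ e i)) theta).
      assert (Hx : 0 < x) by apply exp_pos.
      assert (HNi : 0 < INR (N i)) by (apply lt_0_INR; specialize (HN1 i); lia).
      (* the amplitude is traded for the missing factor [2 ^ lam j] in the order *)
      assert (Hamp : (Aj + 1) * x <= Rpower (INR (N i)) ((1 - gamma) * theta)).
      { apply Rle_trans with (Rpower (INR (2 ^ lam j)) theta * x); [apply Rmult_le_compat_r; lra|].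
        unfold x. rewrite Rpower_mult_distr by apply INR_pow2_pos.
        rewrite <- mult_INR, <- Nat.pow_add_r. replace (lam j + e i)%nat with (E i) by (unfold e; fold j; lia).
        rewrite <- Rpower_mult. apply Rle_Rpower_l; [lra|]. split; [apply INR_pow2_pos|apply HE4]. }
      pose proof (inv_nu_le alpha (N i) ltac:(specialize (HN1 i); lia)) as Hinv.
      replace ((1 - gamma) * theta - alpha) with (- alpha + (1 - gamma) * theta) by ring.
      rewrite Rpower_plus.
      set (y := Rpower (INR (N i)) ((1 - gamma) * theta)) in *.
      set (v := Rpower (INR (N i)) (- alpha)) in *.
      replace (/ nu alpha (N i) * r ^ N i * (Aj + 1) * (A * x)) with
        (A * r ^ N i * (/ nu alpha (N i) * ((Aj + 1) * x))) by ring.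
      replace (A * Rpower 2 (Rabs alpha) * (v * y * r ^ N i)) with
        (A * r ^ N i * (Rpower 2 (Rabs alpha) * v * y)) by ring.
      apply Rmult_le_compat_l; [apply Rmult_le_pos; lra|].
      apply Rmult_le_compat; auto; try lra. apply Rmult_le_pos; lra.
Qed.

Theorem theorem4p10 :
  forall (gamma : R) (p : Rbar) (q alpha : R),
    0 < gamma < 1 ->
    Rbar_lt 1 p ->
    conjugate p q ->
    (alpha < (1 - gamma) / Rmax 2 q ->
      exists (f : HD) (A : R),
        U_freq_hypercyclic gamma (taylor_shift alpha) f /\ 0 < A /\
        forall r : R, 0 < r < 1 ->
          Rbar_le (M_p p f r)
            (A * Rpower (1 - r) (alpha - (1 - gamma) / Rmax 2 q))) /\
    (alpha > (1 - gamma) / Rmax 2 q ->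
      exists (f : HD) (A : R),
        U_freq_hypercyclic gamma (taylor_shift alpha) f /\ 0 < A /\
        forall r : R, 0 < r < 1 -> Rbar_le (M_p p f r) A).
Proof.
  intros gamma p q alpha Hg Hp Hq.
  assert (Hm : 0 < Rmax 2 q) by (pose proof (Rmax_l 2 q); lra).
  destruct (kernel_exists p q Hp Hq) as [c [A HK]].
  destruct (universal_function gamma p (/ Rmax 2 q) alpha c A Hg Hp (Rinv_0_lt_compat _ Hm) HK)
    as [f [N [D [HU [HD [HN1 [HN4 Hf]]]]]]].
  fold ((1 - gamma) / Rmax 2 q) in Hf.
  set (tau := (1 - gamma) / Rmax 2 q - alpha) in *.
  split; intros Ha.
  - destruct (lacunary_sum_le tau) as [B [HB0 HB]]; [unfold tau; lra|].
    exists f, (D * B + 2). split; [exact HU|split; [nra|]].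
    intros r Hr. destruct (Hf r Hr) as [n Hn].
    apply (norm_bound_M_p p f r) in Hn; [|exact Hp].
    eapply Rbar_le_trans; [exact Hn|]. simpl.
    replace (alpha - (1 - gamma) / Rmax 2 q) with (- tau) by (unfold tau; ring).
    rewrite Rsum_scal. specialize (HB N r n Hr HN1 HN4).
    assert (H1 : 1 <= Rpower (1 - r) (- tau)).
    { rewrite Rpower_Ropp, <- Rinv_1. apply Rinv_le_contravar; [apply exp_pos|].
      apply Rle_trans with (Rpower 1 tau); [|right; apply Rpower_1_l].
      apply Rle_Rpower_l; unfold tau; lra. }
    apply Rmult_le_compat_l with (r := D) in HB; [|lra]. lra.
  - destruct (lacunary_sum_bounded tau) as [B [HB0 HB]]; [unfold tau; lra|].
    exists f, (D * B + 2). split; [exact HU|split; [nra|]].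
    intros r Hr. destruct (Hf r Hr) as [n Hn].
    apply (norm_bound_M_p p f r) in Hn; [|exact Hp].
    eapply Rbar_le_trans; [exact Hn|]. simpl.
    rewrite Rsum_scal. specialize (HB N r n Hr HN1 HN4).
    apply Rmult_le_compat_l with (r := D) in HB; [|lra]. lra.
Qed.
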